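(* Let $k$ be a perfect field of characteristic two and let $\mathcal{N}=k^*\times k^*\times k^*\times (k/\mathrm{AS}(k))$. For $(a,b,c,d)\in\mathcal{N}$ let $C_{abcd}$ be the smooth projective curve of genus two over $k$ with quasi-affine model $y^2+y=ax+\frac{b}{x}+\frac{c}{x+1}+d$. Let $\Gamma=\{x,\,1/x,\,1+x,\,x/(1+x),\,1/(1+x),\,(1+x)/x\}\subseteq \mathrm{PGL}_2(k)$, a group isomorphic to $S_3$, acting on $\mathcal{N}$ on the right by $$(a,b,c,d)^{\gamma}=\begin{cases}(a,b,c,d)&\text{if }\gamma(x)=x,\\ (b,a,c,d+c)&\text{if }\gamma(x)=1/x,\\ (a,c,b,d+a)&\text{if }\gamma(x)=1+x,\\ (c,b,a,d+c+b+a)&\text{if }\gamma(x)=x/(1+x),\\ (b,c,a,d+c+b)&\text{if }\gamma(x)=1/(1+x),\\ (c,a,b,d+b+a)&\text{if }\gamma(x)=(1+x)/x.\end{cases}$$ 1. For any $(a,b,c,d),(a',b',c',d')\in\mathcal{N}$, the curves $C_{a'b'c'd'}$ and $C_{abcd}$ are $k$-isomorphic if and only if $(a',b',c',d')=(a,b,c,d)^\gamma$ for some $\gamma\in\Gamma$. 2. For any $(a,b,c,d)\in\mathcal{N}$ there is a split exact sequence $$1\to\langle\iota\rangle\to \mathrm{Aut}_k(C_{abcd})\to\Gamma_{abcd}\to1,$$ where $\Gamma_{abcd}$ is the isotropy group of $(a,b,c,d)$ under the action of $\Gamma$, and $$\Gamma_{abcd}\simeq\begin{cases}S_3&\text{if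 }a=b=c\in\mathrm{AS}(k),\\ C_3&\text{if }a=b=c\notin\mathrm{AS}(k),\\ C_2&\text{if exactly two of }a,b,c\text{ coincide and the third belongs to }\mathrm{AS}(k),\\ 1&\text{otherwise.}\end{cases}$$
   Context: $\mathrm{AS}(k)=\{x+x^2 : x\in k\}$. The fourth coordinate $d$ of an element of $\mathcal{N}$ is a class in $k/\mathrm{AS}(k)$; in the equation of the curve one uses any representative in $k$, which does not change the $k$-isomorphism class, and comparisons of fourth coordinates are in $k/\mathrm{AS}(k)$. Elements of $\mathrm{PGL}_2(k)$ are written as fractional linear transformations $\gamma(x)$ of $\mathbb{P}^1$. The hyperelliptic involution is $\iota\colon(x,y)\mapsto(x,y+1)$. Every $k$-automorphism of such a curve has the form $(x,y)\mapsto(\gamma(x),y+v(x))$ with $\gamma\in\mathrm{PGL}_2(k)$, $v(x)\in k(x)$, and the right-hand map of the exact sequence sends it to $\gamma$. $C_n$ denotes the cyclic group of order $n$, $S_3$ the symmetric group. *)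

(* Defs.v *)
From HB Require Import structures.
From mathcomp Require Import all_boot all_order all_fingroup all_algebra all_field.
From mathcomp Require Import boolp.
From mathcomp.multinomials Require Import mpoly.
From mathcomp Require Import ring.

Set Implicit Arguments.
Unset Strict Implicit.
Unset Printing Implicit Defensive.

Import GRing.Theory.

Local Open Scope ring_scope.
Local Open Scope quotient_scope.

(* Aut_k(C) and PGL_2(k) are handled as subsets of the group of all           *)
(* permutations of a possibly infinite type, under (f * g) x = f (g x).       *)
Record sym (T : Type) := Sym {
  symf :> T -> T;
  symv : T -> T;
  symK : cancel symf symv;
  symVK : cancel symv symf }.

Lemma sym_ext (T : Type) (f g : sym T) : f =1 g -> f = g.
Proof.
case: f g => [f f' fK f'K] [g g' gK g'K] /= /funext fg.
case: g / fg gK g'K => gK g'K.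
have fg' : f' = g' by apply: funext => x; rewrite -{1}(g'K x) fK.
by case: g' / fg' gK g'K => gK g'K; congr Sym; exact: Prop_irrelevance.
Qed.

Section SymGroup.
Variable T : Type.

HB.instance Definition _ := gen_eqMixin (sym T).
HB.instance Definition _ := gen_choiceMixin (sym T).

Definition sym1 : sym T := @Sym T id id (fun=> erefl) (fun=> erefl).
Definition symV (f : sym T) : sym T := Sym (@symVK T f) (@symK T f).
Definition symM (f g : sym T) : sym T :=
  Sym (can_comp (@symK T f) (@symK T g)) (can_comp (@symVK T g) (@symVK T f)).

Fact symMA : associative symM. Proof. by move=> f g h; exact: sym_ext. Qed.
Fact sym1M : left_id sym1 symM. Proof. by move=> f; exact: sym_ext. Qed.
Fact symM1 : right_id sym1 symM. Proof. by move=> f; exact: sym_ext. Qed.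
Fact symVM : left_inverse sym1 symV symM.
Proof. by move=> f; apply: sym_ext => x; exact: symK. Qed.
Fact symMV : right_inverse sym1 symV symM.
Proof. by move=> f; apply: sym_ext => x; exact: symVK. Qed.

HB.instance Definition _ := isGroup.Build (sym T) symMA sym1M symM1 symVM symMV.

End SymGroup.

Definition cyclic_subgroup (G : groupType) (x : G) : {pred G} :=
  fun y => `[< exists n : nat, y = (x ^+ n)%g \/ y = (x ^- n)%g >].

Definition isomorphic_to (G : groupType) (A : {pred G}) (gT : finGroupType) :=
  exists f : gT -> G,
    [/\ {morph f : x y / (x * y)%g},
        injective f
      & forall a, a \in A <-> exists x, f x = a].

(* The sequence 1 -> N -> A -p-> B -> 1 of subgroups N, A of G and B of H is   *)
(* exact and splits; N -> A is the inclusion, p is only relevant on A.         *)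
Definition split_exact (G H : groupType) (N A : {pred G}) (B : {pred H})
    (p : G -> H) :=
  [/\ {in A &, {morph p : x y / (x * y)%g}},
      forall x, x \in N <-> x \in A /\ p x = 1%g,
      forall y, y \in B <-> (exists2 x, x \in A & p x = y)
    & exists s : H -> G,
        [/\ {in B &, {morph s : y z / (y * z)%g}},
            {in B, forall y, s y \in A}
          & {in B, forall y, p (s y) = y}]].

Lemma vlineZ (K : fieldType) (vT : vectType K) (t : K) (v : vT) :
  t != 0 -> <[t *: v]>%VS = <[v]>%VS.
Proof.
move=> t0; apply/eqP; rewrite eqEsubv -!memvE memvZ ?memv_line //=.
by rewrite -[X in X \in _](scalerK t0) memvZ ?memv_line.
Qed.

(* K-points of P^n: lines through the origin of K^(n+1).                    *)
Definition pspace (K : fieldType) (n : nat) :=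
  {L : {vspace 'rV[K]_n.+1} | \dim L == 1%N}.

Section ProjectiveSpace.
Variables (K : fieldType) (n : nat).
Implicit Types (v : 'rV[K]_n.+1) (P : pspace K n).

Definition pcoords P : 'rV[K]_n.+1 := vpick (val P).

Fact ppoint_proof v : v != 0 -> \dim <[v]>%VS == 1%N.
Proof. by rewrite dim_vline => ->. Qed.

Definition ppoint v (nz_v : v != 0) : pspace K n :=
  exist _ <[v]>%VS (ppoint_proof nz_v).

Lemma pcoords_neq0 P : pcoords P != 0.
Proof.
by rewrite /pcoords vpick0 -dimv_eq0; case: P => L /= /eqP->.
Qed.

Lemma pcoordsK P : <[pcoords P]>%VS = val P.
Proof.
apply/eqP; rewrite eqEdim -memvE memv_pick dim_vline.
by rewrite (pcoords_neq0 P); case: P => L /= /eqP->.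
Qed.

Lemma ppoint_eq v w (nz_v : v != 0) (nz_w : w != 0) (c : K) :
  v = c *: w -> ppoint nz_v = ppoint nz_w.
Proof.
move=> vE; apply: val_inj => /=; apply/eqP.
by rewrite eqEdim !dim_vline nz_v nz_w leqnn andbT -memvE vE memvZ ?memv_line.
Qed.

Lemma pcoords_ppoint v (nz_v : v != 0) :
  exists2 c : K, c != 0 & pcoords (ppoint nz_v) = c *: v.
Proof.
have /vlineP[c cE] : pcoords (ppoint nz_v) \in <[v]>%VS by exact: memv_pick.
exists c => //; apply/eqP => c0; have := pcoords_neq0 (ppoint nz_v).
by rewrite cE c0 scale0r eqxx.
Qed.

End ProjectiveSpace.

(* A projective k-variety is given by its points over an algebraic closure    *)
(* iota : k -> K of k, as the zero locus in P^n(K) of forms over k.  A        *)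
(* k-morphism is a map on K-points which is given, around every point, by     *)
(* forms of a common degree with coefficients in k.  The forms may be         *)
(* evaluated at any chosen coordinate vector, by homogeneity.                 *)
Section Varieties.
Variables (k K : fieldType) (iota : {rmorphism k -> K}).

Definition evalp n (p : {mpoly k[n]}) (v : 'rV[K]_n) : K := mmap iota (v 0) p.

Definition zero_locus n (S : seq {mpoly k[n.+1]}) : {pred pspace K n} :=
  fun P => all (fun p => evalp p (pcoords P) == 0) S.

Definition pvariety n (S : seq {mpoly k[n.+1]}) :=
  {P : pspace K n | P \in zero_locus S}.

Definition evalpv n m (F : 'I_m.+1 -> {mpoly k[n.+1]}) (v : 'rV[K]_n.+1) :
  'rV[K]_m.+1 := \row_i evalp (F i) v.

Definition regular_map n m (S : seq {mpoly k[n.+1]}) (S' : seq {mpoly k[m.+1]})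
    (f : pvariety S -> pvariety S') :=
  forall P : pvariety S,
    exists (D : nat) (F : 'I_m.+1 -> {mpoly k[n.+1]}),
      [/\ forall i, F i \is D.-homog,
          evalpv F (pcoords (val P)) != 0
        & forall Q : pvariety S, evalpv F (pcoords (val Q)) != 0 ->
            val (val (f Q)) = <[evalpv F (pcoords (val Q))]>%VS].

Definition isomorphic n m (S : seq {mpoly k[n.+1]}) (S' : seq {mpoly k[m.+1]}) :=
  exists (f : pvariety S -> pvariety S') (g : pvariety S' -> pvariety S),
    [/\ cancel f g, cancel g f, regular_map f & regular_map g].

Definition var_aut n (S : seq {mpoly k[n.+1]}) : {pred sym (pvariety S)} :=
  fun f => `[< regular_map f /\ regular_map (f^-1)%g >].

End Varieties.

Arguments isomorphic {k K} iota {n m} S S'.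
Arguments var_aut {k K} iota {n} S _.

Section FractionalLinear.
Variable K : fieldType.
Implicit Types (A : 'M[K]_2) (P : pspace K 1).

(* The point [X : Z] of P^1 has affine coordinate x = X / Z. *)
Definition row2 (x z : K) : 'rV[K]_2 := \row_i (if i == 0 then x else z).

Fact fraclin_neq0 A P : A \in unitmx -> pcoords P *m A^T != 0.
Proof.
move=> uA; apply: contraNneq (pcoords_neq0 P) => PA0.
have uAT : A^T \in unitmx by rewrite unitmx_tr.
by rewrite -(mulmxK uAT (pcoords P)) PA0 mul0mx.
Qed.

Definition fraclin_fun A (uA : A \in unitmx) P : pspace K 1 :=
  ppoint (fraclin_neq0 P uA).

Fact fraclin_funM A B (uA : A \in unitmx) (uB : B \in unitmx)
    (uAB : A *m B \in unitmx) P :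
  fraclin_fun uA (fraclin_fun uB P) = fraclin_fun uAB P.
Proof.
have [c c0 cE] := pcoords_ppoint (fraclin_neq0 P uB).
by apply: (ppoint_eq _ _ (c := c)); rewrite cE trmx_mul mulmxA -scalemxAl.
Qed.

Fact fraclin_fun1 A (uA : A \in unitmx) P : A = 1%:M -> fraclin_fun uA P = P.
Proof.
move=> A1; apply: val_inj => /=.
by rewrite -[RHS]pcoordsK A1 trmx1 mulmx1.
Qed.

Fact fraclin_proof A (uA : A \in unitmx) (uV : invmx A \in unitmx) :
  cancel (fraclin_fun uA) (fraclin_fun uV).
Proof.
move=> P; have uVA : invmx A *m A \in unitmx by rewrite mulVmx ?unitmx1.
by rewrite (fraclin_funM _ _ uVA) fraclin_fun1 // mulVmx.
Qed.

Fact fraclin_proofV A (uA : A \in unitmx) (uV : invmx A \in unitmx) :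
  cancel (fraclin_fun uV) (fraclin_fun uA).
Proof.
move=> P; have uAV : A *m invmx A \in unitmx by rewrite mulmxV ?unitmx1.
by rewrite (fraclin_funM _ _ uAV) fraclin_fun1 // mulmxV.
Qed.

Fact invmx_unit A : A \in unitmx -> invmx A \in unitmx.
Proof. by rewrite unitmx_inv. Qed.

(* x |-> (A_00 x + A_01) / (A_10 x + A_11), acting on column vectors (X, Z).   *)
Definition fraclin A (uA : A \in unitmx) : sym (pspace K 1) :=
  Sym (fraclin_proof uA (invmx_unit uA)) (fraclin_proofV uA (invmx_unit uA)).

Lemma fraclinM A B (uA : A \in unitmx) (uB : B \in unitmx)
    (uAB : A *m B \in unitmx) :
  (fraclin uA * fraclin uB)%g = fraclin uAB.
Proof. by apply: sym_ext => P; exact: fraclin_funM. Qed.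

End FractionalLinear.

Variant Gamma :=
  | G_x         (* x         *)
  | G_inv       (* 1/x       *)
  | G_add1      (* 1+x       *)
  | G_x_div     (* x/(1+x)   *)
  | G_1_div     (* 1/(1+x)   *)
  | G_add1_div  (* (1+x)/x   *).

Section GammaPGL2.
Variables (k K : fieldType) (iota : {rmorphism k -> K}).

Definition mx22 (p q r s : k) : 'M[k]_2 :=
  \matrix_(i, j) if i == 0 then (if j == 0 then p else q)
                 else (if j == 0 then r else s).

Definition Gamma_mx (g : Gamma) : 'M[k]_2 :=
  match g with
  | G_x        => mx22 1 0
                       0 1
  | G_inv      => mx22 0 1
                       1 0
  | G_add1     => mx22 1 1
                       0 1
  | G_x_div    => mx22 1 0
                       1 1
  | G_1_div    => mx22 0 1
                       1 1
  | G_add1_div => mx22 1 1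
                       1 0
  end.

Lemma det_mx22 p q r s : \det (mx22 p q r s) = p * s - q * r.
Proof.
rewrite (expand_det_row _ 0) !big_ord_recl big_ord0 /cofactor !det_mx11 !mxE /=.
by rewrite /bump /= expr0 expr1; ring.
Qed.

Fact Gamma_unit g : map_mx iota (Gamma_mx g) \in unitmx.
Proof.
rewrite map_unitmx unitmxE unitfE.
by case: g; rewrite /= det_mx22 ?(mul0r, mulr0, mul1r, subr0, sub0r) ?oppr_eq0 oner_eq0.
Qed.

(* The element of PGL_2(k), as a transformation of P^1(K).                     *)
Definition Gamma_PGL2 (g : Gamma) : sym (pspace K 1) := fraclin (Gamma_unit g).

End GammaPGL2.

Section Curve.
Variable k : fieldType.

(* The smooth projective model of y^2 + y = a x + b/x + c/(x+1) + d.  Put      *)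
(* x = X/Z, h = XZ(X+Z) and W = h y (of degree 3 in X, Z).  In characteristic  *)
(* 2, multiplying the equation by h^2 gives the genus 2 equation (smooth of    *)
(* degree 6 in the weighted plane P(1,1,3), since abc <> 0)                    *)
(*   W^2 + h W = a X^3 Z (X+Z)^2 + b X Z^3 (X+Z)^2 + c X^2 Z^3 (X+Z) + d h^2.  *)
(* The embedding (u0 : u1 : u2 : u3 : w) = (X^3 : X^2 Z : X Z^2 : Z^3 : W) in  *)
(* P^4 turns it into the intersection of the four quadrics below.  See         *)
(* on_curve_affine, on_curve_affine_surj for the affine model and              *)
(* jacobian_rank for smoothness.                                               *)

Definition curve (a b c d : k) : seq {mpoly k[5]} :=
  let u0 := 'X_(@inord 4 0) in let u1 := 'X_(@inord 4 1) in
  let u2 := 'X_(@inord 4 2) in let u3 := 'X_(@inord 4 3) in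
  let w := 'X_(@inord 4 4) in
  [:: u0 * u2 - u1 ^+ 2;
      u0 * u3 - u1 * u2;
      u1 * u3 - u2 ^+ 2;
      w ^+ 2 + (u1 + u2) * w
      - (a *: (u0 * u1 + u0 * u3) + b *: (u0 * u3 + u2 * u3)
         + c *: (u0 * u3 + u1 * u3) + d *: (u1 ^+ 2 + u2 ^+ 2))].

Variables (K : fieldType) (iota : {rmorphism k -> K}) (a b c d : k).

Definition row5 (x0 x1 x2 x3 x4 : K) : 'rV[K]_5 :=
  \row_i [:: x0; x1; x2; x3; x4]`_i.

Lemma row5P (v : 'rV[K]_5) :
  {x : K * K * K * K * K | v = let: (x0, x1, x2, x3, x4) := x in
                                row5 x0 x1 x2 x3 x4}.
Proof.
exists (v 0 (@inord 4 0), v 0 (@inord 4 1), v 0 (@inord 4 2),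
        v 0 (@inord 4 3), v 0 (@inord 4 4)).
apply/rowP=> -[[|[|[|[|[|i]]]]] lt_i] //; rewrite mxE /=;
  by congr (v 0 _); apply: val_inj; rewrite /= inordK.
Qed.

Lemma row5_eq0 x0 x1 x2 x3 x4 : (row5 x0 x1 x2 x3 x4 == 0) =
  [&& x0 == 0, x1 == 0, x2 == 0, x3 == 0 & x4 == 0].
Proof.
apply/eqP/and5P => [/rowP v0|[/eqP-> /eqP-> /eqP-> /eqP-> /eqP->]].
  split; [have := v0 (@inord 4 0) | have := v0 (@inord 4 1)
         | have := v0 (@inord 4 2) | have := v0 (@inord 4 3)
         | have := v0 (@inord 4 4)];
  by rewrite !mxE inordK //= => ->.
by apply/rowP=> -[[|[|[|[|[|i]]]]] lt_i] //; rewrite !mxE.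
Qed.

Lemma row5Z t x0 x1 x2 x3 x4 : t *: row5 x0 x1 x2 x3 x4 =
  row5 (t * x0) (t * x1) (t * x2) (t * x3) (t * x4).
Proof. by apply/rowP=> -[[|[|[|[|[|i]]]]] lt_i] //; rewrite !mxE. Qed.

Definition on_curve (v : 'rV[K]_5) : bool :=
  all (fun p => evalp iota p v == 0) (curve a b c d).

Lemma on_curve_row5 u0 u1 u2 u3 w : on_curve (row5 u0 u1 u2 u3 w) =
  [&& u0 * u2 - u1 ^+ 2 == 0, u0 * u3 - u1 * u2 == 0, u1 * u3 - u2 ^+ 2 == 0
    & w ^+ 2 + (u1 + u2) * w
      - (iota a * (u0 * u1 + u0 * u3) + iota b * (u0 * u3 + u2 * u3)
         + iota c * (u0 * u3 + u1 * u3) + iota d * (u1 ^+ 2 + u2 ^+ 2)) == 0].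
Proof.
rewrite /on_curve /= /evalp andbT !(rmorphB, rmorphD, rmorphM, rmorphXn) /=.
rewrite !(mmapZ, rmorphD, rmorphM, rmorphXn) /= !mmapX !mmap1U.
by rewrite !mxE !inordK.
Qed.

Lemma on_curveZ t v : t != 0 -> on_curve (t *: v) = on_curve v.
Proof.
case: (row5P v) => -[[[[u0 u1] u2] u3] w] -> t0.
rewrite row5Z !on_curve_row5.
have sc (x y : K) : y = t ^+ 2 * x -> (y == 0) = (x == 0).
  by move=> ->; rewrite mulf_eq0 expf_eq0 /= (negbTE t0).
by do 3?[congr (_ && _)]; apply: sc; ring.
Qed.

Lemma ppoint_curve (v : 'rV[K]_5) (nz_v : v != 0) :
  on_curve v -> ppoint nz_v \in zero_locus iota (curve a b c d).
Proof.
have [t t0 tE] := pcoords_ppoint nz_v.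
by rewrite -(on_curveZ _ t0) -tE.
Qed.

Lemma on_curve_neq0 u0 u1 u2 u3 w : on_curve (row5 u0 u1 u2 u3 w) ->
  row5 u0 u1 u2 u3 w != 0 -> (u0 != 0) || (u3 != 0).
Proof.
rewrite on_curve_row5 row5_eq0 -!negb_and => /and4P[/eqP e1 _ /eqP e2 /eqP e3].
apply: contra => /andP[/eqP u00 /eqP u30].
have u10 : u1 = 0.
  by apply/eqP; move: e1; rewrite u00 mul0r sub0r => /eqP; rewrite oppr_eq0 expf_eq0.
have u20 : u2 = 0.
  by apply/eqP; move: e2; rewrite u30 mulr0 sub0r => /eqP; rewrite oppr_eq0 expf_eq0.
move: e3; rewrite u00 u10 u20 u30 !(mul0r, mulr0, addr0, subr0, expr0n) /=.
by move/eqP; rewrite expf_eq0 !eqxx.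
Qed.

(* The x-coordinate C -> P^1, [X : Z] = [u0 : u1] = [u2 : u3].              *)
Definition xrow (v : 'rV[K]_5) : 'rV[K]_2 :=
  if v 0 (@inord 4 0) != 0 then row2 (v 0 (@inord 4 0)) (v 0 (@inord 4 1))
  else row2 (v 0 (@inord 4 2)) (v 0 (@inord 4 3)).

Fact xrow_neq0 (P : pvariety iota (curve a b c d)) :
  xrow (pcoords (val P)) != 0.
Proof.
have: on_curve (pcoords (val P)) by exact: (valP P).
have := pcoords_neq0 (val P).
case: (row5P (pcoords (val P))) => -[[[[u0 u1] u2] u3] w] -> v0 vC.
have := on_curve_neq0 vC v0.
rewrite /xrow !mxE !inordK //=; case: ifP => [u0n _|_ /= u3n].
  by apply: contra u0n => /eqP/rowP/(_ 0); rewrite !mxE /= => /eqP.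
by apply: contra u3n => /eqP/rowP/(_ 1); rewrite !mxE /= => /eqP.
Qed.

Definition xcoord (P : pvariety iota (curve a b c d)) : pspace K 1 :=
  ppoint (xrow_neq0 P).

End Curve.

Section Char2.
Variables (k : fieldType) (char2 : 2%N \in [pchar k]).

Definition perfect_field (F : fieldType) : Prop :=
  forall p : {poly F}, irreducible_poly p -> separable_poly p.

(* The proof of characteristic 2 is an argument of AS because it is what makes *)
(* AS(k) a subgroup of k, hence k/AS(k) a group.                               *)
Definition AS of 2%N \in [pchar k] : {pred k} :=
  fun z => `[< exists x : k, z = x + x ^+ 2 >].

Fact AS_zmod_closed : zmod_closed (AS char2).
Proof.
split=> [|_ _ /asboolP[x ->] /asboolP[y ->]].
  by apply/asboolP; exists 0; rewrite expr0n addr0.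
apply/asboolP; exists (x - y).
have e : x * y *+ 2 = 0 by rewrite -mulr_natr (pcharf0 char2) mulr0.
by rewrite sqrrB e subr0 opprD addrACA (oppr_pchar2 char2 (y ^+ 2)).
Qed.

HB.instance Definition _ := GRing.isZmodClosed.Build k (AS char2) AS_zmod_closed.

Definition kstar := {x : k | x != 0}.
Definition kmodAS := Quotient.quot (AS char2).

Definition ASclass (x : k) : kmodAS := \pi_kmodAS x.

Definition calN := (kstar * kstar * kstar * kmodAS)%type.

Definition Gamma_act (n : calN) (g : Gamma) : calN :=
  let: (a, b, c, d) := n in
  match g with
  | G_x        => (a, b, c, d)
  | G_inv      => (b, a, c, d + ASclass (val c))
  | G_add1     => (a, c, b, d + ASclass (val a))
  | G_x_div    => (c, b, a, d + ASclass (val c) + ASclass (val b) + ASclass (val a))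
  | G_1_div    => (b, c, a, d + ASclass (val c) + ASclass (val b))
  | G_add1_div => (c, a, b, d + ASclass (val b) + ASclass (val a))
  end.

Lemma ASclassE (x y : k) : (ASclass x == ASclass y) = (x - y \in AS char2).
Proof. by rewrite /ASclass -Quotient.idealrBE. Qed.

Variables (K : fieldType) (iota : {rmorphism k -> K}).

Definition isotropy (n : calN) : {pred sym (pspace K 1)} :=
  fun g => `[< exists2 h : Gamma, Gamma_act n h = n & g = Gamma_PGL2 iota h >].

Section Hyperelliptic.
Variables (a b c d : k).
Local Notation C := (pvariety iota (curve a b c d)).

Definition hyp_row (v : 'rV[K]_5) : 'rV[K]_5 :=
  row5 (v 0 (@inord 4 0)) (v 0 (@inord 4 1)) (v 0 (@inord 4 2))
       (v 0 (@inord 4 3))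
       (v 0 (@inord 4 4) + (v 0 (@inord 4 1) + v 0 (@inord 4 2))).

Lemma hyp_row5 u0 u1 u2 u3 w :
  hyp_row (row5 u0 u1 u2 u3 w) = row5 u0 u1 u2 u3 (w + (u1 + u2)).
Proof. by rewrite /hyp_row !mxE !inordK. Qed.

Lemma hyp_rowZ t v : hyp_row (t *: v) = t *: hyp_row v.
Proof.
by case: (row5P v) => -[[[[u0 u1] u2] u3] w] ->; rewrite row5Z !hyp_row5 row5Z !mulrDr.
Qed.

Let char2K : 2%N \in [pchar K] := rmorph_pchar iota char2.

Lemma hyp_rowK : involutive hyp_row.
Proof.
move=> v; case: (row5P v) => -[[[[u0 u1] u2] u3] w] ->.
by rewrite !hyp_row5 -addrA (addrr_pchar2 char2K) addr0.
Qed.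

Lemma hyp_row_neq0 v : v != 0 -> hyp_row v != 0.
Proof.
apply: contraNneq => v0; rewrite -[v]hyp_rowK v0 -[X in hyp_row X](scale0r 0).
by rewrite hyp_rowZ scale0r.
Qed.

Lemma on_curve_hyp v :
  on_curve iota a b c d v -> on_curve iota a b c d (hyp_row v).
Proof.
case: (row5P v) => -[[[[u0 u1] u2] u3] w] ->; rewrite hyp_row5 !on_curve_row5.
suff -> : (w + (u1 + u2)) ^+ 2 + (u1 + u2) * (w + (u1 + u2))
          = w ^+ 2 + (u1 + u2) * w by [].
apply/eqP; rewrite -subr_eq0.
have -> : (w + (u1 + u2)) ^+ 2 + (u1 + u2) * (w + (u1 + u2))
          - (w ^+ 2 + (u1 + u2) * w) = 2%:R * ((u1 + u2) * w + (u1 + u2) ^+ 2).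
  by ring.
by rewrite (pcharf0 char2K) mul0r.
Qed.

Definition hyp_fun (P : C) : C :=
  exist _ (ppoint (hyp_row_neq0 (pcoords_neq0 (val P))))
          (ppoint_curve (hyp_row_neq0 (pcoords_neq0 (val P))) 
                        (on_curve_hyp (valP P))).

Fact hyp_funK : involutive hyp_fun.
Proof.
move=> P; apply: val_inj; apply: val_inj => /=.
have [t t0 ->] := pcoords_ppoint (hyp_row_neq0 (pcoords_neq0 (val P))).
by rewrite hyp_rowZ hyp_rowK vlineZ // pcoordsK.
Qed.

(* (x, y) |-> (x, y + 1), that is W |-> W + XZ(X+Z) *)
Definition hyperelliptic_involution : sym C := Sym hyp_funK hyp_funK.

End Hyperelliptic.

End Char2.


Section RegularMaps.
Variables (k K : fieldType) (iota : {rmorphism k -> K}).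

Lemma evalp_homog n D (p : {mpoly k[n]}) (t : K) (v : 'rV[K]_n) :
  p \is D.-homog -> evalp iota p (t *: v) = t ^+ D * evalp iota p v.
Proof.
move=> /dhomogP hp; rewrite /evalp /mmap mulr_sumr; apply: eq_big_seq => m /hp.
rewrite /mmap1 /= mdegE => <-; rewrite mulrCA; congr (_ * _).
by rewrite -prodrXr -big_split; apply: eq_bigr => i _; rewrite mxE exprMn.
Qed.

Lemma dhomog_comp n m D E (p : {mpoly k[n]}) (F : n.-tuple {mpoly k[m]}) :
  p \is D.-homog -> (forall i, tnth F i \is E.-homog) ->
  p \mPo F \is (D * E)%N.-homog.
Proof.
move=> /dhomogP hp hF; rewrite comp_mpolyEX big_seq rpred_sum // => mm /hp.
rewrite /= mdegE => <-; apply: dhomogZ; rewrite comp_mpolyX big_distrl /=.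
elim: (index_enum _) => [|i r IHr]; first by rewrite !big_nil dhomog1.
by rewrite !big_cons dhomogM // mulnC dhomogMn.
Qed.

Lemma evalp_comp n m (p : {mpoly k[n]}) (F : 'I_n -> {mpoly k[m]}) v :
  evalp iota (p \mPo [tuple F i | i < n]) v
  = evalp iota p (\row_i evalp iota (F i) v).
Proof.
rewrite comp_mpolyEX /evalp raddf_sum /= [in RHS]/mmap; apply: eq_bigr => mm _.
rewrite mmapZ comp_mpolyX rmorph_prod; congr (_ * _).
by apply: eq_bigr => i _; rewrite rmorphXn tnth_mktuple mxE.
Qed.

Lemma regular_comp n1 n2 n3 (S1 : seq {mpoly k[n1.+1]})
    (S2 : seq {mpoly k[n2.+1]}) (S3 : seq {mpoly k[n3.+1]})
    (f : pvariety iota S2 -> pvariety iota S3)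
    (g : pvariety iota S1 -> pvariety iota S2) :
  regular_map f -> regular_map g -> regular_map (f \o g).
Proof.
move=> rf rg P; have [E [G [hG nzG gE]]] := rg P.
have [D [F [hF nzF fE]]] := rf (g P).
pose FG i := F i \mPo [tuple G j | j < n2.+1].
have FGE v : evalpv iota FG v = evalpv iota F (evalpv iota G v).
  by apply/rowP=> i; rewrite !mxE evalp_comp.
have coordE Q : evalpv iota G (pcoords (val Q)) != 0 ->
    exists2 t : K, t != 0 & evalpv iota G (pcoords (val Q))
                            = t *: pcoords (val (g Q)).
  move=> nzQ; have := memv_line (evalpv iota G (pcoords (val Q))).
  rewrite -(gE Q nzQ) -pcoordsK => /vlineP[t tE]; exists t => //.
  by apply: contraNneq nzQ => t0; rewrite tE t0 scale0r.
have FZ t v : evalpv iota F (t *: v) = t ^+ D *: evalpv iota F v.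
  by apply/rowP=> i; rewrite !mxE (evalp_homog _ _ (hF i)).
exists (D * E)%N, FG; split=> [i||Q].
- by apply: dhomog_comp => // j; rewrite tnth_mktuple.
- have [t t0 tE] := coordE _ nzG.
  by rewrite FGE tE FZ scaler_eq0 negb_or expf_neq0.
rewrite FGE => nzQ.
have [G0|nzG'] := eqVneq (evalpv iota G (pcoords (val Q))) 0.
  move: nzQ; rewrite G0 -[X in evalpv iota F X](scale0r (pcoords (val (g Q)))).
  rewrite FZ => nzQ; have D0 : D = 0%N.
    by apply: contraNeq nzQ => D0; rewrite expr0n (negbTE D0) scale0r.
  by move: nzQ; rewrite D0 expr0 scale1r; apply: fE.
have [t t0 tE] := coordE _ nzG'.
have tD0 : t ^+ D != 0 by rewrite expf_neq0.
rewrite tE FZ fE; last by move: nzQ; rewrite tE FZ scaler_eq0 negb_or tD0.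
by rewrite vlineZ.
Qed.

Lemma regular_id n (S : seq {mpoly k[n.+1]}) : @regular_map k K iota n n S S id.
Proof.
move=> P; have idE v : evalpv iota (fun i : 'I_n.+1 => 'X_i) v = v.
  by apply/rowP=> i; rewrite mxE /evalp mmapX mmap1U.
exists 1%N, (fun i => 'X_i); split=> [i||Q _]; rewrite ?idE ?pcoords_neq0 //.
  by rewrite dhomogX; apply/eqP; exact: mdeg1.
by rewrite pcoordsK.
Qed.

Lemma var_aut_group_closed n (S : seq {mpoly k[n.+1]}) : group_closed (var_aut iota S).
Proof.
split=> [|f g /asboolP[rf rf'] /asboolP[rg rg']].
  by apply/asboolP; split; exact: regular_id.
by apply/asboolP; split; [exact: (regular_comp rf rg')
                         | rewrite invgF; exact: (regular_comp rg rf')].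
Qed.


End RegularMaps.

Section GammaGroup.
Variables (k : fieldType) (char2 : 2%N \in [pchar k]).
Variables (K : fieldType) (iota : {rmorphism k -> K}).

Definition Gamma_mul (g h : Gamma) : Gamma :=
  match g, h with
  | G_x, _ => h | _, G_x => g
  | G_inv, G_inv => G_x
  | G_inv, G_add1 => G_1_div
  | G_inv, G_x_div => G_add1_div
  | G_inv, G_1_div => G_add1
  | G_inv, G_add1_div => G_x_div
  | G_add1, G_inv => G_add1_div
  | G_add1, G_add1 => G_x
  | G_add1, G_x_div => G_1_div
  | G_add1, G_1_div => G_x_div
  | G_add1, G_add1_div => G_inv
  | G_x_div, G_inv => G_1_div
  | G_x_div, G_add1 => G_add1_div
  | G_x_div, G_x_div => G_x
  | G_x_div, G_1_div => G_inv
  | G_x_div, G_add1_div => G_add1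
  | G_1_div, G_inv => G_x_div
  | G_1_div, G_add1 => G_inv
  | G_1_div, G_x_div => G_add1
  | G_1_div, G_1_div => G_add1_div
  | G_1_div, G_add1_div => G_x
  | G_add1_div, G_inv => G_add1
  | G_add1_div, G_add1 => G_x_div
  | G_add1_div, G_x_div => G_inv
  | G_add1_div, G_1_div => G_x
  | G_add1_div, G_add1_div => G_1_div
  end.

Lemma Gamma_PGL2M g h :
  (Gamma_PGL2 iota g * Gamma_PGL2 iota h)%g = Gamma_PGL2 iota (Gamma_mul g h).
Proof.
have e : Gamma_mx k g *m Gamma_mx k h = Gamma_mx k (Gamma_mul g h).
  apply/matrixP=> i j; case: g; case: h; rewrite !mxE !big_ord_recl big_ord0 !mxE /=;
    case: ifP => _; case: ifP => _;
    by rewrite ?(mul0r, mulr0, mul1r, add0r, addr0, addrr_pchar2 char2).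
have eK : map_mx iota (Gamma_mx k g) *m map_mx iota (Gamma_mx k h)
          = map_mx iota (Gamma_mx k (Gamma_mul g h)) by rewrite -map_mxM e.
have u : map_mx iota (Gamma_mx k g) *m map_mx iota (Gamma_mx k h) \in unitmx.
  by rewrite eK Gamma_unit.
rewrite (fraclinM _ _ u); apply: sym_ext => P; apply: val_inj => /=.
by rewrite eK.
Qed.

Lemma Gamma_actM (n : calN char2) g h :
  Gamma_act (Gamma_act n g) h = Gamma_act n (Gamma_mul g h).
Proof.
case: n => [[[a b] c] d].
have xx (x : k) : ASclass char2 x + ASclass char2 x = 0.
  by rewrite /ASclass -raddfD addrr_pchar2 // raddf0.
have addK x (u : kmodAS char2) : u + ASclass char2 x + ASclass char2 x = u.
  by rewrite -addrA xx addr0.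
pose A := ASclass char2 (val a); pose B := ASclass char2 (val b).
pose C := ASclass char2 (val c).
by case: g; case: h; rewrite /= -/A -/B -/C //;
  congr (_, _, _, _);
  rewrite ?(addrAC _ B A, addrAC _ C A, addrAC _ C B, addK).
Qed.

End GammaGroup.

Section AffineChart.
Variables (k : fieldType) (char2 : 2%N \in [pchar k]).
Variables (K : fieldType) (iota : {rmorphism k -> K}) (a b c d : k).

(* The points of C_abcd with x <> 0, 1, oo, and the maps x and iota on them.   *)
Lemma on_curve_affine (x y : K) : x != 0 -> x + 1 != 0 ->
  on_curve iota a b c d (row5 (x ^+ 3) (x ^+ 2) x 1 (x * (x + 1) * y))
  = (y ^+ 2 + y == iota a * x + iota b / x + iota c / (x + 1) + iota d).
Proof.
move=> x0 x1; rewrite on_curve_row5.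
have -> : x ^+ 3 * x - (x ^+ 2) ^+ 2 = 0 by ring.
have -> : x ^+ 3 * 1 - x ^+ 2 * x = 0 by ring.
have -> : x ^+ 2 * 1 - x ^+ 2 = 0 by ring.
rewrite !eqxx /= -[in RHS]subr_eq0.
have h0 : (x * (x + 1)) ^+ 2 != 0 by rewrite expf_neq0 // mulf_neq0.
have eqh (F : K) : (F == 0) = ((x * (x + 1)) ^+ 2 * F == 0).
  by rewrite mulf_eq0 (negbTE h0).
rewrite [RHS]eqh.
congr (_ == 0); apply/eqP; rewrite -subr_eq0.
rewrite [X in X == 0](_ : _ = 2%:R * (iota a * x ^+ 4 + iota b * x ^+ 2 + iota d * x ^+ 3)).
  by rewrite (pcharf0 (rmorph_pchar iota char2)) mul0r.
by field; rewrite x0 x1.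
Qed.

Lemma on_curve_affine_surj u0 u1 u2 u3 w :
  on_curve iota a b c d (row5 u0 u1 u2 u3 w) -> u1 + u2 != 0 ->
  exists t x y : K, [/\ t != 0, x != 0, x + 1 != 0
    & row5 u0 u1 u2 u3 w
      = t *: row5 (x ^+ 3) (x ^+ 2) x 1 (x * (x + 1) * y)].
Proof.
rewrite on_curve_row5 !subr_eq0 => /and4P[/eqP e1 /eqP e2 /eqP e3 _] h0.
have u30 : u3 != 0.
  apply: contraNneq h0 => u30.
  have u20 : u2 = 0.
    by apply/eqP; move/esym/eqP: e3; rewrite u30 mulr0 expf_eq0.
  by move/esym/eqP: e1; rewrite u20 mulr0 expf_eq0 addr0.
have u1E : u1 = u3 * (u2 / u3) ^+ 2 by rewrite expr_div_n -e3; field.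
have u0E : u0 = u3 * (u2 / u3) ^+ 3.
  by apply: (mulIf u30); rewrite e2 u1E; field.
have sE : u1 + u2 = u3 * ((u2 / u3) * (u2 / u3 + 1)) by rewrite u1E; field.
have := h0; rewrite sE mulf_eq0 (negbTE u30) /= mulf_eq0 negb_or => /andP[x0 x1].
exists u3, (u2 / u3), (w / (u1 + u2)); split=> //.
rewrite row5Z; congr row5 => //; first by field.
  by rewrite mulr1.
by rewrite mulrA -sE mulrC divfK.
Qed.

Lemma hyp_row_affine (x y : K) :
  hyp_row (row5 (x ^+ 3) (x ^+ 2) x 1 (x * (x + 1) * y))
  = row5 (x ^+ 3) (x ^+ 2) x 1 (x * (x + 1) * (y + 1)).
Proof. by rewrite hyp_row5; congr row5; ring. Qed.

Lemma xrow_affine (x w : K) : x != 0 ->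
  xrow (row5 (x ^+ 3) (x ^+ 2) x 1 w) = x ^+ 2 *: row2 x 1.
Proof.
move=> x0; rewrite /xrow !mxE !inordK //= expf_neq0 //.
by apply/rowP=> i; rewrite !mxE; case: ifP => _; ring.
Qed.

Definition jacobian (v : 'rV[K]_5) : 'M[K]_(4, 5) :=
  \matrix_(i, j) evalp iota (mderiv j (curve a b c d)`_i) v.

Lemma jacobianE u0 u1 u2 u3 w : jacobian (row5 u0 u1 u2 u3 w) =
  \matrix_(i, j) (nth [::] [::
     [:: u2; - (u1 *+ 2); u0; 0; 0];
     [:: u3; - u2; - u1; u0; 0];
     [:: 0; u3; - (u2 *+ 2); u1; 0];
     [:: - (iota a * (u1 + u3) + iota b * u3 + iota c * u3);
         w - (iota a * u0 + iota c * u3 + iota d * (u1 *+ 2));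
         w - (iota b * u3 + iota d * (u2 *+ 2));
         - (iota a * u0 + iota b * (u0 + u2) + iota c * (u0 + u1));
         w *+ 2 + (u1 + u2)]] i)`_j.
Proof.
have dX (i j : 'I_5) :
    mmap iota (row5 u0 u1 u2 u3 w 0) (mderiv j ('X_i : {mpoly k[5]})) = (i == j)%:R.
  rewrite mderivX mmapZ mnm1E; case: eqP => [->|_]; last by rewrite rmorph0 mul0r.
  have -> : (U_(j) - U_(j) = 0 :> 'X_{1..5})%MM.
    by apply/mnmP=> l; rewrite mnmBE subnn mnm0E.
  by rewrite rmorph1 mul1r mpolyX0 rmorph1.
apply/matrixP=> i j; rewrite [LHS]mxE [RHS]mxE /evalp.
case: i => [[|[|[|[|i]]]] lt_i] //; rewrite [(curve _ _ _ _)`_ _]/=;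
rewrite !(mderivB, mderivD, mderivM, mderivZ, expr2) !(rmorphB, rmorphD, rmorphM, mmapZ) /=;
rewrite !(mderivD, mderivM, mmapZ, rmorphD, rmorphM, dX) /= !mmapX !mmap1U !mxE !inordK //=;
case: j => [[|[|[|[|[|j]]]]] lt_j] //; rewrite ?dX -!val_eqE /= !inordK //=; ring.
Qed.

Let det33 (F : nat -> nat -> K) :=
  F 0%N 0%N * (F 1%N 1%N * F 2%N 2%N - F 1%N 2%N * F 2%N 1%N)
  - F 0%N 1%N * (F 1%N 0%N * F 2%N 2%N - F 1%N 2%N * F 2%N 0%N)
  + F 0%N 2%N * (F 1%N 0%N * F 2%N 1%N - F 1%N 1%N * F 2%N 0%N).

Let det_mx33 (F : nat -> nat -> K) :
  \det (\matrix_(i < 3, j < 3) F i j) = det33 F.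
Proof.
rewrite (expand_det_row _ 0) !big_ord_recl big_ord0 /cofactor.
rewrite !(expand_det_row _ 0) !big_ord_recl !big_ord0 /cofactor !det_mx11 !mxE /=.
by rewrite /det33 /bump /=; ring.
Qed.

Lemma mxrank_minor m n p (f : 'I_p -> 'I_m) (g : 'I_p -> 'I_n) (A : 'M[K]_(m, n)) :
  \det (mxsub f g A) != 0 -> (p <= \rank A)%N.
Proof.
rewrite -unitfE -unitmxE => /mxrank_unit {1}<-.
have -> : mxsub f g A = rowsub f 1%:M *m (A *m colsub g 1%:M).
  by rewrite -rowsubE mulmx_colsub mulmx1; apply/matrixP=> i j; rewrite !mxE.
exact: leq_trans (mxrankM_maxr _ _) (mxrankM_maxl _ _).
Qed.

(* The Jacobian criterion of smoothness for a curve in P^4.                    *)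
Lemma jacobian_rank (v : 'rV[K]_5) : a != 0 -> b != 0 -> c != 0 ->
  v != 0 -> on_curve iota a b c d v -> (3 <= \rank (jacobian v))%N.
Proof.
move=> a0 b0 c0; case: (row5P v) => -[[[[u0 u1] u2] u3] w] -> v0 vC.
have := on_curve_neq0 vC v0.
move: vC; rewrite on_curve_row5 !subr_eq0 => /and4P[/eqP e1 /eqP e2 /eqP e3 /eqP e4].
have two0 : 2%:R = 0 :> K := pcharf0 (rmorph_pchar iota char2).
have mul2 (x : K) : x *+ 2 = 0 by rewrite -mulr_natr two0 mulr0.
rewrite jacobianE; set J := (J in \matrix_(i, j) (nth _ J _)`_ _).
have minor (r q : seq nat) (F := fun i j => (nth [::] J (nth 0%N r i))`_(nth 0%N q j)) :
    all (ltn^~ 4) r -> all (ltn^~ 5) q ->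
    det33 F != 0 ->
    leq 3 (\rank (\matrix_(i < 4, j < 5) (nth [::] J i)`_j)).
  move=> /all_nthP rP /all_nthP qP; rewrite -det_mx33.
  pose f (i : 'I_3) := @inord 3 (nth 0%N r i).
  pose g (j : 'I_3) := @inord 4 (nth 0%N q j).
  have ltn_nth (s : seq nat) m x : (forall i, (i < size s)%N -> (nth 0 s i < m.+1)%N) ->
      (nth 0 s x < m.+1)%N.
    by move=> sP; case: (ltnP x (size s)) => [/sP//|le_x]; rewrite nth_default.
  suff -> : \matrix_(i < 3, j < 3) F i j
            = mxsub f g (\matrix_(i < 4, j < 5) (nth [::] J i)`_j).
    exact: mxrank_minor.
  apply/matrixP=> i j; rewrite !mxE !inordK //; apply: ltn_nth => l.
    exact: (qP 0%N).
  exact: (rP 0%N).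
have [u30|u30 _] := eqVneq u3 0.
  rewrite orbF => u00.
  have u20 : u2 = 0.
    by apply/eqP; move/esym/eqP: e3; rewrite u30 mulr0 expf_eq0.
  have u10 : u1 = 0.
    by apply/eqP; move/esym/eqP: e1; rewrite u20 mulr0 expf_eq0.
  have w0 : w = 0.
    apply/eqP; move/eqP: e4; rewrite u30 u20 u10 expr0n !(mulr0, mul0r, addr0).
    by rewrite expf_eq0.
  apply: (minor [:: 0; 1; 3]%N [:: 2; 3; 1]%N) => //.
  rewrite /det33 /= u30 u20 u10 w0 !mul2 !(mulr0, mul0r, addr0, add0r, oppr0, subr0, sub0r).
  by rewrite !mulf_neq0 ?oppr_eq0 ?mulf_neq0 ?fmorph_eq0.
have [h0|h0] := eqVneq (u1 + u2) 0; last first.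
  apply: (minor [:: 1; 2; 3]%N [:: 0; 1; 4]%N) => //.
  rewrite /det33 /= !mul2 !(mulr0, mul0r, addr0, add0r, oppr0, subr0, sub0r).
  by rewrite !mulf_neq0.
have u12 : u1 = u2.
  by apply/eqP; rewrite -subr_eq0 (oppr_pchar2 (rmorph_pchar iota char2)) h0.
have w0 : w = 0.
  have : w ^+ 2 = 0.
    move: e1 e2 e3 e4; rewrite h0 mul0r addr0 u12 => e1 e2 e3 ->.
    by rewrite e1 e2 e3 -expr2 -!mulr2n !mul2 !mulr0 !addr0.
  by move/eqP; rewrite expf_eq0 => /andP[_ /eqP].
have [u20|u20] := eqVneq u2 0.
  apply: (minor [:: 1; 2; 3]%N [:: 0; 1; 2]%N) => //.
  have u00 : u0 = 0 by apply: (mulIf u30); rewrite e2 u12 u20 !mul0r.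
  rewrite /det33 /= u00 u12 u20 w0 !mul2.
  rewrite !(mulr0, mul0r, addr0, add0r, oppr0, subr0, sub0r).
  by rewrite !mulf_neq0 ?oppr_eq0 ?mulf_neq0 ?fmorph_eq0.
have u32 : u3 = u2 by apply: (mulfI u20); rewrite -[in LHS]u12 e3.
have u02 : u0 = u2 by apply: (mulIf u20); rewrite e1 u12.
apply: (minor [:: 1; 2; 3]%N [:: 0; 1; 2]%N) => //.
rewrite /det33 /= u02 u32 u12 w0 -!mulr2n !mul2.
rewrite [X in X != 0](_ : _ = iota c * u2 ^+ 3 - 2%:R * (iota b * u2 ^+ 3 + iota c * u2 ^+ 3)); last first.
  by ring.
by rewrite two0 mul0r subr0 mulf_neq0 ?fmorph_eq0 ?expf_neq0.
Qed.

End AffineChart.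

(* Main.v *)
(* Let f : C' -> C be a k-isomorphism.  For generic t, the function            *)
(* 1 / (x o f - t) has two simple poles P1 and P2 with finite x-coordinates p1  *)
(* and p2, so (x - p1)(x - p2) / (x o f - t) is regular at all finite points,   *)
(* hence of the form A(x) + B(x) w with w = x (x+1) y; the behaviour at oo,     *)
(* where w has a pole of order 5 and x one of order 2, forces B = 0 and         *)
(* deg A <= 2.  Hence x o f only depends on x, i.e. f commutes with the         *)
(* hyperelliptic involution; so P1 and P2 are conjugate for another t, p1 = p2  *)
(* = p, and the same argument for (x - p) / (x o f - t) shows that x o f is a   *)
(* Moebius transformation g of x.  Now v = y o f + y is invariant under the     *)
(* involution, i.e. a rational function of x, and v^2 + v has at most simple    *)
(* poles; so v has none and is a constant u, whence g permutes 0, 1, oo.        *)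
(* Comparing coefficients determines C' from C, g and u; conversely all these   *)
(* maps (x, y) |-> (g(x), y + u) are linear in P^4.  Finally u lies in k since  *)
(* it solves a linear equation between coefficients of the forms defining f.    *)

Require Import Defs.
From HB Require Import structures.
From mathcomp Require Import all_boot all_order all_fingroup all_algebra all_field.
From mathcomp Require Import boolp.
From mathcomp.multinomials Require Import mpoly.
From mathcomp Require Import ring zify.

Set Implicit Arguments.
Unset Strict Implicit.
Unset Printing Implicit Defensive.

Import GRing.Theory.
Local Open Scope ring_scope.

(** The curve is a double cover of the line by x, and the functions A(x) + B(x) w with w = x(x+1)y
    form its affine coordinate ring. For an isomorphism f and generic t, [fibre_poly] shows that
    clearing the poles of 1/(x o f - t) leaves a polynomial in x of small degree. Hence f commutes
    with the involution almost everywhere ([commute_hyp]) and acts on x by a Moebius map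
    ([xP_moebius]). The function v = y o f + y is then rational in x ([y_shift]). A pole of v would
    give v^2 + v a pole of order at least two, whereas its equation allows only simple ones; so v is
    a constant u, and the Moebius map must permute the poles 0, 1, oo, that is, lie in Gamma
    ([rational_solution]). Comparing coefficients ([qform_coef]) and descending u to k
    ([shift_rational]) gives [classification]: every isomorphism is (x, y) |-> (g(x), y + u), and
    the parameters of its source are the [twist] by (g, u) of those of its target. Conversely
    [lin_map_iso] realises every pair (g, u). Since u only adds u + u^2 to d, [twist] modulo AS(k)
    is the action of Gamma ([Gamma_act_twist]), which proves part 1.

    For part 2, automorphisms are the pairs (g, u) that fix the parameters. Over g = 1 the condition
    u + u^2 = 0 leaves u = 0 and u = 1, the identity and the involution. A splitting needs a
    multiplicative choice of u for every g in the isotropy group; [shift] is one ([shift_twist],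
    [shiftM]). The isotropy groups are read off [Gamma_fixedP]: a transposition fixes the parameters
    when the two it exchanges agree and the third lies in AS(k), a rotation when all three agree. *)

(** Turns an identity of characteristic two into an integral one that [ring] decides: z is half the
    difference of the two sides. *)
Lemma eq_pchar2 (R : nzRingType) (x y z : R) :
  2%N \in [pchar R] -> x - y = z *+ 2 -> x = y.
Proof.
move=> char2 e; apply/eqP; rewrite -subr_eq0 e -mulr_natr.
by rewrite (pcharf0 char2) mulr0.
Qed.

Definition hornerR :=
  (hornerD, hornerN, hornerZ, hornerM, horner_exp, hornerXn, hornerX, hornerC).

(** The polynomial below takes the value 1 on s and has a root; the factor 'X keeps it nonconstant
    when s is empty. *)
Lemma exists_notin (K : closedFieldType) (s : seq K) : exists t, t \notin s.
Proof.
pose p := 1 + 'X * \prod_(r <- s) ('X - r%:P) : {poly K}.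
have szp : size p != 1%N.
  rewrite /p addrC size_polyDl; last first.
    by rewrite size_poly1 size_monicM ?monicX ?monic_neq0 ?monic_prod_XsubC //
      size_polyX size_prod_XsubC.
  rewrite size_monicM ?monicX ?monic_neq0 ?monic_prod_XsubC //.
  by rewrite size_polyX size_prod_XsubC.
have /closed_rootP[t /rootP tE] := szp.
exists t; apply: contra_eqN tE => ts.
have /rootP p0 : root (\prod_(r <- s) ('X - r%:P)) t by rewrite root_prod_XsubC.
rewrite hornerD hornerC hornerM p0 mulr0 addr0.
exact: oner_neq0.
Qed.

(** * Points of the curve in weighted coordinates *)

Section Points.
Variables (k : fieldType) (char2 : 2%N \in [pchar k]).
Variables (K : closedFieldType) (iota : {rmorphism k -> K}).

Let char2K : 2%N \in [pchar K] := rmorph_pchar iota char2.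

Lemma addKK (x : K) : x + x = 0. Proof. exact: addrr_pchar2. Qed.
Lemma subK2 (x y : K) : x - y = x + y. Proof. by rewrite (oppr_pchar2 char2K). Qed.

(* The image in P^4 of the point [X : Z : W] of the weighted plane P(1,1,3).   *)
Definition par (X Z W : K) : 'rV[K]_5 :=
  row5 (X ^+ 3) (X ^+ 2 * Z) (X * Z ^+ 2) (Z ^+ 3) W.

Definition hform (X Z : K) := X * Z * (X + Z).

Lemma parZ t X Z W : par (t * X) (t * Z) (t ^+ 3 * W) = t ^+ 3 *: par X Z W.
Proof. by rewrite /par row5Z; congr row5; ring. Qed.

Lemma par_neq0 X Z W : (X != 0) || (Z != 0) -> par X Z W != 0.
Proof.
by rewrite row5_eq0 !expf_eq0 !mulf_eq0 /=; case: eqP => //= _; case: eqP => //= _.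
Qed.

Section OneCurve.
Variables (a b c d : k).
Local Notation C := (pvariety iota (curve a b c d)).

Definition qform (X Z : K) :=
  iota a * X ^+ 3 * Z * (X + Z) ^+ 2 + iota b * X * Z ^+ 3 * (X + Z) ^+ 2
  + iota c * X ^+ 2 * Z ^+ 3 * (X + Z) + iota d * hform X Z ^+ 2.

Lemma on_curve_par X Z W :
  on_curve iota a b c d (par X Z W) = (W ^+ 2 + hform X Z * W == qform X Z).
Proof.
rewrite /par on_curve_row5.
have -> : X ^+ 3 * (X * Z ^+ 2) - (X ^+ 2 * Z) ^+ 2 = 0 by ring.
have -> : X ^+ 3 * Z ^+ 3 - X ^+ 2 * Z * (X * Z ^+ 2) = 0 by ring.
have -> : X ^+ 2 * Z * Z ^+ 3 - (X * Z ^+ 2) ^+ 2 = 0 by ring.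
rewrite !eqxx /= -[in RHS]subr_eq0; congr (_ == 0).
apply: (@eq_pchar2 _ _ _ (iota a * X ^+ 4 * Z ^+ 2 + iota b * X ^+ 2 * Z ^+ 4
  + iota d * X ^+ 3 * Z ^+ 3)) => //.
by rewrite /qform /hform; ring.
Qed.

Lemma on_curve_parP v : on_curve iota a b c d v -> v != 0 ->
  exists t X Z W, [/\ t != 0, v = t *: par X Z W
    & X = 1 /\ Z = 0 /\ W = 0 \/ Z = 1].
Proof.
case: (row5P v) => -[[[[u0 u1] u2] u3] w] -> vC v0.
have := on_curve_neq0 vC v0; move: vC.
rewrite on_curve_row5 !subr_eq0 => /and4P[/eqP e1 /eqP e2 /eqP e3 /eqP e4].
have [u30|u30 _] := eqVneq u3 0.
  rewrite orbF => u00.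
  have u20 : u2 = 0.
    by apply/eqP; move/esym/eqP: e3; rewrite u30 mulr0 expf_eq0.
  have u10 : u1 = 0.
    by apply/eqP; move/esym/eqP: e1; rewrite u20 mulr0 expf_eq0.
  have w0 : w = 0.
    apply/eqP; move/eqP: e4; rewrite u30 u20 u10 expr0n !(mulr0, mul0r, addr0).
    by rewrite expf_eq0.
  exists u0, 1, 0, 0; split; [by []| |by left].
  by rewrite /par row5Z u30 u20 u10 w0; congr row5; ring.
exists u3, (u2 / u3), 1, (w / u3); split; [by []| |by right].
have u1E : u1 = u3 * (u2 / u3) ^+ 2 by rewrite expr_div_n -e3; field.
have u0E : u0 = u3 * (u2 / u3) ^+ 3.
  by apply: (mulIf u30); rewrite e2 u1E; field.
rewrite /par row5Z; congr row5 => //.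
- by rewrite mulr1.
- by rewrite expr1n mulr1 mulrC divfK.
- by rewrite expr1n mulr1.
- by rewrite mulrC divfK.
Qed.

Definition co (Q : C) (i : nat) : K := pcoords (val Q) 0 (@inord 4 i).
(** These are x = X/Z and w = W/Z^3, because u2 = X Z^2 and u3 = Z^3. At the point at infinity both
    default to 0 through division by zero, hence the hypotheses [finP]. *)
Definition xP Q := co Q 2 / co Q 3.
Definition wP Q := co Q 4 / co Q 3.
Definition finP Q := co Q 3 != 0.

Lemma coordsP (Q : C) : exists2 t, t != 0 & exists X Z W,
   [/\ pcoords (val Q) = t *: par X Z W,
       W ^+ 2 + hform X Z * W = qform X Z
     & X = 1 /\ Z = 0 /\ W = 0 \/ Z = 1].
Proof.
have QC : on_curve iota a b c d (pcoords (val Q)) by exact: (valP Q).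
have [t [X [Z [W [t0 QE XZ]]]]] := on_curve_parP QC (pcoords_neq0 _).
exists t => //; exists X, Z, W; split=> //.
by apply/eqP; rewrite -on_curve_par -(on_curveZ _ _ _ _ _ _ t0) -QE.
Qed.

Lemma pt_eq (Q Q' : C) (v v' : 'rV_5) t :
  val (val Q) = <[v]>%VS -> val (val Q') = <[v']>%VS -> t != 0 -> v = t *: v' ->
  Q = Q'.
Proof.
move=> QE QE' t0 vE; apply: val_inj; apply: val_inj.
by rewrite QE QE' vE vlineZ.
Qed.

Lemma co_line (Q : C) v : val (val Q) = <[v]>%VS ->
  exists2 t, t != 0 & pcoords (val Q) = t *: v.
Proof.
move=> QE; have : pcoords (val Q) \in <[v]>%VS by rewrite -QE memv_pick.
case/vlineP=> t tE; exists t => //; apply: contraNneq (pcoords_neq0 (val Q)).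
by move=> t0; rewrite tE t0 scale0r.
Qed.

Lemma xP_line (Q : C) v : val (val Q) = <[v]>%VS ->
  [/\ finP Q = (v 0 (@inord 4 3) != 0),
      xP Q = v 0 (@inord 4 2) / v 0 (@inord 4 3)
    & wP Q = v 0 (@inord 4 4) / v 0 (@inord 4 3)].
Proof.
case/co_line=> t t0 tE; rewrite /finP /xP /wP /co tE !mxE mulf_eq0 (negbTE t0).
split=> //; rewrite invfM mulrACA divff ?mul1r //.
Qed.

Lemma finP_line (Q : C) : finP Q -> val (val Q) = <[par (xP Q) 1 (wP Q)]>%VS.
Proof.
have [t t0 [X [Z [W [QE _ XZ]]]]] := coordsP Q.
rewrite -[val (val Q)]pcoordsK /finP /xP /wP /co QE vlineZ // /par !mxE !inordK //=.
case: XZ => [[-> [-> ->]]|->]; first by rewrite expr0n mulr0 eqxx.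
by rewrite !expr1n !mulr1 ![t * _ / t]mulrAC => t0'; rewrite divff // !mul1r.
Qed.

Lemma finP_eqn (Q : C) : finP Q ->
  wP Q ^+ 2 + hform (xP Q) 1 * wP Q = qform (xP Q) 1.
Proof.
move=> Qf; have [t t0 tE] := co_line (finP_line Qf).
apply/eqP; rewrite -on_curve_par -(on_curveZ _ _ _ _ _ _ t0) -tE.
exact: (valP Q).
Qed.

Lemma finP_inj (Q Q' : C) : finP Q -> finP Q' -> xP Q = xP Q' -> wP Q = wP Q' ->
  Q = Q'.
Proof.
move=> /finP_line QE /finP_line QE' ex ew; apply: val_inj; apply: val_inj.
by rewrite QE QE' ex ew.
Qed.

Lemma infP_line (Q : C) : ~~ finP Q -> val (val Q) = <[par 1 0 0]>%VS.
Proof.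
have [t t0 [X [Z [W [QE _ XZ]]]]] := coordsP Q.
rewrite -[val (val Q)]pcoordsK /finP /co QE vlineZ // /par !mxE !inordK //=.
by case: XZ => [[-> [-> ->]]|->]; rewrite // expr1n mulr1 t0.
Qed.

Lemma infP_inj (Q Q' : C) : ~~ finP Q -> ~~ finP Q' -> Q = Q'.
Proof.
move=> /infP_line QE /infP_line QE'; apply: val_inj; apply: val_inj.
by rewrite QE QE'.
Qed.

Lemma pt_par X Z W : (X != 0) || (Z != 0) -> W ^+ 2 + hform X Z * W = qform X Z ->
  exists Q : C, val (val Q) = <[par X Z W]>%VS.
Proof.
move=> /(par_neq0 W) nz /eqP; rewrite -on_curve_par => oc.
by exists (exist _ (ppoint nz) (ppoint_curve nz oc)).
Qed.

Lemma pt_fin x w : w ^+ 2 + hform x 1 * w = qform x 1 ->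
  exists Q : C, [/\ finP Q, xP Q = x & wP Q = w].
Proof.
move=> e; have [|Q QE] := pt_par _ e; first by rewrite oner_eq0 orbT.
exists Q; have [-> -> ->] := xP_line QE.
by rewrite /par !mxE !inordK //= !expr1n oner_eq0 mulr1 !divr1.
Qed.

Lemma eqn_solve (h q : K) : exists w, w ^+ 2 + h * w = q.
Proof.
have := @solve_monicpoly K 2 (fun i => if i == 0%N then q else - h) isT.
case=> w; rewrite !big_ord_recl big_ord0 /= => wE; exists w; rewrite wE.
by rewrite addr0 expr0 expr1 mulr1; ring.
Qed.

Lemma pt_over x : exists2 Q : C, finP Q & xP Q = x.
Proof.
have [w /pt_fin[Q [Qf Qx _]]] := eqn_solve (hform x 1) (qform x 1).
by exists Q.
Qed.

Local Notation hyp := (hyp_fun char2 (iota := iota) (a := a) (b := b) (c := c) (d := d)).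

Lemma hyp_fin (Q : C) : finP Q ->
  [/\ finP (hyp Q), xP (hyp Q) = xP Q & wP (hyp Q) = wP Q + hform (xP Q) 1].
Proof.
move=> Qf; have [t t0 tE] := co_line (finP_line Qf).
have /xP_line : val (val (hyp Q)) = <[hyp_row (par (xP Q) 1 (wP Q))]>%VS.
  by rewrite /= tE hyp_rowZ vlineZ.
rewrite /par hyp_row5 !mxE !inordK //= !expr1n oner_eq0 !mulr1 !divr1.
by case=> -> -> ->; split=> //; rewrite /hform; ring.
Qed.

(** The difference of the two equations factors as (w' - w)(w' + w + h). *)
Lemma same_x (Q Q' : C) : finP Q -> finP Q' -> xP Q = xP Q' ->
  Q' = Q \/ Q' = hyp Q.
Proof.
move=> Qf Qf' ex; have e := finP_eqn Qf; have := finP_eqn Qf'.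
have [hf hx hw] := hyp_fin Qf.
rewrite -ex -e => /eqP; rewrite -subr_eq0.
have -> : wP Q' ^+ 2 + hform (xP Q) 1 * wP Q' - (wP Q ^+ 2 + hform (xP Q) 1 * wP Q)
  = (wP Q' - wP Q) * (wP Q' + wP Q + hform (xP Q) 1) by ring.
rewrite mulf_eq0 => /orP[|]; rewrite ?subr_eq0 => /eqP e'.
  by left; apply: finP_inj.
right; apply: finP_inj => //; rewrite ?hx ?hw //.
by apply/eqP; rewrite -subr_eq0 subK2 addrA e'.
Qed.

End OneCurve.
End Points.

(** * Rational and regular functions *)

Section Cofinite.
Variables (k : fieldType) (char2 : 2%N \in [pchar k]).
Variables (K : closedFieldType) (iota : {rmorphism k -> K}).

Let char2K : 2%N \in [pchar K] := rmorph_pchar iota char2.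

Definition hpoly : {poly K} := 'X * ('X + 1).

Lemma horner_hpoly x : hpoly.[x] = hform x 1.
Proof. by rewrite /hpoly !hornerR /hform; ring. Qed.

Lemma size_hpoly : size hpoly = 3%N.
Proof.
rewrite /hpoly -[1]opprK -polyCN size_monicM ?monicX ?monic_neq0 ?monicXsubC //.
by rewrite size_polyX size_XsubC.
Qed.

Section OneCurve.
Variables (a b c d : k).
Local Notation C := (pvariety iota (curve a b c d)).

Definition curve_poly : {poly K} :=
  (iota a) *: ('X^3 * ('X + 1) ^+ 2) + ((iota b) *: ('X * ('X + 1) ^+ 2)
  + (iota c) *: ('X^2 * ('X + 1)) + (iota d) *: hpoly ^+ 2).

Lemma horner_curve_poly x : curve_poly.[x] = qform iota a b c d x 1.
Proof. rewrite /curve_poly /hpoly !hornerR.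
by rewrite /qform /hform; ring. Qed.

Lemma size_curve_poly : a != 0 -> size curve_poly = 6%N.
Proof.
move=> a0; have X1 : size ('X + 1 : {poly K}) = 2%N.
  by rewrite -[1]opprK -polyCN size_XsubC.
have X1m : ('X + 1 : {poly K}) \is monic by rewrite -[1]opprK -polyCN monicXsubC.
have X12 : size (('X + 1) ^+ 2 : {poly K}) = 3%N.
  by rewrite expr2 size_monicM ?monic_neq0 // X1.
rewrite /curve_poly size_polyDl size_scale ?fmorph_eq0 //.
  by rewrite size_monicM ?monicXn ?monic_neq0 ?monicMl ?rpredX // size_polyXn X12.
rewrite [X in (_ < X)%N]size_monicM ?monicXn ?monic_neq0 ?rpredX // size_polyXn X12.
apply: leq_ltn_trans (size_polyD _ _) _; rewrite gtn_max; apply/andP; split.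
  apply: leq_ltn_trans (size_polyD _ _) _; rewrite gtn_max; apply/andP; split.
    apply: leq_ltn_trans (size_scale_leq _ _) _.
    by rewrite size_monicM ?monicX ?monic_neq0 ?rpredX // size_polyX X12.
  apply: leq_ltn_trans (size_scale_leq _ _) _.
  by rewrite size_monicM ?monicXn ?monic_neq0 // size_polyXn X1.
apply: leq_ltn_trans (size_scale_leq _ _) _.
rewrite /hpoly expr2 !size_monicM ?rpredM ?monicX ?monic_neq0 ?rpredM ?monicX //.
by rewrite size_polyX X1.
Qed.

(** The norm to K(x) of A + B w, whose conjugate is A + B (w + h); see [ev_norm]. *)
Definition norm (A B : {poly K}) := A ^+ 2 + A * B * hpoly + B ^+ 2 * curve_poly.

(** The degree of A^2 is even and that of B^2 q is odd, q having degree 5 because a is nonzero. The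
    mixed term has degree below the larger of the two, so the leading terms cannot cancel. *)
Lemma norm_eq0 A B : a != 0 -> norm A B = 0 -> A = 0 /\ B = 0.
Proof.
move=> a0 N0; have sq := size_curve_poly a0.
have q0 : curve_poly != 0 by rewrite -size_poly_gt0 sq.
have h0 : hpoly != 0 by rewrite -size_poly_gt0 size_hpoly.
have [B0|B0] := eqVneq B 0.
  split=> //; apply/eqP; move/eqP: N0.
  by rewrite /norm B0 mulr0 mul0r expr0n mul0r !addr0 expf_eq0.
have [A0|A0] := eqVneq A 0.
  move/eqP: N0; rewrite /norm A0 expr0n !mul0r !add0r mulf_eq0 (negbTE q0).
  by rewrite expf_eq0 (negbTE B0).
have [m sA] : exists m, size A = m.+1.
  by exists (size A).-1; rewrite prednK // size_poly_gt0.
have [n sB] : exists n, size B = n.+1.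
  by exists (size B).-1; rewrite prednK // size_poly_gt0.
have sA2 : size (A ^+ 2) = (m + m).+1 by rewrite expr2 size_mul // sA; lia.
have sB2 : size (B ^+ 2 * curve_poly) = (n + n).+2.+4.
  by rewrite size_mul ?expf_neq0 // sq expr2 size_mul // sB; lia.
have sAB : size (A * B * hpoly) = (m + n).+3.
  by rewrite size_mul // ?mulf_neq0 // size_hpoly size_mul // sA sB; lia.
move/(congr1 (fun p : {poly K} => size p)): N0; rewrite /norm size_poly0.
case: (leqP m n.+2) => le_mn.
  rewrite addrC size_polyDl sB2 //.
  by apply: leq_ltn_trans (size_polyD _ _) _; rewrite gtn_max sA2 sAB; lia.
rewrite -addrA size_polyDl sA2 //.
by apply: leq_ltn_trans (size_polyD _ _) _; rewrite gtn_max sB2 sAB; lia.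
Qed.

(** Identities between rational functions are stated off a finite list of points, which avoids
    building the function field. Such statements have witnesses by [cof_ex], because K is
    infinite. *)
Definition cof (P : C -> Prop) := exists s : seq C, forall Q, Q \notin s -> P Q.

Lemma cofW (P P' : C -> Prop) : (forall Q, P Q -> P' Q) -> cof P -> cof P'.
Proof. by move=> PP' [s sP]; exists s => Q /sP/PP'. Qed.

Lemma cofT (P : C -> Prop) : (forall Q, P Q) -> cof P.
Proof. by move=> h; exists [::]. Qed.

Lemma cofI (P P' : C -> Prop) : cof P -> cof P' -> cof (fun Q => P Q /\ P' Q).
Proof.
move=> [s sP] [s' sP']; exists (s ++ s') => Q.
by rewrite mem_cat negb_or => /andP[/sP ? /sP' ?].
Qed.

Lemma cof_neq (Q0 : C) : cof (fun Q => Q <> Q0).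
Proof. by exists [:: Q0] => Q; rewrite inE => /eqP. Qed.

Lemma cof_fin : cof (@finP _ _ iota a b c d).
Proof.
have [[Q0 Q0i]|noi] := pselect (exists Q : C, ~~ finP Q); last first.
  by apply: cofT => Q; apply: contra_notT noi; exists Q.
by apply: (cofW _ (cof_neq Q0)) => Q; apply: contra_notT => Qi; exact: (infP_inj char2).
Qed.

Lemma cof_x x : cof (fun Q : C => finP Q -> xP Q <> x).
Proof.
have [Q Qf Qx] := pt_over char2 iota a b c d x.
exists [:: Q; hyp_fun char2 Q] => Q'; rewrite !inE negb_or => /andP[/eqP n1 /eqP n2].
by move=> Qf' ex; case: (@same_x _ char2 _ _ _ _ _ _ Q Q') => //; rewrite ex.
Qed.

Lemma cof_xs (s : seq K) : cof (fun Q : C => finP Q -> xP Q \notin s).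
Proof.
elim: s => [|x s IHs]; first exact: cofT.
apply: cofW (cofI (cof_x x) IHs) => Q [nx ns] Qf.
by rewrite inE negb_or ns // andbT; apply/eqP; apply: nx.
Qed.

Lemma roots_list (p : {poly K}) : p != 0 ->
  exists s : seq K, forall x, root p x -> x \in s.
Proof.
have [s {2}-> p0] := closed_field_poly_normal p; exists s => x.
by rewrite rootZ ?lead_coef_eq0 // root_prod_XsubC.
Qed.

Lemma cof_poly (p : {poly K}) : p != 0 -> cof (fun Q : C => finP Q -> p.[xP Q] != 0).
Proof.
case/roots_list=> s sP; apply: cofW (cof_xs s) => Q h /h.
by apply: contra => /sP.
Qed.

Lemma cof_ex (P : C -> Prop) : cof P -> exists2 Q, finP Q & P Q.
Proof.
case=> s sP; have [x xs] := exists_notin (map (@xP _ _ iota a b c d) s).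
have [Q Qf Qx] := pt_over char2 iota a b c d x; exists Q => //; apply: sP.
by apply: contra xs => Qs; apply/mapP; exists Q.
Qed.

Lemma poly_cof0 (p : {poly K}) : cof (fun Q : C => p.[xP Q] = 0) -> p = 0.
Proof.
move=> pc; apply/eqP; apply: contraT => /cof_poly pn.
by have [Q Qf [p0 /(_ Qf)]] := cof_ex (cofI pc pn); rewrite p0 eqxx.
Qed.

(** An element of the affine coordinate ring; for nonzero a the pair (A, B) is determined by its
    values ([ev_cof0]). *)
Definition ev (A B : {poly K}) (Q : C) := A.[xP Q] + B.[xP Q] * wP Q.

Lemma wP2 (Q : C) : finP Q -> wP Q ^+ 2 = curve_poly.[xP Q] - hpoly.[xP Q] * wP Q.
Proof. by move=> /(finP_eqn char2) e; rewrite horner_curve_poly horner_hpoly -e; ring. Qed.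

Lemma evM A B A' B' Q : finP Q -> ev A B Q * ev A' B' Q =
  ev (A * A' + B * B' * curve_poly) (A * B' + A' * B - B * B' * hpoly) Q.
Proof.
move/wP2; rewrite /ev; move: curve_poly hpoly => q h w2; rewrite !hornerR.
transitivity (A.[xP Q] * A'.[xP Q] + (A.[xP Q] * B'.[xP Q] + A'.[xP Q] * B.[xP Q])
  * wP Q + B.[xP Q] * B'.[xP Q] * wP Q ^+ 2); first by ring.
by rewrite w2; ring.
Qed.

Lemma evMx A B A' B' : exists A2 B2,
  forall Q, finP Q -> ev A B Q * ev A' B' Q = ev A2 B2 Q.
Proof. by eexists; eexists => Q; apply: evM. Qed.

Lemma evD A B A' B' Q : ev A B Q + ev A' B' Q = ev (A + A') (B + B') Q.
Proof. by rewrite /ev !hornerD; ring. Qed.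

Lemma evB A B A' B' Q : ev A B Q - ev A' B' Q = ev (A - A') (B - B') Q.
Proof. by rewrite /ev !hornerR; ring. Qed.

Lemma evC x Q : ev x%:P 0 Q = x.
Proof. by rewrite /ev hornerC horner0 mul0r addr0. Qed.

Lemma evp p Q : ev p 0 Q = p.[xP Q].
Proof. by rewrite /ev horner0 mul0r addr0. Qed.

Lemma ev_norm A B Q : finP Q ->
  ev A B Q * ev (A + B * hpoly) B Q = (norm A B).[xP Q].
Proof.
move=> Qf; rewrite evM // -evp; congr (ev _ _ Q); first by rewrite /norm; ring.
apply: (@eq_pchar2 _ _ _ (A * B)); last by ring.
exact: (rmorph_pchar (@polyC K) char2K).
Qed.

Lemma ev_hyp A B Q : finP Q ->
  ev A B (hyp_fun char2 Q) = ev (A + B * hpoly) B Q.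
Proof.
move=> Qf; have [_ hx hw] := hyp_fin char2 Qf.
by rewrite /ev hx hw hornerD hornerM horner_hpoly; ring.
Qed.

Lemma ev_cof0 A B : a != 0 -> cof (fun Q : C => ev A B Q = 0) -> A = 0 /\ B = 0.
Proof.
move=> a0 c0; apply: norm_eq0 => //; apply: poly_cof0.
by apply: cofW (cofI c0 cof_fin) => Q [e Qf]; rewrite -ev_norm // e mul0r.
Qed.

(** The zeros of a nonzero function lie over the finitely many zeros of its norm. *)
Lemma cof_ev A B (Q0 : C) : a != 0 -> ev A B Q0 <> 0 ->
  cof (fun Q : C => finP Q -> ev A B Q != 0).
Proof.
move=> a0 e0; have : norm A B != 0.
  by apply: contra_notN e0 => /eqP/(norm_eq0 a0)[-> ->]; rewrite evp horner0.
move/cof_poly; apply: cofW => Q nQ Qf.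
by apply: contraNneq (nQ Qf) => e; rewrite -ev_norm // e mul0r.
Qed.

(* phi extends to a regular function near Q0 with value v at Q0: phi may differ *)
(* from this function at finitely many points, Q0 included.                    *)
Definition regat (phi : C -> K) (Q0 : C) (v : K) :=
  exists A B D E, [/\ ev D E Q0 <> 0, ev A B Q0 = v * ev D E Q0
    & cof (fun Q => phi Q * ev D E Q = ev A B Q)].

Section Regat.
Variables (a0 : a != 0) (Q0 : C) (Q0f : finP Q0).

Lemma regat_ext phi psi v : cof (fun Q => phi Q = psi Q) -> regat phi Q0 v ->
  regat psi Q0 v.
Proof.
move=> e [A [B [D [E [d0 n0 nd]]]]]; exists A, B, D, E; split=> //.
by apply: cofW (cofI e nd) => Q [<-].
Qed.

Lemma regat_ev A B : regat (ev A B) Q0 (ev A B Q0).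
Proof.
exists A, B, 1, 0; rewrite evp hornerE; split; [exact/eqP/oner_neq0|by rewrite mulr1|].
by apply: cofT => Q; rewrite evp hornerE mulr1.
Qed.

Lemma regat_const x : regat (fun=> x) Q0 x.
Proof.
have := regat_ev x%:P 0; rewrite evC; apply: regat_ext.
by apply: cofT => Q; rewrite evC.
Qed.

Lemma regatM phi psi u v : regat phi Q0 u -> regat psi Q0 v ->
  regat (fun Q => phi Q * psi Q) Q0 (u * v).
Proof.
move=> [A [B [D [E [d0 n0 nd]]]]] [A' [B' [D' [E' [d0' n0' nd']]]]].
have [D2 [E2 e1]] := evMx D E D' E'; have [A2 [B2 e2]] := evMx A B A' B'.
exists A2, B2, D2, E2; split; rewrite -?e1 -?e2 //.
- by apply/eqP; apply: mulf_neq0; apply/eqP.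
- by rewrite n0 n0'; ring.
apply: cofW (cofI cof_fin (cofI nd nd')) => Q [Qf [h h']].
by rewrite -e1 // -e2 // -h -h'; ring.
Qed.

Lemma regatD phi psi u v : regat phi Q0 u -> regat psi Q0 v ->
  regat (fun Q => phi Q + psi Q) Q0 (u + v).
Proof.
move=> [A [B [D [E [d0 n0 nd]]]]] [A' [B' [D' [E' [d0' n0' nd']]]]].
have [A1 [B1 e1]] := evMx A' B' D E; have [A2 [B2 e2]] := evMx A B D' E'.
have [D2 [E2 e3]] := evMx D E D' E'.
exists (A1 + A2), (B1 + B2), D2, E2; split; rewrite -?evD -?e1 -?e2 -?e3 //.
- by apply/eqP; apply: mulf_neq0; apply/eqP.
- by rewrite n0 n0'; ring.
apply: cofW (cofI cof_fin (cofI nd nd')) => Q [Qf [h h']].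
by rewrite -evD -e1 // -e2 // -e3 // -h -h'; ring.
Qed.

Lemma regatV phi v : v != 0 -> regat phi Q0 v ->
  regat (fun Q => (phi Q)^-1) Q0 v^-1.
Proof.
move=> v0 [A [B [D [E [d0 n0 nd]]]]].
have nz : ev A B Q0 <> 0.
  by rewrite n0; apply/eqP; rewrite mulf_neq0 //; apply/eqP.
exists D, E, A, B; split=> //; first by rewrite n0 mulKf.
apply: cofW (cofI cof_fin (cofI nd (cof_ev a0 nz))) => Q [Qf [e /(_ Qf) nQ]].
rewrite -e mulKf //; apply: contraNneq nQ => p0.
by rewrite -e p0 mul0r.
Qed.

Lemma regat_poly phi v (p : {poly K}) : regat phi Q0 v ->
  regat (fun Q => p.[phi Q]) Q0 p.[v].
Proof.
move=> rp; elim/poly_ind: p => [|p x IHp].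
  by rewrite horner0; apply: regat_ext (regat_const 0); apply: cofT => Q; rewrite horner0.
rewrite hornerMXaddC; apply: regat_ext (regatD (regatM IHp rp) (regat_const x)).
by apply: cofT => Q; rewrite hornerMXaddC.
Qed.

(** Away from the branch points x - x(Q0) is a local parameter. Multiplying numerator and
    denominator by a function that vanishes at the conjugate of Q0 but not at Q0 makes the numerator
    vanish at both points over t = x(Q0), so that x - t divides it. *)
Lemma regat_div phi : (hform (xP Q0) 1 != 0) -> regat phi Q0 0 ->
  exists v, regat (fun Q => phi Q / (xP Q - xP Q0)) Q0 v.
Proof.
move=> h0 [A [B [D [E [d0 n0 nd]]]]].
set t := xP Q0; rewrite mul0r in n0.
(* The value of w at the conjugate point. *)
pose w' := wP Q0 + hform t 1.
have evw Q : ev (- w'%:P) 1 Q = wP Q - w'.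
  by rewrite /ev hornerN -[1]/(1%:P) !hornerC mul1r addrC.
have h0p : ev (- w'%:P) 1 Q0 <> 0.
  rewrite evw /w' opprD addrA subrr sub0r.
  by apply/eqP; rewrite oppr_eq0.
have [A1 [B1 e1]] := evMx A B (- w'%:P) 1.
have n1 : ev A1 B1 Q0 = 0 by rewrite -e1 // n0 mul0r.
have n2 : ev A1 B1 (hyp_fun char2 Q0) = 0.
  have [hf hx hw] := hyp_fin char2 Q0f.
  by rewrite -e1 // evw hw /w' subrr mulr0.
have [hf hx hw] := hyp_fin char2 Q0f.
(* The values of A1 + B1 w at the two points over t differ by B1(t) h(t). *)
have B1t : B1.[t] = 0.
  apply: (mulIf h0); rewrite mul0r -[RHS](subrr 0) -{1}n2 -{1}n1 /ev hx hw -/t; ring.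
have A1t : A1.[t] = 0 by move: n1; rewrite /ev -/t B1t mul0r addr0.
have /factor_theorem[A2 A2E] : root A1 t by apply/rootP.
have /factor_theorem[B2 B2E] : root B1 t by apply/rootP.
have [D1 [E1 e2]] := evMx D E (- w'%:P) 1.
have d1 : ev D1 E1 Q0 <> 0.
  by rewrite -e2 //; apply/eqP; apply: mulf_neq0; apply/eqP.
exists (ev A2 B2 Q0 / ev D1 E1 Q0), A2, B2, D1, E1; split=> //.
  by rewrite divfK //; apply/eqP.
apply: cofW (cofI cof_fin (cofI nd (cof_x t))) => Q [Qf [e /(_ Qf) /eqP nx]].
have xt : xP Q - t != 0 by rewrite subr_eq0.
apply: (mulfI xt); rewrite mulrA mulrCA mulfV // mulr1 -e2 // mulrA e e1 //.
by rewrite /ev A2E B2E !hornerR; ring.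
Qed.

End Regat.

(* The denominators of phi form an ideal; by the norm it meets K[x] in a       *)
(* nonzero ideal, whose generator has no root.                                 *)
Lemma regular_everywhere phi : a != 0 ->
  (forall Q, finP Q -> exists v, regat phi Q v) ->
  exists A B, cof (fun Q => phi Q = ev A B Q).
Proof.
move=> a0 rp.
pose den (D E : {poly K}) := exists A B, cof (fun Q => phi Q * ev D E Q = ev A B Q).
have denM D E D' E' D2 E2 : den D E ->
    (forall Q, finP Q -> ev D E Q * ev D' E' Q = ev D2 E2 Q) -> den D2 E2.
  move=> [A [B AB]] h; eexists; eexists.
  apply: cofW (cofI cof_fin AB) => Q [Qf e].
  by rewrite -h // mulrA e evM.
have denD D E D' E' : den D E -> den D' E' -> den (D + D') (E + E').
  move=> [A [B AB]] [A' [B' AB']]; exists (A + A'), (B + B').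
  by apply: cofW (cofI AB AB') => Q [e e']; rewrite -!evD mulrDr e e'.
have denp p q : den p 0 -> den (p * q) 0.
  by move=> dp; apply: (denM _ _ q 0 _ _ dp) => Q Qf; rewrite !evp hornerM.
(* A denominator that vanishes at neither point over x has a norm, again a denominator, that is
   nonzero at x. *)
have denx x : exists2 p, den p 0 & p.[x] != 0.
  have [Q Qf Qx] := pt_over char2 iota a b c d x.
  have [hf hx hw] := hyp_fin char2 Qf.
  have [D [E [dDE d1 d2]]] : exists D E, [/\ den D E, ev D E Q != 0
      & ev D E (hyp_fun char2 Q) != 0].
    have [v [A [B [D [E [/eqP d0 _ nd]]]]]] := rp Q Qf.
    have [v' [A' [B' [D' [E' [/eqP d0' _ nd']]]]]] := rp _ hf.
    have dd : den D E by exists A, B.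
    have dd' : den D' E' by exists A', B'.
    have [e1|] := eqVneq (ev D E (hyp_fun char2 Q)) 0; last by exists D, E.
    have [e2|] := eqVneq (ev D' E' Q) 0; last by exists D', E'.
    (* Each denominator vanishes exactly at the one of the two points where the other does not, so
       their sum vanishes at neither. *)
    exists (D + D'), (E + E'); rewrite -!evD e1 e2 addr0 add0r.
    by split=> //; apply: denD.
  exists (norm D E); last by rewrite -Qx -ev_norm // -ev_hyp // mulf_neq0.
  by apply: (denM _ _ _ _ _ _ dDE) => Q' Qf'; rewrite evp; apply: ev_norm.
have [p [dp p0 pmin]] : exists p, [/\ den p 0, p != 0
    & forall p', den p' 0 -> p' != 0 -> (size p <= size p')%N].
  have ex : exists n, `[< exists p, [/\ den p 0, p != 0 & size p = n] >].
    have [p dp px] := denx 0; exists (size p); apply/asboolP; exists p; split=> //.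
    by apply: contraNneq px => ->; rewrite horner0.
  case: (ex_minnP ex) => n /asboolP[p [dp p0 <-]] min; exists p; split=> // p' dp' p0'.
  by apply: min; apply/asboolP; exists p'.
have [|sp] := eqVneq (size p) 1%N.
  case/eqP/size_poly1P=> u u0 pE; have [A [B AB]] : den 1 0.
    have -> : 1 = p * (u^-1)%:P by rewrite pE -polyCM divff.
    exact: denp.
  by exists A, B; apply: cofW AB => Q; rewrite evp hornerE mulr1.
(* At a root x of the minimal denominator p, another denominator is nonzero; its remainder modulo p
   is then a smaller nonzero denominator. *)
have [x /rootP px] := closed_rootP p sp.
have [p' dp' px'] := denx x.
have dr : den (p' %% p) 0.
  have -> : p' %% p = p' + p * (- (p' %/ p)).
    by rewrite {2}(divp_eq p' p); ring.
  by rewrite -[0](addr0 0); apply: denD => //; apply: denp.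
have r0 : p' %% p != 0.
  apply: contraNneq px' => r0.
  by rewrite (divp_eq p' p) r0 addr0 hornerM px mulr0.
by have := pmin _ dr r0; rewrite leqNgt ltn_modp p0.
Qed.

End OneCurve.
End Cofinite.

(** * Functions with coefficients in k, and regular maps in affine coordinates *)

Section Forms.
Variables (k : fieldType) (char2 : 2%N \in [pchar k]).
Variables (K : closedFieldType) (iota : {rmorphism k -> K}).

Section OneCurve.
Variables (a b c d : k).
Local Notation C := (pvariety iota (curve a b c d)).

Lemma co_fin (Q : C) : finP Q ->
  [/\ co Q 0 = co Q 3 * xP Q ^+ 3, co Q 1 = co Q 3 * xP Q ^+ 2,
      co Q 2 = co Q 3 * xP Q & co Q 4 = co Q 3 * wP Q].
Proof.
move=> Qf; have [t _ tE] := co_line (finP_line char2 Qf).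
move: (xP Q) (wP Q) tE => x w tE.
by rewrite /co tE /par !mxE !inordK //= !expr1n !mulr1.
Qed.

Lemma co_inf (Q : C) : ~~ finP Q -> [/\ co Q 0 != 0, co Q 1 = 0, co Q 2 = 0,
  co Q 3 = 0 & co Q 4 = 0].
Proof.
move=> Qf; have [t t0 tE] := co_line (infP_line char2 Qf).
by rewrite /co tE /par !mxE !inordK //= !expr0n /= expr1n !mulr0 mulr1.
Qed.

Lemma co_neq0 (Q : C) : exists2 i, (i < 5)%N & co Q i != 0.
Proof.
have [Qf|/co_inf[]] := boolP (finP Q); first by exists 3%N.
by exists 0%N.
Qed.

Lemma pt_eq_co (Q Q' : C) t : (forall i, (i < 5)%N -> co Q i = t * co Q' i) ->
  Q = Q'.
Proof.
move=> e; have t0 : t != 0.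
  have [i i5] := co_neq0 Q; rewrite e //.
  by apply: contraNneq => ->; rewrite mul0r.
apply: (pt_eq (esym (pcoordsK (val Q))) (esym (pcoordsK (val Q'))) t0).
by apply/rowP=> i; rewrite !mxE -(inord_val i); apply: (e i).
Qed.

(** The coefficients are kept in k rather than K: this is what later brings the shift u down to
    k. *)
Definition kpoly (phi : C -> K) := exists A B : {poly k},
  forall Q, finP Q -> phi Q = ev (map_poly iota A) (map_poly iota B) Q.

Lemma kpoly_const x : kpoly (fun=> iota x).
Proof. by exists x%:P, 0 => Q _; rewrite map_polyC rmorph0 evC. Qed.

Lemma kpolyD phi psi : kpoly phi -> kpoly psi -> kpoly (fun Q => phi Q + psi Q).
Proof.
move=> [A [B e]] [A' [B' e']]; exists (A + A'), (B + B') => Q Qf.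
by rewrite e // e' // evD !rmorphD.
Qed.

Lemma kpolyM phi psi : kpoly phi -> kpoly psi -> kpoly (fun Q => phi Q * psi Q).
Proof.
move=> [A [B e]] [A' [B' e']].
pose h : {poly k} := 'X * ('X + 1).
pose q : {poly k} := a *: ('X^3 * ('X + 1) ^+ 2) + (b *: ('X * ('X + 1) ^+ 2)
  + c *: ('X^2 * ('X + 1)) + d *: h ^+ 2).
have hE : map_poly iota h = hpoly K by rewrite rmorphM rmorphD /= map_polyX rmorph1.
have qE : map_poly iota q = curve_poly iota a b c d.
  have X1 : map_poly iota ('X + 1) = 'X + 1 by rewrite rmorphD /= map_polyX rmorph1.
  have mM (p p' : {poly k}) : map_poly iota (p * p') = map_poly iota p * map_poly iota p'.
    exact: rmorphM.
  by rewrite /q !rmorphD /= !map_polyZ !mM !map_polyX X1.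
clearbody q h.
exists (A * A' + B * B' * q), (A * B' + A' * B - B * B' * h) => Q Qf.
by rewrite e // e' // evM // !(rmorphB, rmorphD, rmorphM) /= hE qE.
Qed.

Lemma kpolyX phi n : kpoly phi -> kpoly (fun Q => phi Q ^+ n).
Proof.
move=> kp; elim: n => [|n IHn].
  by have [A [B e]] := kpoly_const 1; exists A, B => Q /e <-; rewrite rmorph1 expr0.
have [A [B e]] := kpolyM kp IHn; exists A, B => Q Qf.
by rewrite exprS e.
Qed.

Lemma kpoly_evalp (p : {mpoly k[5]}) :
  kpoly (fun Q => evalp iota p (par (xP Q) 1 (wP Q))).
Proof.
have kx i : kpoly (fun Q => par (xP Q) 1 (wP Q) 0 i).
  have kp (A B : {poly k}) (phi : C -> K) :
      (forall Q, phi Q = ev (map_poly iota A) (map_poly iota B) Q) -> kpoly phi.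
    by move=> e; exists A, B => Q _.
  have mx n : map_poly iota 'X^n = 'X^n by rewrite map_polyXn.
  case: i => [[|[|[|[|[|i]]]]] lt_i] //.
  - by apply: (kp 'X^3 0) => Q; rewrite mx rmorph0 evp !mxE hornerXn.
  - by apply: (kp 'X^2 0) => Q; rewrite mx rmorph0 evp !mxE hornerXn /= mulr1.
  - by apply: (kp 'X^1 0) => Q; rewrite mx rmorph0 evp !mxE hornerXn /= expr1n mulr1.
  - by apply: (kp 1%:P 0) => Q; rewrite map_polyC rmorph0 evC !mxE /= rmorph1 expr1n.
  apply: (kp 0 1) => Q; rewrite rmorph0 rmorph1 /ev horner0 add0r.
  by rewrite -polyC1 hornerC mul1r !mxE.
have ks (I : Type) (r : seq I) (F : I -> C -> K) : (forall i, kpoly (F i)) ->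
    kpoly (fun Q => \sum_(i <- r) F i Q).
  move=> kF; elim: r => [|i r IHr].
    have [A [B e]] := kpoly_const 0; exists A, B => Q /e <-.
    by rewrite rmorph0 big_nil.
  have [A [B e]] := kpolyD (kF i) IHr; exists A, B => Q /e <-.
  by rewrite big_cons.
have kpr (I : Type) (r : seq I) (F : I -> C -> K) : (forall i, kpoly (F i)) ->
    kpoly (fun Q => \prod_(i <- r) F i Q).
  move=> kF; elim: r => [|i r IHr].
    have [A [B e]] := kpoly_const 1; exists A, B => Q /e <-.
    by rewrite rmorph1 big_nil.
  have [A [B e]] := kpolyM (kF i) IHr; exists A, B => Q /e <-.
  by rewrite big_cons.
apply: ks => m; apply: kpolyM; first exact: kpoly_const.
by apply: kpr => i; apply: kpolyX; apply: kx.
Qed.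

End OneCurve.

Section Maps.
Variables (a b c d a' b' c' d' : k).
Local Notation C1 := (pvariety iota (curve a b c d)).
Local Notation C2 := (pvariety iota (curve a' b' c' d')).
Variables (a0 : a != 0) (a0' : a' != 0).

(** Evaluating the forms that define f near Q0 at (x^3, x^2, x, 1, w) gives five functions over k
    proportional to the coordinates of f. One of them is nonzero at Q0, hence at almost every point,
    so these forms describe f almost everywhere. *)
Lemma regular_fin (f : C1 -> C2) (Q0 : C1) : regular_map f -> finP Q0 ->
  exists G : C1 -> nat -> K,
  [/\ forall i, kpoly (G^~ i),
      exists2 t, t != 0 & forall i, (i < 5)%N -> G Q0 i = t * co (f Q0) i
    & cof (fun Q => exists2 t, t != 0 & forall i, (i < 5)%N -> G Q i = t * co (f Q) i)].
Proof.
move=> rf Q0f; have [D [F [hF nzF fE]]] := rf Q0.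
pose G (Q : C1) i := evalp iota (F (@inord 4 i)) (par (xP Q) 1 (wP Q)).
have GE Q : finP Q -> exists2 t, t != 0 & forall i : 'I_5,
    evalpv iota F (pcoords (val Q)) 0 i = t * G Q i.
  move=> Qf; have [t t0 tE] := co_line (finP_line char2 Qf).
  exists (t ^+ D); first by rewrite expf_neq0.
  by move=> i; rewrite mxE tE (evalp_homog _ _ _ (hF i)) /G inord_val.
have Gf Q : finP Q -> evalpv iota F (pcoords (val Q)) != 0 ->
    exists2 t, t != 0 & forall i, (i < 5)%N -> G Q i = t * co (f Q) i.
  move=> Qf nz; have [t t0 tE] := GE Q Qf.
  have [s s0 sE] := co_line (fE Q nz).
  exists (t * s)^-1; first by rewrite invr_eq0 mulf_neq0.
  move=> i i5; rewrite /co sE mxE tE inordK //.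
  by field; rewrite s0 t0.
exists G; split; [by move=> i; apply: kpoly_evalp|exact: Gf|].
have [i i5 Gi] : exists2 i, (i < 5)%N & G Q0 i <> 0.
  have [t t0 tE] := Gf _ Q0f nzF; have [i i5 ci] := co_neq0 (f Q0).
  by exists i => //; rewrite tE //; apply/eqP; rewrite mulf_neq0.
have [A [B AB]] := kpoly_evalp a b c d (F (@inord 4 i)).
have nz : ev (map_poly iota A) (map_poly iota B) Q0 <> 0 by rewrite -AB.
apply: cofW (cofI (cof_fin char2 iota a b c d) (cof_ev char2 a0 nz)) => Q [Qf /(_ Qf) nQ].
apply: Gf => //; have [t t0 tE] := GE Q Qf.
apply: contraNneq nQ => e; rewrite -AB // -/(G Q i).
have := tE (inord i); rewrite e mxE inordK // => /esym/eqP.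
by rewrite mulf_eq0 (negbTE t0).
Qed.

Lemma cof_map (f : C1 -> C2) (g : C2 -> C1) (P : C2 -> Prop) : cancel f g ->
  cof P -> cof (fun Q => P (f Q)).
Proof.
move=> fK [s sP]; exists (map g s) => Q Qs; apply: sP.
by apply: contra Qs => /(map_f g); rewrite fK.
Qed.

(** The 2 x 2 minors of the two coordinate vectors are elements of the coordinate ring that vanish
    almost everywhere, hence everywhere. *)
Lemma regular_eq_fin (f f' : C1 -> C2) : regular_map f -> regular_map f' ->
  cof (fun Q => f Q = f' Q) -> forall Q, finP Q -> f Q = f' Q.
Proof.
move=> rf rf' ff' Q0 Q0f.
have [G [kG [t t0 tE] Gf]] := regular_fin rf Q0f.
have [G' [kG' [t' t0' tE'] Gf']] := regular_fin rf' Q0f.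
have minor i j : (i < 5)%N -> (j < 5)%N -> G Q0 i * G' Q0 j = G Q0 j * G' Q0 i.
  move=> i5 j5; have [A [B AB]] := kpolyM (kG i) (kG' j).
  have [A' [B' AB']] := kpolyM (kG j) (kG' i).
  rewrite AB // AB' //; apply/eqP; rewrite -subr_eq0 evB; apply/eqP.
  set A2 := (_ - _); set B2 := (_ - _).
  have [|eA eB] := @ev_cof0 _ char2 _ iota a b c d A2 B2 a0.
    2: by rewrite eA eB evp horner0.
  apply: cofW (cofI (cof_fin char2 iota a b c d) (cofI ff' (cofI Gf Gf'))) => Q.
  case=> Qf [e [[s _ sE] [s' _ sE']]].
  by rewrite -evB -AB // -AB' // !sE // !sE' // e; ring.
have [j j5 cj] := co_neq0 (f' Q0).
apply: (@pt_eq_co _ _ _ _ _ _ (co (f Q0) j / co (f' Q0) j)) => i i5.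
have := minor i j i5 j5; rewrite !tE // !tE' // => e.
apply: (mulfI t0); apply: (mulfI t0'); apply: (mulIf cj).
transitivity (t * co (f Q0) i * (t' * co (f' Q0) j)); first by ring.
by rewrite e; field.
Qed.

Variables (f : C1 -> C2) (g : C2 -> C1).
Hypotheses (fK : cancel f g) (gK : cancel g f).
Hypotheses (rf : regular_map f) (rg : regular_map g).

Lemma cof_fin_map : cof (fun Q => finP (f Q)).
Proof. exact: (cof_map fK (cof_fin char2 _ _ _ _ _)). Qed.

Lemma cof_x_map t : cof (fun Q => xP (f Q) != t).
Proof.
apply: cofW (cofI cof_fin_map (cof_map fK (cof_x char2 iota a' b' c' d' t))).
by move=> Q [Qf /(_ Qf)/eqP].
Qed.

Lemma regat_quot (Q0 : C1) (phi psi theta : C1 -> K) v : kpoly phi -> kpoly psi ->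
  psi Q0 != 0 -> phi Q0 = v * psi Q0 -> finP Q0 ->
  cof (fun Q => theta Q * psi Q = phi Q) -> regat theta Q0 v.
Proof.
move=> [A [B e]] [D [E e']] n0 v0 Q0f nd; exists (map_poly iota A), (map_poly iota B).
exists (map_poly iota D), (map_poly iota E); rewrite -e' // -e //; split=> //.
  exact/eqP.
apply: cofW (cofI (cof_fin char2 iota a b c d) nd) => Q [Qf h].
by rewrite -e' // -e.
Qed.

Lemma regat_x (Q0 : C1) : finP Q0 -> finP (f Q0) ->
  regat (fun Q => xP (f Q)) Q0 (xP (f Q0)).
Proof.
move=> Q0f fQ0f; have [G [kG [t t0 tE] Gf]] := regular_fin rf Q0f.
apply: (regat_quot (kG 2%N) (kG 3%N)) => //; first by rewrite tE // mulf_neq0.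
  by have [_ _ e _] := co_fin fQ0f; rewrite !tE // e; ring.
apply: cofW (cofI cof_fin_map Gf) => Q [fQf [s s0 sE]].
by have [_ _ e _] := co_fin fQf; rewrite !sE // e; ring.
Qed.

Lemma regat_w (Q0 : C1) : finP Q0 -> finP (f Q0) ->
  regat (fun Q => wP (f Q)) Q0 (wP (f Q0)).
Proof.
move=> Q0f fQ0f; have [G [kG [t t0 tE] Gf]] := regular_fin rf Q0f.
apply: (regat_quot (kG 4%N) (kG 3%N)) => //; first by rewrite tE // mulf_neq0.
  by have [_ _ _ e] := co_fin fQ0f; rewrite !tE // e; ring.
apply: cofW (cofI cof_fin_map Gf) => Q [fQf [s s0 sE]].
by have [_ _ _ e] := co_fin fQf; rewrite !sE // e; ring.
Qed.

Lemma regat_pull (Q0 : C1) psi v : finP Q0 -> finP (f Q0) ->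
  regat psi (f Q0) v -> regat (fun Q => psi (f Q)) Q0 v.
Proof.
move=> Q0f fQ0f [A [B [D [E [d0 n0 nd]]]]].
have pull A' B' : regat (fun Q => ev A' B' (f Q)) Q0 (ev A' B' (f Q0)).
  apply: regatD => //; first by apply: regat_poly => //; apply: regat_x.
  by apply: regatM => //; [apply: regat_poly => //; apply: regat_x|apply: regat_w].
have d0' : ev D E (f Q0) != 0 by apply/eqP.
have -> : v = ev A B (f Q0) * (ev D E (f Q0))^-1 by rewrite n0 mulfK.
apply: regat_ext (regatM char2 Q0f (pull A B) (regatV char2 a0 d0' (pull D E))).
apply: cofW (cofI cof_fin_map (cofI (cof_map fK nd) (cof_map fK (cof_ev char2 a0' d0)))).
by move=> Q [fQf [<- /(_ fQf) nQ]]; rewrite mulfK.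
Qed.

(** Only a point that f sends to infinity needs care; there 1/(x - t) is rewritten as u1/(u0 - t
    u1), with u0 nonzero and u1 = 0. *)
Lemma regat_fibre (t : K) (Q0 : C1) : finP Q0 -> (finP (f Q0) -> xP (f Q0) != t) ->
  exists v, regat (fun Q => (xP (f Q) - t)^-1) Q0 v.
Proof.
move=> Q0f; have [fQ0f /(_ isT) nt|fQ0i _] := boolP (finP (f Q0)).
  exists (xP (f Q0) - t)^-1; apply: regatV => //; first by rewrite subr_eq0.
  by apply: regatD => //; [apply: regat_x|apply: regat_const].
have [G [kG [s s0 sE] Gf]] := regular_fin rf Q0f; have [c0 c1 _ _ _] := co_inf fQ0i.
have rG i : regat (G^~ i) Q0 (G Q0 i).
  have [A [B AB]] := kG i; rewrite AB //.
  apply: regat_ext (regat_ev Q0 (map_poly iota A) (map_poly iota B)).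
  by apply: cofW (cof_fin char2 iota a b c d) => Q Qf; rewrite -AB.
have nz : G Q0 0%N + - t * G Q0 1%N != 0.
  by rewrite !sE // c1 !mulr0 addr0 mulf_neq0.
exists (G Q0 1%N * (G Q0 0%N + - t * G Q0 1%N)^-1).
have rd := regatD char2 Q0f (rG 0%N) (regatM char2 Q0f (regat_const Q0 (- t)) (rG 1%N)).
apply: regat_ext (regatM char2 Q0f (rG 1%N) (regatV char2 a0 nz rd)).
apply: cofW (cofI cof_fin_map (cofI (cof_x_map 0) (cofI (cof_x_map t) Gf))).
move=> Q [fQf [x0 [xt [r r0 rE]]]]; have [e0 e1 _ _] := co_fin fQf.
rewrite !rE // e0 e1; have c3 : co (f Q) 3 != 0 by [].
have xt' : xP (f Q) - t != 0 by rewrite subr_eq0.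
have -> : r * (co (f Q) 3 * xP (f Q) ^+ 3) + - t * (r * (co (f Q) 3 * xP (f Q) ^+ 2))
  = r * co (f Q) 3 * xP (f Q) ^+ 2 * (xP (f Q) - t) by ring.
by field; rewrite r0 c3 x0 xt'.
Qed.

End Maps.

(** The pole of 1/(x o f - t) at Q0 is cancelled by x - x(Q0): apply [regat_div] on the target to x
    o g - x(Q0), which vanishes at f Q0, and pull the quotient back along f. *)
Lemma regat_pole a b c d a' b' c' d' (f : pvariety iota (curve a b c d) ->
    pvariety iota (curve a' b' c' d')) g Q0 :
  a != 0 -> a' != 0 -> cancel f g -> cancel g f -> regular_map f -> regular_map g ->
  finP Q0 -> finP (f Q0) -> hform (xP (f Q0)) 1 != 0 ->
  exists v, regat (fun Q => (xP Q - xP Q0) / (xP (f Q) - xP (f Q0))) Q0 v.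
Proof.
move=> a0 a0' fK gK rf rg Q0f fQ0f h0.
have [|v rv] := @regat_div _ char2 _ iota a' b' c' d' (f Q0) fQ0f
   (fun N => xP (g N) + - xP Q0) h0.
  rewrite -(subrr (xP Q0)); apply: regatD => //; last exact: regat_const.
  have := regat_x a0' gK rg fQ0f; rewrite fK; exact.
exists v; apply: regat_ext (regat_pull a0 a0' fK rf Q0f fQ0f rv).
by apply: cofT => Q; rewrite fK.
Qed.

End Forms.

(** * The isomorphisms lifting Gamma *)

Section LinearMaps.
Variables (k : fieldType) (char2 : 2%N \in [pchar k]).
Variables (K : closedFieldType) (iota : {rmorphism k -> K}).
Let char2K : 2%N \in [pchar K] := rmorph_pchar iota char2.

(* The action of Gamma on the triple X, Y = X + Z, Z, which it permutes.       *)
Definition Gamma_triple (R : Type) (g : Gamma) (X Y Z : R) : R * R * R :=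
  match g with
  | G_x        => (X, Y, Z)
  | G_inv      => (Z, Y, X)
  | G_add1     => (Y, X, Z)
  | G_x_div    => (X, Z, Y)
  | G_1_div    => (Z, X, Y)
  | G_add1_div => (Y, Z, X)
  end.

Definition Gamma_X g (X Z : K) := (Gamma_triple g X (X + Z) Z).1.1.
Definition Gamma_Y g (X Z : K) := (Gamma_triple g X (X + Z) Z).1.2.
Definition Gamma_Z g (X Z : K) := (Gamma_triple g X (X + Z) Z).2.

Lemma Gamma_XZ g X Z : Gamma_X g X Z + Gamma_Z g X Z = Gamma_Y g X Z.
Proof.
by case: g; rewrite /Gamma_X /Gamma_Y /Gamma_Z /=; first [ring
  | apply: (@eq_pchar2 _ _ _ Z) => //; ring | apply: (@eq_pchar2 _ _ _ X) => //; ring].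
Qed.

Lemma hform_Gamma g X Z : hform (Gamma_X g X Z) (Gamma_Z g X Z) = hform X Z.
Proof.
rewrite /hform Gamma_XZ.
by case: g; rewrite /Gamma_X /Gamma_Y /Gamma_Z /=; ring.
Qed.

Lemma Gamma_neq0 g X Z : (X != 0) || (Z != 0) ->
  (Gamma_X g X Z != 0) || (Gamma_Z g X Z != 0).
Proof.
rewrite -!negb_and; apply: contra => /andP[/eqP eX /eqP eZ].
have := Gamma_XZ g X Z; rewrite eX eZ addr0 => /esym eY; move: eX eY eZ.
by case: g; rewrite /Gamma_X /Gamma_Y /Gamma_Z /= => *; apply/andP; split; apply/eqP.
Qed.

Definition quad := (k * k * k * k)%type.
Definition curve_of (n : quad) := let: (a, b, c, d) := n in curve a b c d.

(** The action of Gamma lifted from classes of d to representatives. It gives the parameters of the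
    source of (x, y) |-> (g(x), y + u) in terms of those of the target. *)
Definition twist (g : Gamma) (u : k) (n : quad) : quad :=
  let: (a, b, c, d) := n in
  match g with
  | G_x        => (a, b, c, d + (u + u ^+ 2))
  | G_inv      => (b, a, c, d + c + (u + u ^+ 2))
  | G_add1     => (a, c, b, d + a + (u + u ^+ 2))
  | G_x_div    => (c, b, a, d + c + b + a + (u + u ^+ 2))
  | G_1_div    => (b, c, a, d + c + b + (u + u ^+ 2))
  | G_add1_div => (c, a, b, d + b + a + (u + u ^+ 2))
  end.

Definition qform_of (n : quad) := let: (a, b, c, d) := n in qform iota a b c d.

Lemma qform_twist g u n X Z : qform_of n (Gamma_X g X Z) (Gamma_Z g X Z)
  = qform_of (twist g u n) X Z + (iota u + iota u ^+ 2) * hform X Z ^+ 2.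
Proof.
case: n => [[[a b] c] d].
pose q3 (a b c d X Y Z : K) :=
  X * Y * Z * (a * X ^+ 2 * Y + b * Z ^+ 2 * Y + c * X * Z ^+ 2) + d * (X * Y * Z) ^+ 2.
have qE a' b' c' d' U V : qform_of (a', b', c', d') U V =
    q3 (iota a') (iota b') (iota c') (iota d') U (U + V) V.
  by rewrite /= /qform /hform /q3; ring.
have gE : qform_of (a, b, c, d) (Gamma_X g X Z) (Gamma_Z g X Z) =
    q3 (iota a) (iota b) (iota c) (iota d)
       (Gamma_X g X Z) (Gamma_Y g X Z) (Gamma_Z g X Z).
  by rewrite qE Gamma_XZ.
(* Over the integers the permuted form and the twisted one differ by an even multiple of a monomial;
   e is the parameter in half of that difference. *)
pose e := match g with G_inv => iota c | G_x_div => iota a | G_add1_div => iota b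
          | _ => 0 end.
apply: (@eq_pchar2 _ _ _ (- (X * (X + Z) * Z * e * X * Z ^+ 2)
  - (iota u + iota u ^+ 2) * hform X Z ^+ 2)) => //.
rewrite gE /e /Gamma_X /Gamma_Y /Gamma_Z; clear gE e.
by case: g; rewrite /twist qE !(rmorphD, rmorphXn) /= /q3 /hform; ring.
Qed.

(** The substitution X |-> pX + qZ, Z |-> rX + sZ, W |-> W + u h expanded on cubic monomials, where
    u1 + u2 = h. The integer binomial coefficients are kept so that [linrow_par] holds by [ring]. *)
Definition linrow (g : Gamma) (u : k) (v : 'rV[K]_5) : 'rV[K]_5 :=
  let p := iota (Gamma_mx k g 0 0) in let q := iota (Gamma_mx k g 0 1) in
  let r := iota (Gamma_mx k g 1 0) in let s := iota (Gamma_mx k g 1 1) in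
  let u0 := v 0 (@inord 4 0) in let u1 := v 0 (@inord 4 1) in
  let u2 := v 0 (@inord 4 2) in let u3 := v 0 (@inord 4 3) in
  row5 (p ^+ 3 * u0 + 3%:R * p ^+ 2 * q * u1 + 3%:R * p * q ^+ 2 * u2 + q ^+ 3 * u3)
       (p ^+ 2 * r * u0 + (p ^+ 2 * s + 2%:R * p * q * r) * u1
        + (2%:R * p * q * s + q ^+ 2 * r) * u2 + q ^+ 2 * s * u3)
       (p * r ^+ 2 * u0 + (2%:R * p * r * s + q * r ^+ 2) * u1
        + (p * s ^+ 2 + 2%:R * q * r * s) * u2 + q * s ^+ 2 * u3)
       (r ^+ 3 * u0 + 3%:R * r ^+ 2 * s * u1 + 3%:R * r * s ^+ 2 * u2 + s ^+ 3 * u3)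
       (v 0 (@inord 4 4) + iota u * (u1 + u2)).

Lemma Gamma_mxE g X Z :
  [/\ Gamma_X g X Z = iota (Gamma_mx k g 0 0) * X + iota (Gamma_mx k g 0 1) * Z
    & Gamma_Z g X Z = iota (Gamma_mx k g 1 0) * X + iota (Gamma_mx k g 1 1) * Z].
Proof.
by case: g; rewrite !mxE /= !(rmorph0, rmorph1) /Gamma_X /Gamma_Z /=; split; ring.
Qed.

Lemma linrow_par g u X Z W : linrow g u (par X Z W)
  = par (Gamma_X g X Z) (Gamma_Z g X Z) (W + iota u * hform X Z).
Proof.
have [-> ->] := Gamma_mxE g X Z.
by rewrite /linrow /par !mxE !inordK //= /hform; congr row5; ring.
Qed.

Lemma linrowZ g u t v : linrow g u (t *: v) = t *: linrow g u v.
Proof. by rewrite /linrow !mxE row5Z; congr row5; ring. Qed.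

Definition pt_of (n : quad) := pvariety iota (curve_of n).

(* f is the map (x, y) |-> (g(x), y + u).                                      *)
Definition lin_map n n' (g : Gamma) (u : k) (f : pt_of n' -> pt_of n) := forall P,
  val (val (f P)) = <[linrow g u (pcoords (val P))]>%VS.

Lemma coords_of n (P : pt_of n) : exists2 t, t != 0 & exists X Z W,
   [/\ pcoords (val P) = t *: par X Z W,
       W ^+ 2 + hform X Z * W = qform_of n X Z
     & X = 1 /\ Z = 0 /\ W = 0 \/ Z = 1].
Proof. by case: n P => [[[a b] c] d] P; apply: coordsP. Qed.

Lemma lin_map_par n n' g u (f : pt_of n' -> pt_of n) P X Z W : lin_map g u f ->
  val (val P) = <[par X Z W]>%VS -> val (val (f P))
  = <[par (Gamma_X g X Z) (Gamma_Z g X Z) (W + iota u * hform X Z)]>%VS.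
Proof.
move=> fE PE; have : pcoords (val P) \in <[par X Z W]>%VS by rewrite -PE memv_pick.
case/vlineP=> t tE; have t0 : t != 0.
  by apply: contraNneq (pcoords_neq0 (val P)) => t0; rewrite tE t0 scale0r.
by rewrite fE tE linrowZ linrow_par vlineZ.
Qed.

Lemma lin_map_ex g u n : exists f : pt_of (twist g u n) -> pt_of n, lin_map g u f.
Proof.
suff h (P : pt_of (twist g u n)) : exists Q : pt_of n,
    val (val Q) = <[linrow g u (pcoords (val P))]>%VS.
  by exists (fun P => projT1 (cid (h P))) => P; case: cid.
have [t t0 [X [Z [W [-> e XZ]]]]] := coords_of P.
rewrite linrowZ linrow_par vlineZ //.
have nz : (Gamma_X g X Z != 0) || (Gamma_Z g X Z != 0).
  by apply: Gamma_neq0; case: XZ => [[-> _]|->]; rewrite oner_eq0 ?orbT.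
suff eq' : (W + iota u * hform X Z) ^+ 2 + hform (Gamma_X g X Z) (Gamma_Z g X Z)
    * (W + iota u * hform X Z) = qform_of n (Gamma_X g X Z) (Gamma_Z g X Z).
  by case: n P e eq' => [[[a b] c] d] P e eq'; apply: pt_par.
rewrite (qform_twist _ u) -e hform_Gamma.
apply: (@eq_pchar2 _ _ _ (iota u * hform X Z * W)) => //; ring.
Qed.

Lemma lin_map_regular n n' g u (f : pt_of n' -> pt_of n) : lin_map g u f ->
  regular_map f.
Proof.
move=> fE P.
pose p := Gamma_mx k g 0 0; pose q := Gamma_mx k g 0 1.
pose r := Gamma_mx k g 1 0; pose s := Gamma_mx k g 1 1.
pose lin (x : k * k * k * k * k) : {mpoly k[5]} :=
  let: (x0, x1, x2, x3, x4) := x in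
  x0 *: 'X_(@inord 4 0) + x1 *: 'X_(@inord 4 1) + x2 *: 'X_(@inord 4 2)
  + x3 *: 'X_(@inord 4 3) + x4 *: 'X_(@inord 4 4).
pose F (i : 'I_5) := lin (nth (0, 0, 0, 0, 0)
  [:: (p ^+ 3, 3%:R * p ^+ 2 * q, 3%:R * p * q ^+ 2, q ^+ 3, 0);
      (p ^+ 2 * r, p ^+ 2 * s + 2%:R * p * q * r, 2%:R * p * q * s + q ^+ 2 * r,
       q ^+ 2 * s, 0);
      (p * r ^+ 2, 2%:R * p * r * s + q * r ^+ 2, p * s ^+ 2 + 2%:R * q * r * s,
       q * s ^+ 2, 0);
      (r ^+ 3, 3%:R * r ^+ 2 * s, 3%:R * r * s ^+ 2, s ^+ 3, 0);
      (0, u, u, 0, 1)] i).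
have FE v : evalpv iota F v = linrow g u v.
  apply/rowP=> i; rewrite mxE /evalp /F /lin.
  by case: i => [[|[|[|[|[|i]]]]] lt_i] //=; rewrite !rmorphD /= !mmapZ !mmapX !mmap1U
    !mxE /= !(rmorph0, rmorph1, rmorphD, rmorphM, rmorphXn, rmorph_nat) /= -/p -/q -/r -/s; ring.
exists 1%N, F; split=> [i||Q _]; last by rewrite FE.
  rewrite /F /lin; case: (nth _ _ _) => [[[[x0 x1] x2] x3] x4].
  by rewrite !rpredD // dhomogZ // dhomogX; apply/eqP; exact: mdeg1.
rewrite FE; apply: contraTneq isT => e; have := fE P.
rewrite e; case: (val (f P)) => L /= /eqP dL LE.
by move: dL; rewrite LE dim_vline eqxx.
Qed.

Lemma lin_map_uniq n n' g u (f f' : pt_of n' -> pt_of n) : lin_map g u f ->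
  lin_map g u f' -> f =1 f'.
Proof.
by move=> fE fE' P; apply: val_inj; apply: val_inj; rewrite fE fE'.
Qed.

Lemma Gamma_mul_XZ g h X Z :
  Gamma_X g (Gamma_X h X Z) (Gamma_Z h X Z) = Gamma_X (Gamma_mul g h) X Z /\
  Gamma_Z g (Gamma_X h X Z) (Gamma_Z h X Z) = Gamma_Z (Gamma_mul g h) X Z.
Proof.
rewrite [Gamma_X g _ _]/Gamma_X [Gamma_Z g _ _]/Gamma_Z Gamma_XZ.
by case: g; case: h.
Qed.

Lemma lin_map_comp n1 n2 n3 g h u v (f : pt_of n2 -> pt_of n1)
    (f' : pt_of n3 -> pt_of n2) : lin_map g u f -> lin_map h v f' ->
  lin_map (Gamma_mul g h) (u + v) (f \o f').
Proof.
move=> fE fE' P; have [t t0 [X [Z [W [PE _ _]]]]] := coords_of P.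
have PE' : val (val P) = <[par X Z W]>%VS by rewrite -pcoordsK PE vlineZ.
rewrite PE linrowZ vlineZ // linrow_par /=.
rewrite (lin_map_par fE (lin_map_par fE' PE')) hform_Gamma.
have [-> ->] := Gamma_mul_XZ g h X Z.
by rewrite rmorphD /=; congr (<[par _ _ _]>%VS); ring.
Qed.

Lemma lin_map_id n (f : pt_of n -> pt_of n) : lin_map G_x 0 f -> f =1 id.
Proof.
move=> fE P; have [t t0 [X [Z [W [PE _ _]]]]] := coords_of P.
have PE' : val (val P) = <[par X Z W]>%VS by rewrite -pcoordsK PE vlineZ.
apply: val_inj; apply: val_inj.
by rewrite (lin_map_par fE PE') PE' rmorph0 mul0r addr0.
Qed.

Definition Gamma_inv g :=
  match g with G_1_div => G_add1_div | G_add1_div => G_1_div | _ => g end.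

Lemma Gamma_mulV g : Gamma_mul g (Gamma_inv g) = G_x.
Proof. by case: g. Qed.

Lemma Gamma_mulVg g : Gamma_mul (Gamma_inv g) g = G_x.
Proof. by case: g. Qed.

Lemma twistK g u n : twist (Gamma_inv g) u (twist g u n) = n.
Proof.
case: n => [[[a b] c] d].
(* The second twist adds to d the same amount as the first. *)
pose e := (twist g u (a, b, c, d)).2 - d.
have eq_d x : x - d = e *+ 2 -> x = d by apply: eq_pchar2.
by move: eq_d; rewrite /e; clear e; case: g => /= eq_d; congr (_, _, _, _); apply: eq_d; ring.
Qed.

Lemma lin_map_iso g u n : exists (f : pt_of (twist g u n) -> pt_of n)
    (f' : pt_of n -> pt_of (twist g u n)),
  [/\ cancel f f', cancel f' f, lin_map g u f & lin_map (Gamma_inv g) u f'].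
Proof.
have [f fE] := lin_map_ex g u n.
have := lin_map_ex (Gamma_inv g) u (twist g u n); rewrite twistK => -[f' fE'].
have uu : u + u = 0 by apply: addrr_pchar2.
exists f, f'; split=> // P.
  have := lin_map_comp fE' fE; rewrite Gamma_mulVg uu => /lin_map_id; exact.
have := lin_map_comp fE fE'; rewrite Gamma_mulV uu => /lin_map_id; exact.
Qed.

End LinearMaps.

(** * The x-coordinate of an isomorphism *)

Section Fibres.
Variables (k : fieldType) (char2 : 2%N \in [pchar k]).
Variables (K : closedFieldType) (iota : {rmorphism k -> K}).

Definition froot (ps : seq K) : {poly K} := \prod_(p <- ps) ('X - p%:P).

Lemma froot_neq0 ps : froot ps != 0.
Proof. exact/monic_neq0/monic_prod_XsubC. Qed.

(** Reversal of coefficients carries polynomials between the charts at 0 and at oo. *)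
Lemma reverse_poly (p : {poly K}) N : (size p <= N.+1)%N -> exists2 q : {poly K},
  (size q <= N.+1)%N & forall x, x != 0 -> q.[x] = x ^+ N * p.[x^-1].
Proof.
move=> sp; exists (\poly_(i < N.+1) p`_(N - i)); first exact: size_poly.
move=> x x0; rewrite horner_poly (horner_coef_wide _ sp) mulr_sumr.
rewrite (reindex_inj rev_ord_inj) /=; apply: eq_bigr => i _.
have iN : (i <= N)%N by rewrite -ltnS ltn_ord.
have -> : x ^+ N = x ^+ (N - i) * x ^+ i by rewrite -exprD subnK.
rewrite subSS subKn // exprVn; field.
by rewrite expf_neq0.
Qed.

Lemma lin_map_inv a b c d (s : pt_of iota (twist G_inv 0 (a, b, c, d)) ->
    pvariety iota (curve a b c d)) (P : pvariety iota _) :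
  @lin_map _ _ iota (a, b, c, d) _ G_inv 0 s -> finP (s P) -> xP (s P) != 0 ->
  [/\ finP P, xP P = (xP (s P))^-1 & wP P = wP (s P) / xP (s P) ^+ 3].
Proof.
move=> sE.
have [Pf|Pi] := boolP (finP P).
  have PE := finP_line char2 Pf; have := lin_map_par sE PE.
  rewrite /Gamma_X /Gamma_Z /= => /(xP_line)[-> -> ->].
  rewrite /par !mxE !inordK //= rmorph0 mul0r addr0 expf_eq0 /= mul1r => x0 _.
  by split=> //; field; rewrite x0 oner_neq0.
have PE := infP_line char2 Pi; have := lin_map_par sE PE.
rewrite /Gamma_X /Gamma_Z /= => /(xP_line)[_ -> _].
by rewrite /par !mxE !inordK //= mul0r mul0r eqxx.
Qed.

(** The poles of 1/(x o f - t) lie over ps and are cancelled by [froot ps] through [regat_pole], t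
    not being a branch value. A function without poles at finite points lies in the coordinate
    ring. *)
Lemma fibre_regular a b c d a' b' c' d' (f : pvariety iota (curve a b c d) ->
    pvariety iota (curve a' b' c' d')) g t (ps : seq K) :
  a != 0 -> a' != 0 -> cancel f g -> cancel g f -> regular_map f -> regular_map g ->
  hform t 1 != 0 ->
  (forall P, finP P -> finP (f P) -> xP (f P) = t -> xP P \in ps) ->
  exists A B, cof (fun Q => (froot ps).[xP Q] / (xP (f Q) - t) = ev A B Q).
Proof.
move=> a0 a0' fK gK rf rg t0 ft; apply: regular_everywhere => // Q Qf.
have rp (p : {poly K}) : regat (fun Q => p.[xP Q]) Q p.[xP Q].
  rewrite -evp; apply: regat_ext (regat_ev Q p 0).
  by apply: cofT => Q'; rewrite evp.
have [/andP[fQf /eqP xt]|nt] := boolP (finP (f Q) && (xP (f Q) == t)); last first.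
  have [|v rv] := @regat_fibre _ char2 _ iota _ _ _ _ _ _ _ _ a0 f g fK rf t Q Qf.
    by move=> fQf; move: nt; rewrite fQf.
  by eexists; apply: (regatM char2 Qf (rp _) rv).
have := regat_pole char2 a0 a0' fK gK rf rg Qf fQf.
rewrite xt => /(_ t0)[v rv].
have Qps := ft Q Qf fQf xt; eexists.
apply: regat_ext (regatM char2 Qf (rp (froot (rem (xP Q) ps))) rv).
apply: cofT => Q'; rewrite /froot (big_rem _ Qps) /= hornerM hornerXsubC; ring.
Qed.

Section Iso.
Variables (a b c d a' b' c' d' : k).
Local Notation C1 := (pvariety iota (curve a b c d)).
Local Notation C1' := (pvariety iota (curve b a c (d + c + (0 + 0 ^+ 2)))).
Local Notation C2 := (pvariety iota (curve a' b' c' d')).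
Variables (a0 : a != 0) (b0 : b != 0) (a0' : a' != 0).
Variables (f : C1 -> C2) (g : C2 -> C1).
Hypotheses (fK : cancel f g) (gK : cancel g f).
Hypotheses (rf : regular_map f) (rg : regular_map g).

(* Comparing the charts at 0 and at oo bounds the degrees of the two           *)
(* polynomials given by fibre_regular.                                         *)
Lemma fibre_poly t (ps : seq K) : hform t 1 != 0 ->
  (forall P, finP (f P) -> xP (f P) = t -> finP P /\ xP P \in ps) ->
  0 \notin ps -> (size ps <= 2)%N ->
  exists2 A : {poly K}, (size A <= (size ps).+1)%N
    & cof (fun Q => (froot ps).[xP Q] = (xP (f Q) - t) * A.[xP Q]).
Proof.
move=> t0 ft ps0 sps.
have [A [B AB]] : exists A B, cof (fun Q => (froot ps).[xP Q] / (xP (f Q) - t) = ev A B Q).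
  by apply: (fibre_regular a0 a0' fK gK rf rg t0) => P _ fPf /(ft _ fPf)[].
have [s [s' [sK s'K sE sE']]] : exists (s : C1' -> C1) (s' : C1 -> C1'),
    [/\ cancel s s', cancel s' s,
        @lin_map _ _ iota (a, b, c, d) (twist G_inv 0 (a, b, c, d)) G_inv 0 s
      & @lin_map _ _ iota (twist G_inv 0 (a, b, c, d)) (a, b, c, d) G_inv 0 s'].
  exact: (lin_map_iso char2 iota G_inv 0 (a, b, c, d)).
have rs := lin_map_regular sE; have rs' := lin_map_regular sE'.
have [A1 [B1 AB1]] : exists A B, cof (fun Q => (froot ([seq p^-1 | p <- ps])).[xP Q]
    / (xP (f (s Q)) - t) = ev A B Q).
  have rfs := regular_comp rf rs; have rfs' := regular_comp rs' rg.
  apply: (fibre_regular b0 a0' (can_comp fK sK) (can_comp s'K gK) rfs rfs' t0).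
  move=> P Pf fPf /(ft _ fPf)[sPf xps].
  have x0 : xP (s P) != 0 by apply: contraNneq ps0 => <-.
  have [_ -> _] := lin_map_inv sE sPf x0.
  by apply: map_f.
have ps_neq0 p : p \in ps -> p != 0 by apply: contraTneq => ->.
(* The constant relating the fibre polynomials in x and in 1/x: 1/x - 1/p = (-1/p) (x - p)/x. *)
pose kap := \prod_(p <- ps) (- p^-1).
have kap0 : kap != 0.
  rewrite prodf_seq_neq0; by apply/allP => p pps; rewrite /= oppr_eq0 invr_eq0 ps_neq0.
have frootV x : x != 0 -> x ^+ size ps * (froot ([seq p^-1 | p <- ps])).[x^-1]
    = kap * (froot ps).[x].
  move=> x0; rewrite /froot /kap; elim: ps ps_neq0 {ft ps0 sps AB AB1 kap kap0} => [|p ps IH] p0.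
    by rewrite /= !big_nil -polyC1 !hornerC expr0 !mul1r.
  rewrite /= !big_cons !hornerM exprS mulrACA [RHS]mulrACA; congr (_ * _).
    by rewrite !hornerXsubC; field; rewrite x0 p0 ?mem_head.
  by apply: IH => q qps; apply: p0; rewrite inE qps orbT.
(* The exponent N clears the powers of 1/x; it exceeds N' by 3 because w becomes w/x^3 in the other
   chart. *)
pose N' := (size A1 + size B1)%N; have [N NE] : exists N, N = N'.+3 by exists N'.+3.
have sA1 : (size A1 <= N.+1)%N by rewrite NE /N'; lia.
have sB1 : (size B1 <= N'.+1)%N by rewrite /N'; lia.
have [q1 sq1 q1E] := reverse_poly sA1; have [q2 sq2 q2E] := reverse_poly sB1.
have [|eA eB] := @ev_cof0 _ char2 _ iota a b c d (kap *: ('X^N * A) - 'X^(size ps) * q1)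
    (kap *: ('X^N * B) - 'X^(size ps) * q2) a0.
  apply: cofW (cofI AB (cofI (cof_map s'K AB1)
    (cofI (cof_fin char2 iota a b c d) (cof_x char2 iota a b c d 0)))).
  move=> Q [e [e1 [Qf /(_ Qf)/eqP x0]]].
  have sf : finP (s (s' Q)) by rewrite s'K.
  have sx : xP (s (s' Q)) != 0 by rewrite s'K.
  have [_ ex ew] := lin_map_inv sE sf sx; rewrite s'K in e1 ex ew.
  have := frootV _ x0.
  move: e e1; rewrite -evB /ev !(hornerD, hornerZ, hornerM, hornerXn) q1E // q2E // ex ew.
  move: (xP Q) (wP Q) x0 => x w x0.
  set F := (froot ps).[x]; set F1 := (froot _).[_]; set T := xP (f Q) - t.
  move=> e e1 e2.
  have -> : kap * (x ^+ N * A.[x]) + kap * (x ^+ N * B.[x]) * w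
    = kap * x ^+ N * (A.[x] + B.[x] * w) by ring.
  rewrite -e; have -> : kap * x ^+ N * (F / T) = x ^+ N * (kap * F) / T by ring.
  rewrite -e2; have -> : x ^+ N * (x ^+ size ps * F1) / T = x ^+ N * x ^+ size ps * (F1 / T).
    by ring.
  rewrite e1 NE !exprS; field.
  by rewrite x0.
have sN (p q : {poly K}) : kap *: ('X^N * p) - 'X^(size ps) * q = 0 ->
    (size p + N <= size ps + size q)%N \/ p = 0.
  move/eqP; rewrite subr_eq0 => /eqP e; have [->|p0] := eqVneq p 0; [by right|left].
  have := congr1 (fun r : {poly K} => size r) e.
  rewrite size_scale // ![in 'X^_ * _]mulrC size_mulXn //.
  have [->|q0] := eqVneq q 0; first by
    rewrite mul0r size_poly0 => /eqP; rewrite addn_eq0 size_poly_eq0 (negbTE p0) andbF.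
  by rewrite size_mulXn // [(size p + N)%N]addnC => ->.
(* The w-parts give size B + N <= size ps + N' + 1 <= N, as ps has at most two entries. *)
have B0 : B = 0.
  have [h|//] := sN _ _ eB; apply/eqP; rewrite -size_poly_eq0 -leqn0 -(leq_add2r N).
  rewrite (leq_trans h) // NE add0n -(addn3 N') addnC.
  by rewrite (leq_trans (leq_add sq2 sps)) // addSnnS.
exists A.
  have [h|->] := sN _ _ eA; last by rewrite size_poly0.
  by rewrite -(leq_add2r N) addSnnS (leq_trans h) // leq_add2l.
apply: cofW (cofI AB (cof_x_map char2 fK t)) => Q [e xt].
have xt' : xP (f Q) - t != 0 by rewrite subr_eq0.
by move: e; rewrite B0 evp => <-; rewrite mulrC divfK.
Qed.

Lemma generic_fibre (s : seq C1) : exists t (M : C2), [/\ hform t 1 != 0, finP M, xP M = t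
  & forall P, finP (f P) -> xP (f P) = t -> [/\ finP P, xP P != 0 & P \notin s]].
Proof.
have [s1 s1P] := cofI (cof_fin char2 iota a b c d) (cof_x char2 iota a b c d 0).
(* Besides the branch values 0 and -1 = 1, avoid the images of s, of the point at infinity and of
   the points with x = 0. *)
have [t] := exists_notin ([:: 0; -1] ++ map (fun P : C1 => xP (f P)) (s ++ s1)).
rewrite mem_cat negb_or !inE negb_or => /andP[/andP[t0 t1] tn].
have [M Mf Mt] := pt_over char2 iota a' b' c' d' t.
exists t, M; split=> //.
  by rewrite /hform mulr1 mulf_neq0 // -(opprK 1) subr_eq0.
move=> P fPf Pt; have Pn : P \notin s ++ s1.
  by apply: contra tn => Ps; apply/mapP; exists P.
move: Pn; rewrite mem_cat negb_or => /andP[Ps /s1P[Pf /(_ Pf)/eqP P0]].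
by split.
Qed.

Local Notation hyp1 := (hyp_fun char2 (iota := iota) (a := a) (b := b) (c := c) (d := d)).
Local Notation hyp2 := (hyp_fun char2 (iota := iota) (a := a') (b := b') (c := c') (d := d')).

Lemma cof_hyp (P : C1 -> Prop) : cof P -> cof (fun Q => P (hyp1 Q)).
Proof. by apply: cof_map; apply: (hyp_funK char2). Qed.

(** With ps the x-coordinates of the fibre over t, [fibre_poly] expresses x o f through x alone. So
    f takes conjugate points to points with equal x, which differ by injectivity unless the point is
    a branch point. *)
Lemma commute_hyp : cof (fun Q => f (hyp1 Q) = hyp2 (f Q)).
Proof.
have [t [M [t0 Mf Mt ft]]] := generic_fibre [::].
pose ps := [:: xP (g M); xP (g (hyp2 M))].
have psP P : finP (f P) -> xP (f P) = t -> finP P /\ xP P \in ps.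
  move=> fPf Pt; have [Pf _ _] := ft P fPf Pt; split=> //.
  have := same_x char2 Mf fPf; rewrite Mt Pt => /(_ erefl); rewrite !inE.
  by case=> <-; rewrite fK eqxx ?orbT.
have ps0 : 0 \notin ps.
  have [hMf hMt _] := hyp_fin char2 Mf.
  have [] := ft (g M); rewrite ?gK // => _ p0 _.
  have [] := ft (g (hyp2 M)); rewrite ?gK // ?hMt // => _ p0' _.
  by rewrite !inE negb_or eq_sym p0 eq_sym.
have [A sA AE] := fibre_poly t0 psP ps0 isT.
have cfr := cof_poly char2 iota a b c d (froot_neq0 ps).
have ch := cof_poly char2 iota a b c d (p := hpoly K).
apply: cofW (cofI AE (cofI (cof_hyp AE) (cofI cfr (cofI (ch _)
  (cofI (cof_fin char2 iota a b c d) (cofI (cof_fin_map char2 fK)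
  (cof_hyp (cof_fin_map char2 fK)))))))); last first.
  by rewrite -size_poly_gt0 size_hpoly.
move=> Q [e [e' [/[swap] -[h0 [Qf [fQf fhQf]]] /(_ Qf) fr0]]].
have [hQf hx hw] := hyp_fin char2 Qf.
have A0 : A.[xP Q] != 0.
  by apply: contraNneq fr0 => A0; rewrite e A0 mulr0.
have ex : xP (f Q) = xP (f (hyp1 Q)).
  by apply: (addIr (- t)); apply: (mulIf A0); rewrite -e -{1}hx e' hx.
have [/(can_inj fK) hQ|//] := same_x char2 fQf fhQf ex.
move: (h0 Qf) hw; rewrite hQ horner_hpoly => h1 /eqP.
by rewrite -subr_eq0 opprD addrA subrr sub0r oppr_eq0 (negbTE h1).
Qed.

(** Choosing t so that the fibre avoids the exceptions to [commute_hyp], its two points are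
    conjugate and share one x-coordinate p. Then [fibre_poly] applies to [:: p] and gives x - p = (x
    o f - t) A(x) with A of degree at most one. *)
Lemma xP_moebius : exists al be ga de, al * de - be * ga != 0 /\
  cof (fun Q => xP (f Q) * (ga * xP Q + de) = al * xP Q + be).
Proof.
have [s sP] := commute_hyp.
have [t [M [t0 Mf Mt ft]]] := generic_fibre s.
pose p := xP (g M).
have [Pf P0 Ps] : [/\ finP (g M), xP (g M) != 0 & g M \notin s] by apply: ft; rewrite gK.
have psP P : finP (f P) -> xP (f P) = t -> finP P /\ xP P \in [:: p].
  move=> fPf Pt; have [Pf' _ _] := ft P fPf Pt; split=> //; rewrite inE.
  have := same_x char2 Mf fPf; rewrite Mt Pt => /(_ erefl); case=> fP.
    by rewrite /p -fP fK.
  have : f P = f (hyp1 (g M)) by rewrite sP // gK.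
  by move/(can_inj fK) ->; have [_ -> _] := hyp_fin char2 Pf.
have ps0 : 0 \notin [:: p] by rewrite inE eq_sym.
have [A sA AE] := fibre_poly t0 psP ps0 isT.
have AE' x : A.[x] = A`_1 * x + A`_0.
  by rewrite (horner_coef_wide _ sA) !big_ord_recl big_ord0 /= addr0 expr0 expr1 mulr1 addrC.
have fr x : (froot [:: p]).[x] = x - p by rewrite /froot big_seq1 hornerXsubC.
exists (t * A`_1 + 1), (t * A`_0 - p), A`_1, A`_0; split.
  have -> : (t * A`_1 + 1) * A`_0 - (t * A`_0 - p) * A`_1 = A.[p] by rewrite AE'; ring.
  apply/eqP => Ap; have eA x : A.[x] = A`_1 * (x - p).
    by transitivity (A.[x] - A.[p]); [rewrite Ap subr0|rewrite !AE'; ring].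
  have [Q _ [e [np nt]]] := cof_ex char2 (cofI AE (cofI (cof_x_map char2 fK (t + (A`_1)^-1))
    (cofI (cof_x char2 iota a b c d p) (cof_fin char2 iota a b c d)))).
  case: nt => /[swap] Qf /(_ Qf)/eqP; rewrite -subr_eq0 => xp.
  move: e; rewrite fr eA mulrCA -{1}[_ - p]mul1r mulrA => /(mulIf xp) e.
  have A1 : A`_1 != 0.
    by apply/eqP => A10; move: e; rewrite A10 mul0r => /eqP; rewrite oner_eq0.
  move/eqP: np; apply; apply: (addIr (- t)); rewrite addrAC subrr add0r.
  by apply: (mulfI A1); rewrite mulfV.
apply: cofW AE => Q; rewrite fr AE' => e.
have -> : xP (f Q) * (A`_1 * xP Q + A`_0)
  = (xP (f Q) - t) * (A`_1 * xP Q + A`_0) + t * (A`_1 * xP Q + A`_0) by ring.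
by rewrite -e; ring.
Qed.

End Iso.
End Fibres.

(** * The y-coordinate of an isomorphism *)

Section InvariantFunctions.
Variables (k : fieldType) (char2 : 2%N \in [pchar k]).
Variables (K : closedFieldType) (iota : {rmorphism k -> K}).

Lemma simple_root (R : idomainType) (p : {poly R}) e : (p.[e] = 0 -> p^`().[e] != 0) ->
  exists i p1, [/\ (i <= 1)%N, p = p1 * ('X - e%:P) ^+ i & p1.[e] != 0].
Proof.
have [pe /(_ pe) dp|pe _] := eqVneq p.[e] 0; last first.
  by exists 0%N, p; rewrite expr0 mulr1.
have /factor_theorem[p1 pE] : root p e by apply/rootP.
exists 1%N, p1; split=> //; move: dp; rewrite pE derivM derivXsubC.
by rewrite hornerD !hornerM hornerXsubC subrr mulr0 add0r -polyC1 hornerC mulr1.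
Qed.

(* With denominators cleared: a reduced A / E has no pole at e if              *)
(* (A / E)^2 + A / E = P / H + r / h, where H and h have at most simple roots. *)
Lemma square_pole (R : idomainType) (A E H h P r : {poly R}) e :
  (H.[e] = 0 -> H^`().[e] != 0) -> (h.[e] = 0 -> h^`().[e] != 0) ->
  (A ^+ 2 + A * E) * (H * h) = E ^+ 2 * (P * h + r * H) ->
  E.[e] = 0 -> A.[e] = 0.
Proof.
move=> /simple_root[i [H1 [i1 -> H1e]]] /simple_root[j [h1 [j1 -> h1e]]] eq Ee.
have /factor_theorem[E1 EE] : root E e by apply/rootP.
set X := 'X - e%:P in EE eq; have X0 : X != 0 by rewrite polyXsubC_eq0.
have Xe : X.[e] = 0 by rewrite hornerXsubC subrr.
suff [S eqS] : exists S, (A ^+ 2 + A * E) * (H1 * h1) = X * S.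
  have := congr1 (horner^~ e) eqS; rewrite !hornerM hornerD !hornerM Ee Xe !mul0r mulr0 addr0.
  by move/eqP; rewrite !mulf_eq0 (negbTE H1e) (negbTE h1e) !orbF orbb => /eqP.
have XX n : X ^+ n != 0 by rewrite expf_neq0.
case: i i1 eq => [|[|//]] _; case: j j1 => [|[|//]] _; rewrite ?expr0 ?expr1 => eq.
- exists (E1 ^+ 2 * X * (P * h1 + r * H1)).
  by move: eq; rewrite !mulr1 => ->; rewrite EE; ring.
- exists (E1 ^+ 2 * (P * (h1 * X) + r * H1)); apply: (mulIf X0).
  transitivity ((A ^+ 2 + A * E) * (H1 * 1 * (h1 * X))); first by ring.
  by rewrite eq EE; ring.
- exists (E1 ^+ 2 * (P * h1 + r * (H1 * X))); apply: (mulIf X0).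
  transitivity ((A ^+ 2 + A * E) * (H1 * X * (h1 * 1))); first by ring.
  by rewrite eq EE; ring.
exists (E1 ^+ 2 * (P * h1 + r * H1)); apply: (mulIf (XX 2%N)).
transitivity ((A ^+ 2 + A * E) * (H1 * X * (h1 * X))); first by ring.
by rewrite eq EE; ring.
Qed.

Lemma poly_ext_notin (s : seq K) (p q : {poly K}) :
  (forall x, x \notin s -> p.[x] = q.[x]) -> p = q.
Proof.
move=> pq; apply/eqP; rewrite -subr_eq0; apply: contraT => /roots_list[s' sP].
have [x] := exists_notin (s ++ s'); rewrite mem_cat negb_or => /andP[xs xs'].
by case/negP: xs'; apply: sP; rewrite rootE hornerD hornerN pq // subrr.
Qed.

Lemma poly_ext (p q : {poly K}) : (forall x, p.[x] = q.[x]) -> p = q.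
Proof. by move=> pq; apply: (@poly_ext_notin [::]) => x _. Qed.

Lemma cof_notin a b c d (P : K -> Prop) :
  cof (fun Q : pvariety iota (curve a b c d) => P (xP Q)) ->
  exists s : seq K, forall x, x \notin s -> P x.
Proof.
case=> s sP; exists (map (@xP _ _ iota a b c d) s) => x xs.
have [Q Qf Qx] := pt_over char2 iota a b c d x; rewrite -Qx; apply: sP.
by apply: contra xs => Qs; apply/mapP; exists Q.
Qed.

(** The homogenised product of h and a x + b/x + c/(x+1) + d, so the curve reads y^2 + y = rform / h
    ([yP_eqn]). *)
Definition rform (a b c d X Z : K) :=
  a * X ^+ 2 * (X + Z) + b * Z ^+ 2 * (X + Z) + c * X * Z ^+ 2 + d * hform X Z.

Lemma qform_rform a b c d X Z :
  qform iota a b c d X Z = hform X Z * rform (iota a) (iota b) (iota c) (iota d) X Z.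
Proof. by rewrite /qform /rform /hform; ring. Qed.

(** Multiplying phi by the norm of its denominator gives A' + B' w; invariance under w |-> w + h
    forces B' h = 0. *)
Lemma invariant_rational a b c d (phi : pvariety iota (curve a b c d) -> K) Q0 v0 :
  a != 0 -> regat phi Q0 v0 -> cof (fun Q => phi (hyp_fun char2 Q) = phi Q) ->
  exists A E : {poly K}, E != 0 /\ cof (fun Q => phi Q * E.[xP Q] = A.[xP Q]).
Proof.
move=> a0 [A [B [D [E [d0 _ nd]]]]] ph.
have [A' [B' AB']] := evMx char2 iota a b c d A B (D + E * hpoly K) E.
have cf := cof_fin char2 iota a b c d.
have pN : cof (fun Q => phi Q * (norm iota a b c d D E).[xP Q] = ev A' B' Q).
  apply: cofW (cofI cf nd) => Q [Qf e].
  by rewrite -AB' // -e -mulrA ev_norm.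
have pN' := cof_map (hyp_funK char2 (iota := iota) (a := a) (b := b) (c := c) (d := d)) pN.
have [|hB _] := @ev_cof0 _ char2 _ iota a b c d (B' * hpoly K) 0 a0.
  apply: cofW (cofI cf (cofI pN (cofI pN' ph))) => Q [Qf [e [e' pe]]].
  have [_ hx _] := hyp_fin char2 Qf; move: e'.
  rewrite pe hx e ev_hyp // => /esym/eqP; rewrite -subr_eq0 evB => /eqP.
  by rewrite subrr addrAC subrr add0r.
have B0 : B' = 0.
  by move/eqP: hB; rewrite mulf_eq0 -[hpoly K == 0]size_poly_eq0 size_hpoly orbF => /eqP.
exists A', (norm iota a b c d D E); split.
  by apply: contra_notN d0 => /eqP/(norm_eq0 char2 a0)[-> ->]; rewrite evp horner0.
by apply: cofW pN => Q ->; rewrite B0 evp.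
Qed.

End InvariantFunctions.

(** * The branch form h pulled back along a Moebius map *)

Section Cubic.
Variables (k : fieldType) (char2 : 2%N \in [pchar k]).
Variables (K : closedFieldType) (iota : {rmorphism k -> K}).
Let char2K : 2%N \in [pchar K] := rmorph_pchar iota char2.

Lemma simple_hpoly e : (hpoly K).[e] = 0 -> (hpoly K)^`().[e] != 0.
Proof.
move=> _; rewrite /hpoly derivM derivD derivX -polyC1 derivC !hornerR.
have -> : 1 * (e + 1) + e * (1 + 0) = 1 + 2%:R * e by ring.
by rewrite (pcharf0 char2K) mul0r addr0 oner_neq0.
Qed.

Variables (al be ga de : K) (det : al * de - be * ga != 0).

Definition lpoly (x y : K) : {poly K} := x *: 'X + y%:P.
Local Notation L := (lpoly al be).
Local Notation M := (lpoly ga de).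
(** Its roots are the finite preimages of 0, oo and 1 under (al x + be)/(ga x + de). *)
Definition cubic : {poly K} := L * M * (L + M).

Lemma horner_lpoly x y z : (lpoly x y).[z] = x * z + y.
Proof. by rewrite !hornerR. Qed.

Lemma horner_cubic z : cubic.[z] = hform (al * z + be) (ga * z + de).
Proof. by rewrite /cubic /lpoly !hornerR. Qed.

Lemma size_lpoly x y : (size (lpoly x y) <= 2)%N.
Proof.
apply: leq_trans (size_polyD _ _) _; rewrite geq_max.
rewrite (leq_trans (size_scale_leq _ _)) ?size_polyX //=.
by rewrite (leq_trans (size_polyC_leq1 _)).
Qed.

(** The forms L, M and L + M are pairwise independent because the determinant is nonzero. *)
Lemma simple_cubic e : cubic.[e] = 0 -> cubic^`().[e] != 0.
Proof.
set l := al * e + be; set m := ga * e + de.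
have -> : cubic^`().[e] = (al * m + l * ga) * (l + m) + l * m * (al + ga).
  rewrite /cubic /lpoly !(derivM, derivD, derivZ, derivX, derivC).
  by rewrite -polyC1 !(hornerR, horner0) /l /m; ring.
rewrite horner_cubic -/l -/m /hform.
have lm : al * m - ga * l = al * de - be * ga by rewrite /l /m; ring.
move: det; rewrite -lm => {}lm /eqP; rewrite !mulf_eq0 -orbA => /or3P[] /eqP e0.
- move: lm; rewrite e0 mulr0 subr0 mulf_eq0 negb_or => /andP[al0 m0].
  by rewrite !(mul0r, addr0, add0r) !mulf_neq0.
- move: lm; rewrite e0 mulr0 sub0r oppr_eq0 mulf_eq0 negb_or => /andP[ga0 l0].
  by rewrite !(mul0r, mulr0, addr0, add0r) !mulf_neq0.
have ml : m = l by apply/eqP; rewrite -subr_eq0 (subK2 char2 iota) addrC e0.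
rewrite e0 mulr0 add0r; move: lm; rewrite ml -mulrBl mulf_eq0 negb_or => /andP[ag l0].
by rewrite -(subK2 char2 iota) !mulf_neq0.
Qed.

Lemma cubic_coef : cubic`_3 = al * ga * (al + ga)
  /\ cubic`_2 = al * ga * (be + de) + (al * de + be * ga) * (al + ga).
Proof.
have coefE : cubic = (al * ga * (al + ga)) *: 'X^3
    + (al * ga * (be + de) + (al * de + be * ga) * (al + ga)) *: 'X^2
    + ((al * de + be * ga) * (be + de) + be * de * (al + ga)) *: 'X
    + (be * de * (be + de))%:P.
  by apply: poly_ext => x; rewrite horner_cubic !hornerR /hform; ring.
by rewrite coefE !coefD !coefZ !coefXn !coefX !coefC /=; split; ring.
Qed.

Lemma coef_size (p : {poly K}) i : p`_i != 0 -> (i < size p)%N.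
Proof. by apply: contraR; rewrite -leqNgt => /(nth_default 0) ->. Qed.

(** At most one of the three preimages is at infinity. *)
Lemma size_cubic : (2 < size cubic)%N.
Proof.
have [c3 c2] := cubic_coef.
have [h3|/coef_size/ltnW//] := eqVneq cubic`_3 0; apply: coef_size.
have det' : al * de + be * ga != 0 by rewrite -(subK2 char2 iota).
rewrite c2; move/eqP: h3; rewrite c3 !mulf_eq0 -orbA => /or3P[] /eqP e0.
- move: det'; rewrite e0 !mul0r !add0r => h.
  by rewrite mulf_neq0 //; apply: contraNneq h => ->; rewrite mulr0.
- move: det'; rewrite e0 !mulr0 !mul0r !addr0 add0r => h.
  by rewrite mulf_neq0 //; apply: contraNneq h => ->; rewrite mul0r.
have ga_al : ga = al by apply/eqP; rewrite -subr_eq0 (subK2 char2 iota) addrC e0.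
move: det'; rewrite e0 ga_al !mulr0 addr0 mulrC -mulrDl mulf_eq0 negb_or => /andP[h h'].
by rewrite !mulf_neq0 // addrC.
Qed.

End Cubic.

(** The three equations say that 0, oo and 1 are each sent into {0, 1, oo}. Of the 27 combinations,
    those compatible with a nonzero determinant are the six elements of Gamma up to a scalar lam. *)
Lemma moebius_Gamma (R : closedFieldType) (al be ga de : R) : 2%N \in [pchar R] ->
  al * de - be * ga != 0 ->
  be * de * (be + de) = 0 -> al * ga * (al + ga) = 0 ->
  (al + be) * (ga + de) * (al + be + (ga + de)) = 0 ->
  exists g lam, lam != 0 /\ forall x, al * x + be = lam * Gamma_X g x 1
                                   /\ ga * x + de = lam * Gamma_Z g x 1.
Proof.
move=> char2 /eqP dt.
have eq2 (x y : R) : x + y = 0 -> y = x.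
  by move=> e; apply/eqP; rewrite -subr_eq0 (oppr_pchar2 char2) addrC e.
have kk (x : R) : x + x = 0 by apply: addrr_pchar2.
have or3 (x y z : R) : x * y * z = 0 -> [\/ x = 0, y = 0 | z = 0].
  move/eqP; rewrite !mulf_eq0 -orbA => /or3P[]/eqP h; [exact: Or31|exact: Or32|exact: Or33].
have res g lam : (lam = 0 -> al * de - be * ga = 0) ->
    (forall x, al * x + be = lam * Gamma_X g x 1
            /\ ga * x + de = lam * Gamma_Z g x 1) ->
    exists g lam, lam != 0 /\ forall x, al * x + be = lam * Gamma_X g x 1
                                    /\ ga * x + de = lam * Gamma_Z g x 1.
  by move=> h ?; exists g, lam; split=> //; apply/eqP => /h.
move=> /or3[] e0 /or3[] ei /or3[] e1; try (move/eq2: e0 => e0); try (move/eq2: ei => ei);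
  subst; rewrite ?(addr0, add0r, kk, addrK_pchar2 char2, addKr_pchar2 char2) in e1;
  try (move/eq2: e1 => e1); subst;
  try (by exfalso; apply: dt; ring).
- by apply: (res G_x al) => [->|x]; rewrite ?/Gamma_X ?/Gamma_Z /=; [ring|split; ring].
- by apply: (res G_x_div al) => [->|x]; rewrite ?/Gamma_X ?/Gamma_Z /=; [ring|split; ring].
- by apply: (res G_inv be) => [->|x]; rewrite ?/Gamma_X ?/Gamma_Z /=; [ring|split; ring].
- by apply: (res G_add1_div al) => [->|x]; rewrite ?/Gamma_X ?/Gamma_Z /=; [ring|split; ring].
- exfalso; apply: dt; have -> : be = al + be - al by ring.
  by rewrite -e1; ring.
- by apply: (res G_1_div ga) => [->|x]; rewrite ?/Gamma_X ?/Gamma_Z /=; [ring|split; ring].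
- exfalso; apply: dt; have -> : ga = ga + be - be by ring.
  by rewrite e1; ring.
by apply: (res G_add1 al) => [->|x]; rewrite ?/Gamma_X ?/Gamma_Z /=; [ring|split; ring].
Qed.

Lemma size_polyM_leqS (R : nzRingType) (p q : {poly R}) i j :
  (size p <= i.+1)%N -> (size q <= j.+1)%N -> (size (p * q)%R <= (i + j).+1)%N.
Proof.
move=> sp sq; apply: leq_trans (size_polyMleq _ _) _.
by rewrite -subn1 leq_subLR add1n (leq_trans (leq_add sp sq)) // addSn addnS.
Qed.

(** * The Artin-Schreier equation over K(x) *)

Section RationalSolution.
Variables (k : fieldType) (char2 : 2%N \in [pchar k]).
Variables (K : closedFieldType) (iota : {rmorphism k -> K}).
Let char2K : 2%N \in [pchar K] := rmorph_pchar iota char2.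

(** The hypothesis is v^2 + v = P/H + r/h for v = A/E in lowest terms. The simple poles on the right
    leave no pole for v, which is a constant u. As a, b, c are nonzero, r/h has poles at oo, 0 and
    1; they must cancel against those of P/H, so the Moebius map preserves {0, 1, oo}. *)
Lemma rational_solution (a b c d a' b' c' d' al be ga de : K) (A E : {poly K}) :
  a != 0 -> b != 0 -> c != 0 -> al * de - be * ga != 0 -> coprimep A E -> E != 0 ->
  (exists s : seq K, forall x, x \notin s ->
     (A.[x] ^+ 2 + A.[x] * E.[x]) * (hform (al * x + be) (ga * x + de) * hform x 1)
     = E.[x] ^+ 2 * (rform a' b' c' d' (al * x + be) (ga * x + de) * hform x 1
        + rform a b c d x 1 * hform (al * x + be) (ga * x + de))) ->
  exists g lam u, [/\ lam != 0, forall x, A.[x] = u * E.[x],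
     forall x, (u ^+ 2 + u) * (hform (al * x + be) (ga * x + de) * hform x 1)
       = rform a' b' c' d' (al * x + be) (ga * x + de) * hform x 1
         + rform a b c d x 1 * hform (al * x + be) (ga * x + de)
    & forall x, al * x + be = lam * Gamma_X g x 1 /\ ga * x + de = lam * Gamma_Z g x 1].
Proof.
move=> a0 b0 c0 det cop E0 [s eqn].
pose L := lpoly al be; pose M := lpoly ga de; pose H := cubic al be ga de.
pose P : {poly K} := a' *: (L ^+ 2 * (L + M)) + b' *: (M ^+ 2 * (L + M))
  + c' *: (L * M ^+ 2) + d' *: H.
pose r : {poly K} := a *: ('X^2 * ('X + 1)) + (b *: ('X + 1) + c *: 'X + d *: hpoly K).
have PE x : P.[x] = rform a' b' c' d' (al * x + be) (ga * x + de).
  rewrite /P /H /L /M /lpoly /cubic /lpoly !hornerR /rform /hform; ring.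
have rE x : r.[x] = rform a b c d x 1.
  by rewrite /r /hpoly -polyC1 !hornerR /rform /hform; ring.
have eqAE : (A ^+ 2 + A * E) * (H * hpoly K) = E ^+ 2 * (P * hpoly K + r * H).
  apply: (@poly_ext_notin _ s) => x /eqn; rewrite -PE -rE -horner_cubic -horner_hpoly -/H.
  clearbody P r H; move: (hpoly K) => h.
  by rewrite !(hornerM, hornerD, horner_exp).
have E1 : size E = 1%N.
  apply/eqP; apply: contraT => /closed_rootP[e /rootP Ee].
  have Ae := square_pole (@simple_cubic _ char2 _ iota _ _ _ _ det e)
    (simple_hpoly char2 iota (e := e)) eqAE Ee.
  have : root A e by apply/rootP.
  by move/(coprimep_root cop); rewrite Ee eqxx.
case/eqP/size_poly1P: E1 => ec ec0 EE.
have sP : (size P <= 4)%N.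
  have sL : (size L <= 2)%N := size_lpoly _ _; have sM : (size M <= 2)%N := size_lpoly _ _.
  have sLM : (size (L + M)%R <= 2)%N.
    by rewrite (leq_trans (size_polyD _ _)) // geq_max sL sM.
  have s3 (p q t : {poly K}) : (size p <= 2)%N -> (size q <= 2)%N -> (size t <= 2)%N ->
      (size (p * q * t)%R <= 4)%N.
    by move=> sp sq st; apply: (size_polyM_leqS (size_polyM_leqS sp sq) st).
  have sD (p q : {poly K}) : (size p <= 4)%N -> (size q <= 4)%N -> (size (p + q)%R <= 4)%N.
    by move=> sp sq; rewrite (leq_trans (size_polyD _ _)) // geq_max sp.
  have sZ x (p : {poly K}) : (size p <= 4)%N -> (size (x *: p)%R <= 4)%N.
    exact/leq_trans/size_scale_leq.
  rewrite /P !sD ?sZ ?expr2 ?s3 //; first by rewrite mulrA s3.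
have sr : size r = 4%N.
  have X1 : size ('X + 1 : {poly K}) = 2%N by rewrite -[1]opprK -polyCN size_XsubC.
  have X1n : ('X + 1 : {poly K}) != 0 by rewrite -size_poly_gt0 X1.
  have s4 : size (a *: ('X^2 * ('X + 1)) : {poly K}) = 4%N.
    by rewrite size_scale // size_mul ?size_polyXn ?X1 // -size_poly_gt0 size_polyXn.
  have sD (p q : {poly K}) : (size p <= 3)%N -> (size q <= 3)%N -> (size (p + q)%R <= 3)%N.
    by move=> sp sq; rewrite (leq_trans (size_polyD _ _)) // geq_max sp.
  rewrite /r size_polyDl s4 // ltnS !sD ?(leq_trans (size_scale_leq _ _)) ?X1 //.
    by rewrite size_polyX.
  by rewrite size_hpoly.
have [n nH] : exists n, size H = n.+3.
  by have := size_cubic char2 iota det; case: size => [|[|[|n]]] // _; exists n.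
have H0 : H != 0 by rewrite -size_poly_gt0 nH.
have h0 : hpoly K != 0 by rewrite -size_poly_gt0 size_hpoly.
have r0 : r != 0 by rewrite -size_poly_gt0 sr.
have sHh : size (H * hpoly K) = n.+1.+4 by rewrite size_mul // size_hpoly nH addn3.
have srH : size (r * H) = n.+2.+4 by rewrite size_mul // sr nH.
have sPh : (size (P * hpoly K)%R <= 6)%N.
  by apply: (size_polyM_leqS sP (_ : _ <= 2.+1)%N); rewrite size_hpoly.
(* A nonconstant A would give the left-hand side of [eqAE] a larger degree than the right-hand side:
   this is the absence of a pole at oo. *)
have sA1 : (size A <= 1)%N.
  rewrite leqNgt; apply/negP => sA.
  have [m mA] : exists m, size A = m.+2.
    by case: size sA => [|[|m]] // _; exists m.
  have A0 : A != 0 by rewrite -size_poly_gt0 mA.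
  have sA2 : size (A ^+ 2 + A * E) = (m + m).+3.
    have sAE : size (A * E) = m.+2 by rewrite EE mulrC mul_polyC size_scale.
    have sAA : size (A ^+ 2) = (m + m).+3 by rewrite expr2 size_mul // mA addSn !addnS.
    by rewrite size_polyDl sAA // sAE !ltnS leq_addr.
  have := congr1 (fun p : {poly K} => size p) eqAE.
  have n1 : A ^+ 2 + A * E != 0 by rewrite -size_poly_gt0 sA2.
  have n2 : H * hpoly K != 0 by rewrite -size_poly_gt0 sHh.
  rewrite size_mul // sA2 sHh => e.
  have : (size (E ^+ 2 * (P * hpoly K + r * H))%R <= maxn 6 n.+2.+4)%N.
    rewrite EE -polyC_exp mul_polyC (leq_trans (size_scale_leq _ _)) //.
    by rewrite (leq_trans (size_polyD _ _)) // srH geq_max !leq_max sPh leqnn orbT.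
  by rewrite -e; clear; lia.
have [x xA] : exists x, A = x%:P by exists A`_0; apply: size1_polyC.
pose u := x / ec.
have AE y : A.[y] = u * E.[y] by rewrite xA EE !hornerC divfK.
have eqn' y : (u ^+ 2 + u) * (hform (al * y + be) (ga * y + de) * hform y 1)
    = rform a' b' c' d' (al * y + be) (ga * y + de) * hform y 1
        + rform a b c d y 1 * hform (al * y + be) (ga * y + de).
  have ey : E.[y] ^+ 2 != 0 by rewrite EE hornerC expf_neq0.
  apply: (mulfI ey); have := congr1 (horner^~ y) eqAE.
  rewrite -PE -rE -horner_cubic -horner_hpoly -/H; clearbody P r H; move: (hpoly K) => h.
  rewrite !(hornerM, hornerD, horner_exp). by rewrite AE => <-; ring.
(* At x = 0 the form h vanishes and r takes the nonzero value b, so H(0) = 0; likewise at x = 1 with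
   c. *)
have e0 : be * de * (be + de) = 0.
  have hz : hform 0 1 = 0 :> K by rewrite /hform; ring.
  have rz : rform a b c d 0 1 = b by rewrite /rform /hform; ring.
  have := eqn' 0; rewrite hz rz !mulr0 !add0r => /esym/eqP.
  by rewrite mulf_eq0 (negbTE b0) => /eqP.
have e1 : (al + be) * (ga + de) * (al + be + (ga + de)) = 0.
  have h1 : hform 1 1 = 0 :> K by rewrite /hform (addKK char2 iota) mulr0.
  have r1 : rform a b c d 1 1 = c.
    by rewrite /rform h1 (addKK char2 iota) !mulr0 !add0r addr0; ring.
  have := eqn' 1; rewrite h1 r1 !mulr0 !mulr1 add0r => /esym/eqP.
  by rewrite mulf_eq0 (negbTE c0) => /eqP.
(* If the cubic coefficient of H were nonzero, r H would have a larger degree than both other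
   products. *)
have ei : al * ga * (al + ga) = 0.
  apply/eqP; apply: contraT; have [<- _] := cubic_coef al be ga de.
  move/coef_size; rewrite -/H nH !ltnS => n0.
  have eP : r * H = (u ^+ 2 + u) *: (H * hpoly K) - P * hpoly K.
    have HE z : H.[z] = hform (al * z + be) (ga * z + de) by apply: horner_cubic.
    have hE z : (hpoly K).[z] = hform z 1 by apply: horner_hpoly.
    apply: poly_ext => y; have := eqn' y; rewrite -PE -rE -HE -hE.
    clearbody P r H; move: (hpoly K) => h e.
    by rewrite !(hornerD, hornerN, hornerZ, hornerM) e; ring.
  have := congr1 (fun p : {poly K} => size p) eP; rewrite srH => e.
  have : (size ((u ^+ 2 + u) *: (H * hpoly K) - P * hpoly K)%R <= maxn 6 n.+1.+4)%N.
    rewrite (leq_trans (size_polyD _ _)) // size_polyN geq_max !leq_max sPh.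
    by rewrite [X in _ || X](leq_trans (size_scale_leq _ _)) ?sHh ?orbT.
  by rewrite -e; move: n0; clear; lia.
have [g [lam [l0 gE]]] := moebius_Gamma char2K det e0 ei e1.
by exists g, lam, u; split.
Qed.
End RationalSolution.

(** * Isomorphisms away from finitely many points *)

Section ClassifyCofinite.
Variables (k : fieldType) (char2 : 2%N \in [pchar k]).
Variables (K : closedFieldType) (iota : {rmorphism k -> K}).
Let char2K : 2%N \in [pchar K] := rmorph_pchar iota char2.

(** Dividing the identity by h leaves a cubic polynomial p whose coefficients must vanish. The
    correction e stays in K, since u is not yet known to lie in k. *)
Lemma qform_coef (A B C D a b c d : k) (e : K) :
  (forall x, qform iota A B C D x 1 = qform iota a b c d x 1 + e * hform x 1 ^+ 2) ->
  [/\ A = a, B = b, C = c & iota D = iota d + e].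
Proof.
move=> eqn; pose dA := iota A - iota a; pose dB := iota B - iota b.
pose dC := iota C - iota c; pose dD := iota D - iota d - e.
pose p : {poly K} := (dA) *: 'X^3 + (dA + dD) *: 'X^2 + (dB + dC + dD) *: 'X + dB%:P.
have p0 : hpoly K * p = 0.
  apply: poly_ext => x; rewrite hornerM horner_hpoly horner0 !hornerR.
  have := eqn x; rewrite !qform_rform => /eqP; rewrite -subr_eq0 => /eqP <-.
  by rewrite /rform /hform /dA /dB /dC /dD; ring.
have {}p0 : p = 0.
  by move/eqP: p0; rewrite mulf_eq0 -[hpoly K == 0]size_poly_eq0 size_hpoly => /eqP.
have coef i : p`_i = 0 by rewrite p0 coef0.
have pE i : p`_i = dA * (i == 3%N)%:R + (dA + dD) * (i == 2%N)%:R
    + (dB + dC + dD) * (i == 1%N)%:R + dB * (i == 0%N)%:R.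
  rewrite !coefD !coefZ !coefXn coefX coefC.
  by case: (i == 0%N); rewrite ?mulr1 ?mulr0.
have A0 : dA = 0 by have := coef 3%N; rewrite pE /= !mulr0 !addr0 mulr1.
have B0 : dB = 0 by have := coef 0%N; rewrite pE /= !mulr0 !add0r mulr1.
have D0 : dD = 0 by have := coef 2%N; rewrite pE /= A0 !mulr0 !addr0 !add0r mulr1.
have C0 : dC = 0.
  by have := coef 1%N; rewrite pE /= A0 B0 D0 !mulr0 !addr0 !add0r mulr1.
have inj x y : iota x - iota y = 0 -> x = y.
  by move/eqP; rewrite subr_eq0 => /eqP/fmorph_inj.
split; [exact: inj|exact: inj|exact: inj|].
by apply/eqP; rewrite -subr_eq0 opprD addrA -/dD D0.
Qed.

Section AffineY.
Variables (a b c d : k).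
Local Notation C := (pvariety iota (curve a b c d)).

Definition yP (Q : C) := wP Q / hform (xP Q) 1.

Lemma yP_eqn Q : finP Q -> hform (xP Q) 1 != 0 -> yP Q ^+ 2 + yP Q
  = rform (iota a) (iota b) (iota c) (iota d) (xP Q) 1 / hform (xP Q) 1.
Proof.
move=> Qf h0; have := finP_eqn char2 Qf; rewrite qform_rform => e.
apply: (mulIf (expf_neq0 2 h0)); rewrite /yP.
transitivity (wP Q ^+ 2 + hform (xP Q) 1 * wP Q); first by field.
by rewrite e; field.
Qed.

Lemma yP_hyp Q : finP Q -> hform (xP Q) 1 != 0 -> yP (hyp_fun char2 Q) = yP Q + 1.
Proof.
move=> Qf h0; have [_ hx hw] := hyp_fin char2 Qf.
by rewrite /yP hx hw; field.
Qed.

Lemma cof_hform : cof (fun Q : C => hform (xP Q) 1 != 0).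
Proof.
have h0 : hpoly K != 0 by rewrite -size_poly_gt0 size_hpoly.
apply: cofW (cofI (cof_fin char2 iota a b c d) (cof_poly char2 iota a b c d h0)).
by move=> Q [Qf /(_ Qf)]; rewrite horner_hpoly.
Qed.

Lemma regat_yP (Q : C) : a != 0 -> finP Q -> hform (xP Q) 1 != 0 -> regat yP Q (yP Q).
Proof.
move=> a0 Qf h0.
have rw : regat (@wP _ _ iota a b c d) Q (wP Q).
  have ew (Q' : C) : ev 0 1 Q' = wP Q' by rewrite /ev -polyC1 hornerC horner0 add0r mul1r.
  by have := regat_ev Q 0 1; rewrite ew; apply: regat_ext; apply: cofT.
have rh : regat (fun Q : C => hform (xP Q) 1) Q (hform (xP Q) 1).
  have := regat_ev Q (hpoly K) 0; rewrite evp horner_hpoly.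
  by apply: regat_ext; apply: cofT => Q'; rewrite evp horner_hpoly.
by have := regatM char2 Qf rw (regatV char2 a0 h0 rh).
Qed.

End AffineY.

Section Iso.
Variables (a b c d a' b' c' d' : k).
Local Notation C1 := (pvariety iota (curve a b c d)).
Local Notation C2 := (pvariety iota (curve a' b' c' d')).
Variables (a0 : a != 0) (b0 : b != 0) (c0 : c != 0) (a0' : a' != 0).
Variables (f : C1 -> C2) (g : C2 -> C1).
Hypotheses (fK : cancel f g) (gK : cancel g f).
Hypotheses (rf : regular_map f) (rg : regular_map g).

(** Both y o f and y increase by 1 under the involution, so their sum is invariant, hence rational
    in x; the fraction is then reduced by its gcd. *)
Lemma y_shift : exists A E : {poly K}, [/\ E != 0, coprimep A E
  & cof (fun Q => (yP (f Q) + yP Q) * E.[xP Q] = A.[xP Q])].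
Proof.
have cf := cof_fin char2 iota a b c d.
have cgood := cofI (cof_fin_map char2 fK) (cofI (cof_hform a b c d)
  (cof_map fK (cof_hform a' b' c' d'))).
have [Q0 Q0f [fQ0f [h0 fh0]]] := cof_ex char2 cgood.
have ry : regat (fun Q => yP (f Q) + yP Q) Q0 (yP (f Q0) + yP Q0).
  apply: regatD => //; last exact: regat_yP.
  by apply: (regat_pull char2 a0 a0' fK rf) => //; apply: regat_yP.
have [|A [E [E0 AE]]] := @invariant_rational _ char2 _ iota _ _ _ _ _ _ _ a0 ry.
  apply: cofW (cofI cf (cofI cgood (commute_hyp char2 a0 b0 a0' fK gK rf rg))).
  move=> Q [Qf [[fQf [hQ fhQ]] ->]]; rewrite !yP_hyp //.
  by rewrite addrACA (addKK char2 iota) addr0.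
have [AG EG] : gcdp A E %| A /\ gcdp A E %| E by rewrite dvdp_gcdl dvdp_gcdr.
pose G := gcdp A E.
have G0 : G != 0 by rewrite gcdp_eq0 negb_and E0 orbT.
exists (A %/ G), (E %/ G); split; first by rewrite dvdp_div_eq0.
  by rewrite coprimep_div_gcd // E0 orbT.
apply: cofW (cofI AE (cofI cf (cof_poly char2 iota a b c d G0))) => Q [e [Qf /(_ Qf) GQ]].
apply: (mulIf GQ); rewrite -mulrA -!hornerM !divpK //.
Qed.

Lemma classify_cof : exists h u, [/\
    let: (A, B, C, D) := twist h 0 (a', b', c', d') in
      [/\ a = A, b = B, c = C & iota d = iota D + (u + u ^+ 2)]
  & cof (fun Q => val (val (f Q)) = <[par (Gamma_X h (xP Q) 1) (Gamma_Z h (xP Q) 1)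
       (wP Q + u * hform (xP Q) 1)]>%VS)].
Proof.
have [al [be [ga [de [det mob]]]]] := xP_moebius char2 a0 b0 a0' fK gK rf rg.
have [A [E [E0 cop AE]]] := y_shift.
have cf := cof_fin char2 iota a b c d.
have cgood := cofI cf (cofI (cof_fin_map char2 fK) (cofI (cof_hform a b c d)
  (cof_map fK (cof_hform a' b' c' d')))).
have M0 : lpoly ga de != 0.
  apply: contraNneq det => M0.
  have M0i i : (lpoly ga de)`_i = 0 by rewrite M0 coef0.
  have -> : ga = 0 by have := M0i 1%N; rewrite coefD coefZ coefX coefC mulr1 addr0.
  have -> : de = 0 by have := M0i 0%N; rewrite coefD coefZ coefX coefC mulr0 add0r.
  by rewrite !mulr0 subrr.
have cM := cofI (cof_poly char2 iota a b c d M0) (cof_poly char2 iota a b c d E0).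
have [||||h [lam [u [l0 AuE eqn LM]]]] := @rational_solution _ char2 _ iota
  (iota a) (iota b) (iota c) (iota d) (iota a') (iota b') (iota c') (iota d')
  al be ga de A E _ _ _ det cop E0; rewrite ?fmorph_eq0 //.
  apply: (cof_notin char2 (a := a) (b := b) (c := c) (d := d)
    (P := fun x => _ = _ :> K)).
  apply: cofW (cofI cgood (cofI cM (cofI AE mob))).
  move=> Q [[Qf [fQf [hQ fhQ]]] [[/(_ Qf) MQ _] [AEQ mobQ]]].
  move: MQ; rewrite horner_lpoly => MQ.
  have := yP_eqn Qf hQ; have := yP_eqn fQf fhQ.
  move: AEQ; set v := yP _ + yP Q => AEQ e2 e1.
  have ve : v ^+ 2 + v = (yP (f Q) ^+ 2 + yP (f Q)) + (yP Q ^+ 2 + yP Q).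
    by apply: (@eq_pchar2 _ _ _ (yP (f Q) * yP Q)) => //; rewrite /v; ring.
  have xE : al * xP Q + be = xP (f Q) * (ga * xP Q + de) by rewrite -mobQ.
  move: ve; rewrite e1 e2 -AEQ xE => ve.
  move: (xP (f Q)) (xP Q) (ga * xP Q + de) E.[xP Q] MQ hQ fhQ ve => X x M e M0' hx hX ve.
  have -> : (v * e) ^+ 2 + v * e * e = e ^+ 2 * (v ^+ 2 + v) by ring.
  have -> : hform (X * M) M = M ^+ 3 * hform X 1 by rewrite /hform; ring.
  have -> : rform (iota a') (iota b') (iota c') (iota d') (X * M) M
    = M ^+ 3 * rform (iota a') (iota b') (iota c') (iota d') X 1.
    by rewrite /rform /hform; ring.
  by rewrite ve; field; rewrite hx hX.
exists h, u; split=> //; last first.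
  apply: cofW (cofI cgood (cofI cM (cofI AE mob))).
  move=> Q [[Qf [fQf [hQ fhQ]]] [[/(_ Qf) MQ /(_ Qf) EQ] [AEQ mobQ]]].
  have [LE ME] := LM (xP Q); move: MQ; rewrite horner_lpoly ME => MQ.
  have Z0 : Gamma_Z h (xP Q) 1 != 0 by apply: contraNneq MQ => ->; rewrite mulr0.
  have vu : yP (f Q) + yP Q = u by apply: (mulIf EQ); rewrite AEQ AuE.
  have xE : Gamma_X h (xP Q) 1 = Gamma_Z h (xP Q) 1 * xP (f Q).
    by apply: (mulfI l0); rewrite -LE -mobQ ME; ring.
  have wE : wP Q + u * hform (xP Q) 1 = Gamma_Z h (xP Q) 1 ^+ 3 * wP (f Q).
    have yE : yP (f Q) = u + yP Q by rewrite -vu -addrA (addKK char2 iota) addr0.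
    have -> : wP Q + u * hform (xP Q) 1 = hform (xP Q) 1 * (u + yP Q).
      by rewrite /yP; field.
    rewrite -yE -(hform_Gamma char2 iota h) xE /yP.
    have -> : hform (Gamma_Z h (xP Q) 1 * xP (f Q)) (Gamma_Z h (xP Q) 1)
      = Gamma_Z h (xP Q) 1 ^+ 3 * hform (xP (f Q)) 1 by rewrite /hform; ring.
    by field.
  rewrite xE wE -[X in par _ X _]mulr1 parZ vlineZ ?expf_neq0 //.
  exact: finP_line.
case tw : (twist h 0 (a', b', c', d')) => [[[A' B'] C'] D'].
have := @qform_coef A' B' C' D' a b c d (u + u ^+ 2).
case=> [x|-> -> -> eD]; last first.
  by split=> //; rewrite eD -addrA (addKK char2 iota) addr0.
have := qform_twist char2 iota h 0 (a', b', c', d') x 1; rewrite tw /= => qt.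
have qt' : qform iota A' B' C' D' x 1 = qform iota a' b' c' d' (Gamma_X h x 1) (Gamma_Z h x 1).
  by rewrite qt rmorph0 expr0n addr0 mul0r addr0.
rewrite qt' !qform_rform (hform_Gamma char2 iota).
have [LE ME] := LM x; have := eqn x; rewrite LE ME.
set X := Gamma_X h x 1; set Z := Gamma_Z h x 1.
have -> : hform (lam * X) (lam * Z) = lam ^+ 3 * hform X Z by rewrite /hform; ring.
have -> : rform (iota a') (iota b') (iota c') (iota d') (lam * X) (lam * Z)
  = lam ^+ 3 * rform (iota a') (iota b') (iota c') (iota d') X Z.
  by rewrite /rform /hform; ring.
rewrite (hform_Gamma char2 iota h) => e.
apply: (mulfI (expf_neq0 3 l0)).
set R2 := rform _ _ _ _ X Z; set R1 := rform _ _ _ _ x 1.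
transitivity (lam ^+ 3 * R2 * hform x 1 + R1 * (lam ^+ 3 * hform x 1)
  + lam ^+ 3 * (R1 * hform x 1)).
  by apply: (@eq_pchar2 _ _ _ (- (lam ^+ 3 * (R1 * hform x 1)))) => //; rewrite /R2; ring.
by rewrite -e; ring.
Qed.

End Iso.
End ClassifyCofinite.

(** * Descent of the shift to k, and the classification *)

Section Classify.
Variables (k : fieldType) (char2 : 2%N \in [pchar k]).
Variables (K : closedFieldType) (iota : {rmorphism k -> K}).

Lemma scale_rational (u : K) (p q : {poly k}) : p != 0 ->
  u *: map_poly iota p = map_poly iota q -> exists u0, u = iota u0.
Proof.
move=> p0 /(congr1 (fun r : {poly K} => r`_(size p).-1)).
rewrite coefZ !coef_map -lead_coefE => e; exists (q`_(size p).-1 / lead_coef p).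
by rewrite fmorph_div -e mulfK // fmorph_eq0 lead_coef_eq0.
Qed.

Lemma lin_map_ex_eq n n' g u : n' = twist g u n ->
  exists f : pt_of iota n' -> pt_of iota n, lin_map g u f.
Proof. by move=> ->; apply: lin_map_ex. Qed.

Section Iso.
Variables (a b c d a' b' c' d' : k).
Local Notation C1 := (pvariety iota (curve a b c d)).
Local Notation C2 := (pvariety iota (curve a' b' c' d')).
Variables (a0 : a != 0) (b0 : b != 0) (c0 : c != 0) (a0' : a' != 0).

(** The coordinates of f satisfy u4 : (u1 + u2) = (w + u h) : h, and they are proportional to
    functions over k. Comparing the two components of the resulting relation gives u times a nonzero
    polynomial over k equal to a polynomial over k. *)
Lemma shift_rational (f : C1 -> C2) h u : regular_map f ->
  cof (fun Q => val (val (f Q)) = <[par (Gamma_X h (xP Q) 1) (Gamma_Z h (xP Q) 1)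
       (wP Q + u * hform (xP Q) 1)]>%VS) -> exists u0, u = iota u0.
Proof.
move=> rf fE; have cf := cof_fin char2 iota a b c d.
have [Q0 Q0f _] := cof_ex char2 cf.
have [G [kG _ GE]] := regular_fin char2 a0 rf Q0f.
have [A [B AB]] := kG 4%N; have [D [E DE]] := kpolyD (kG 1%N) (kG 2%N).
pose hk : {poly k} := 'X * ('X + 1).
have hE : map_poly iota hk = hpoly K by rewrite rmorphM rmorphD /= map_polyX rmorph1.
clearbody hk.
have GE' : cof (fun Q : C1 => finP Q /\ exists2 t, t != 0 &
    G Q 4%N = t * (wP Q + u * hform (xP Q) 1) /\ G Q 1%N + G Q 2%N = t * hform (xP Q) 1).
  apply: cofW (cofI cf (cofI fE GE)) => Q [Qf [/co_line[s s0 sE] [t t0 tE]]].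
  split=> //; exists (t * s); first by rewrite mulf_neq0.
  rewrite !tE // /co sE /par !mxE !inordK //= -(hform_Gamma char2 iota h) /hform.
  by split; ring.
have DE0 : D != 0 \/ E != 0.
  have [D0|] := eqVneq D 0; [right|by left]; apply/eqP => E0.
  have [Q Qf [[_ [t t0 [_ e]]] hQ]] := cof_ex char2 (cofI GE' (cof_hform char2 iota a b c d)).
  move: (mulf_neq0 t0 hQ); rewrite -e DE // D0 E0 rmorph0 evp horner0 eqxx //.
pose A1 := map_poly iota A; pose B1 := map_poly iota B.
pose D1 := map_poly iota D; pose E1 := map_poly iota E.
have [|eA eB] := @ev_cof0 _ char2 _ iota a b c d
   (A1 * hpoly K - u *: (hpoly K * D1) - E1 * curve_poly iota a b c d)
   (B1 * hpoly K - u *: (hpoly K * E1) - D1 + E1 * hpoly K) a0.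
  apply: cofW GE' => Q [Qf [t t0 [e4 e12]]].
  have := wP2 char2 Qf; have := horner_hpoly (xP Q).
  move: e4 e12; rewrite AB // DE // -/A1 -/B1 -/D1 -/E1.
  move: (hpoly K) (curve_poly _ _ _ _ _) => hp qp e4 e12 hE2 w2.
  rewrite -hE2 in e4 e12.
  transitivity (hp.[xP Q] * ev A1 B1 Q - (u * hp.[xP Q] + wP Q) * ev D1 E1 Q
    + E1.[xP Q] * (wP Q ^+ 2 - (qp.[xP Q] - hp.[xP Q] * wP Q))).
    by rewrite /ev !(hornerD, hornerN, hornerZ, hornerM); ring.
  by rewrite w2 e4 e12 subrr mulr0; ring.
have hk0 : hk != 0.
  by rewrite -(map_poly_eq0 iota) hE -size_poly_gt0 size_hpoly.
have [E0|E0] := eqVneq E 0.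
  have D0 : D != 0 by case: DE0 => //; rewrite E0 eqxx.
  apply: (@scale_rational _ (hk * D) (hk * A)); first by rewrite mulf_neq0.
  rewrite !rmorphM /= hE -/A1 -/D1; move/eqP: eA.
  by rewrite /E1 E0 rmorph0 mul0r subr0 subr_eq0 mulrC => /eqP ->.
apply: (@scale_rational _ (hk * E) (hk * B - D + hk * E)); first by rewrite mulf_neq0.
rewrite rmorphD rmorphB !rmorphM /= hE -/B1 -/D1 -/E1; apply/eqP; rewrite eq_sym -subr_eq0.
by rewrite -[X in _ == X]eB; apply/eqP; ring.
Qed.

Lemma coords_inf (f : pt_of iota (twist G_inv 0 (a, b, c, d)) -> C1) P :
  @lin_map _ _ iota (a, b, c, d) _ G_inv 0 f -> ~~ finP (f P) ->
  finP (P : pvariety iota (curve b a c (d + c + (0 + 0 ^+ 2)))).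
Proof.
move=> fE; apply: contraNT => Pi.
have := lin_map_par fE (infP_line char2 Pi); rewrite /Gamma_X /Gamma_Z /= => /xP_line[-> _ _].
by rewrite /par !mxE !inordK //= expr1n oner_eq0.
Qed.

(* The point at infinity is reached through the chart at 0 of the curve        *)
(* obtained by x |-> 1/x.                                                      *)
Lemma regular_eq (f f' : C1 -> C2) : regular_map f -> regular_map f' ->
  cof (fun Q => f Q = f' Q) -> f =1 f'.
Proof.
move=> rf rf' ff' P.
have [Pf|Pi] := boolP (finP P); first exact: (regular_eq_fin char2 a0 rf rf' ff').
have [s [s' [sK s'K sE sE']]] : exists
    (s : pvariety iota (curve b a c (d + c + (0 + 0 ^+ 2))) -> C1) (s' : C1 -> _),
    [/\ cancel s s', cancel s' s,
        @lin_map _ _ iota (a, b, c, d) (twist G_inv 0 (a, b, c, d)) G_inv 0 s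
      & @lin_map _ _ iota (twist G_inv 0 (a, b, c, d)) (a, b, c, d) G_inv 0 s'].
  exact: (lin_map_iso char2 iota G_inv 0 (a, b, c, d)).
have rs := lin_map_regular sE.
have := regular_eq_fin char2 b0 (regular_comp rf rs) (regular_comp rf' rs) (cof_map sK ff').
move=> /(_ (s' P)); rewrite /= s'K; apply.
by apply: (coords_inf sE); rewrite s'K.
Qed.

(** By [classify_cof] and [shift_rational], f agrees almost everywhere with a linear map, and
    regular maps that agree almost everywhere are equal. *)
Lemma classification (f : C1 -> C2) (g : C2 -> C1) :
  cancel f g -> cancel g f -> regular_map f -> regular_map g ->
  exists h u, (a, b, c, d) = twist h u (a', b', c', d')
    /\ @lin_map _ _ iota (a', b', c', d') (a, b, c, d) h u f.
Proof.
move=> fK gK rf rg.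
have [h [u [tw fE]]] := classify_cof char2 a0 b0 c0 a0' fK gK rf rg.
have [u0 uE] := shift_rational rf fE.
have e : (a, b, c, d) = twist h u0 (a', b', c', d').
  move: tw; rewrite uE -rmorphXn -!rmorphD.
  case: h fE => _ /= [-> -> ->]; rewrite -rmorphD => /fmorph_inj->;
    by rewrite expr0n !addr0.
exists h, u0; split=> //; have [f0 f0E] := lin_map_ex_eq e.
suff ff0 : f =1 f0 by move=> P; rewrite ff0 f0E.
apply: regular_eq => //; first exact: lin_map_regular f0E.
apply: cofW (cofI (cof_fin char2 iota a b c d) fE) => Q [Qf QE].
apply: val_inj; apply: val_inj; rewrite QE.
by have := lin_map_par f0E (finP_line char2 Qf); rewrite -uE => ->.
Qed.

End Iso.
End Classify.

(** * Automorphisms and isotropy groups *)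

Section XCoordinate.
Variables (k : fieldType) (char2 : 2%N \in [pchar k]).
Variables (K : closedFieldType) (iota : {rmorphism k -> K}).

Lemma row2Z t (x z : K) : t *: row2 x z = row2 (t * x) (t * z).
Proof. by apply/rowP=> i; rewrite !mxE; case: ifP. Qed.

Lemma row2_eq (x z x' z' : K) : row2 x z = row2 x' z' -> x = x' /\ z = z'.
Proof.
move/rowP=> e; have := e 0; have := e 1; rewrite !mxE /= => -> ->; split=> //.
Qed.

Lemma row2P (v : 'rV[K]_2) : v = row2 (v 0 0) (v 0 1).
Proof.
apply/rowP=> i; rewrite !mxE; case: ifP => [/eqP->|] //.
by case: i => [[|[|i]]] // lt_i _; congr (v 0 _); apply: val_inj.
Qed.

Lemma row2_neq0 (x z : K) : (row2 x z != 0) = (x != 0) || (z != 0).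
Proof.
rewrite -negb_and; congr (~~ _); apply/eqP/andP => [/rowP e|[/eqP-> /eqP->]].
  by have := e 0; have := e 1; rewrite !mxE /= => -> ->; rewrite eqxx.
by apply/rowP=> i; rewrite !mxE; case: ifP.
Qed.

Lemma xcoord_line a b c d (P : pvariety iota (curve a b c d)) X Z W :
  (X != 0) || (Z != 0) -> val (val P) = <[par X Z W]>%VS ->
  val (xcoord P) = <[row2 X Z]>%VS.
Proof.
move=> XZ /co_line[t t0 tE].
have -> : val (xcoord P) = <[Defs.xrow (pcoords (val P))]>%VS by [].
rewrite tE /Defs.xrow /par !mxE !inordK //=.
rewrite mulf_eq0 (negbTE t0) expf_eq0 /=; have [X0|X0] := eqVneq X 0.
  move: XZ; rewrite X0 eqxx /= => Z0.
  rewrite -(vlineZ (t := t * Z ^+ 2) (row2 0 Z)) ?mulf_neq0 ?expf_neq0 //.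
  by rewrite row2Z; congr (<[row2 _ _]>%VS); ring.
rewrite -(vlineZ (t := t * X ^+ 2) (row2 X Z)) ?mulf_neq0 ?expf_neq0 //.
by rewrite row2Z; congr (<[row2 _ _]>%VS); ring.
Qed.

Lemma Gamma_PGL2_line g (p : pspace K 1) X Z : val p = <[row2 X Z]>%VS ->
  val (Gamma_PGL2 iota g p) = <[row2 (Gamma_X g X Z) (Gamma_Z g X Z)]>%VS.
Proof.
move=> pE; have : pcoords p \in <[row2 X Z]>%VS by rewrite -pE memv_pick.
case/vlineP=> t tE; have t0 : t != 0.
  by apply: contraNneq (pcoords_neq0 p) => t0; rewrite tE t0 scale0r.
rewrite /= tE -scalemxAl vlineZ //; congr (<[_]>%VS).
have [-> ->] := Gamma_mxE iota g X Z.
apply/rowP=> i; rewrite !mxE !big_ord_recl big_ord0 !mxE /= addr0.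
have -> : lift ord0 ord0 = 1 :> 'I_2 by apply: val_inj.
case: i => [[|[|i]]] //= lt_i; rewrite [X * _]mulrC [Z * _]mulrC.
  by have -> : Ordinal lt_i = 0 by apply: val_inj.
by have -> : Ordinal lt_i = 1 by apply: val_inj.
Qed.

Lemma pt_xcoord n (p : pspace K 1) : exists (P : pt_of iota n) (X Z W : K),
  [/\ (X != 0) || (Z != 0), val (val P) = <[par X Z W]>%VS & val p = <[row2 X Z]>%VS].
Proof.
case: n => [[[a b] c] d].
pose X := pcoords p 0 0; pose Z := pcoords p 0 1.
have pE : pcoords p = row2 X Z by apply: row2P.
have XZ : (X != 0) || (Z != 0) by rewrite -row2_neq0 -pE pcoords_neq0.
have [W WE] := eqn_solve (hform X Z) (qform iota a b c d X Z).
have [P PE] := pt_par char2 XZ WE.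
by exists P, X, Z, W; split=> //; rewrite -[val p]pcoordsK pE.
Qed.

(** The images of oo and 0 separate the six elements. *)
Lemma Gamma_PGL2_inj g h : Gamma_PGL2 iota g = Gamma_PGL2 iota h -> g = h.
Proof.
move=> gh; have key (X Z : K) : (X != 0) || (Z != 0) -> exists2 t, t != 0 &
    Gamma_X g X Z = t * Gamma_X h X Z /\ Gamma_Z g X Z = t * Gamma_Z h X Z.
  move=> XZ; have nz : row2 X Z != 0 by rewrite row2_neq0.
  have pE : val (ppoint nz) = <[row2 X Z]>%VS by [].
  have := Gamma_PGL2_line g pE; rewrite gh (Gamma_PGL2_line h pE) => e.
  have : row2 (Gamma_X g X Z) (Gamma_Z g X Z) \in <[row2 (Gamma_X h X Z) (Gamma_Z h X Z)]>%VS.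
    by rewrite e memv_line.
  case/vlineP=> t; rewrite row2Z => /row2_eq[e1 e2]; exists t => //.
  apply/eqP => t0; move: e1 e2; rewrite t0 !mul0r => e1 e2.
  by have := Gamma_neq0 char2 iota g XZ; rewrite e1 e2 eqxx.
have [|t /eqP t0] := key 1 0; first by rewrite oner_eq0.
have [|s /eqP s0] := key 0 1; first by rewrite oner_eq0 orbT.
have o0 : (1 : K) <> 0 by apply/eqP/oner_neq0.
by case: g {gh key}; case: h; rewrite /Gamma_X /Gamma_Z /= !(addr0, add0r, mulr0, mulr1);
  move=> -[e1 e2] [e3 e4] //; exfalso; congruence.
Qed.

End XCoordinate.

Section Automorphisms.
Variables (k : fieldType) (char2 : 2%N \in [pchar k]).
Variables (K : closedFieldType) (iota : {rmorphism k -> K}).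

Lemma lin_map_xcoord a b c d a' b' c' d' g u
    (f : pvariety iota (curve a' b' c' d') -> pvariety iota (curve a b c d)) P :
  @lin_map _ _ iota (a, b, c, d) (a', b', c', d') g u f ->
  xcoord (f P) = Gamma_PGL2 iota g (xcoord P).
Proof.
move=> fE; have [t t0 [X [Z [W [PE _ XZ]]]]] := coordsP char2 P.
have PE' : val (val P) = <[par X Z W]>%VS by rewrite -pcoordsK PE vlineZ.
have {}XZ : (X != 0) || (Z != 0).
  by case: XZ => [[-> _]|->]; rewrite oner_eq0 ?orbT.
apply: val_inj; rewrite (xcoord_line (Gamma_neq0 char2 iota g XZ) (lin_map_par fE PE')).
by rewrite (Gamma_PGL2_line iota g (xcoord_line XZ PE')).
Qed.

Lemma xcoord_surj a b c d (p : pspace K 1) :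
  exists P : pvariety iota (curve a b c d), xcoord P = p.
Proof.
have [P [X [Z [W [XZ PE pE]]]]] := pt_xcoord char2 iota (a, b, c, d) p.
by exists P; apply: val_inj; rewrite (xcoord_line XZ PE) pE.
Qed.

Lemma Gamma_PGL2_1 : Gamma_PGL2 iota G_x = 1%g.
Proof.
apply: sym_ext => p; have [P [X [Z [W [_ _ pE]]]]] := pt_xcoord char2 iota (0, 0, 0, 0) p.
by apply: val_inj; rewrite (Gamma_PGL2_line iota G_x pE) -pE.
Qed.

Lemma lin_map_iso_eq g u n n' : n' = twist g u n -> exists (f : pt_of iota n' -> pt_of iota n)
    (f' : pt_of iota n -> pt_of iota n'),
  [/\ cancel f f', cancel f' f, lin_map g u f & lin_map (Gamma_inv g) u f'].
Proof. by move=> ->; apply: lin_map_iso. Qed.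

(** Passing to the class of d forgets exactly the term u + u^2. *)
Lemma Gamma_act_twist (a b c a' b' c' : kstar k) (d d' : k) g :
  (a', b', c', ASclass char2 d') = Gamma_act (a, b, c, ASclass char2 d) g
  <-> exists u, (val a', val b', val c', d') = twist g u (val a, val b, val c, d).
Proof.
have asD x y : ASclass char2 x + ASclass char2 y = ASclass char2 (x + y).
  by rewrite /ASclass -raddfD.
have key x : ASclass char2 d' = ASclass char2 x <-> exists u, d' = x + (u + u ^+ 2).
  split=> [/eqP|[u ->]].
    rewrite ASclassE => /asboolP[u uE]; exists u; rewrite -uE; ring.
  by apply/eqP; rewrite ASclassE addrAC subrr add0r; apply/asboolP; exists u.
have vi (x y : kstar k) : val x = val y -> x = y by apply: val_inj.
case: g => /=; rewrite ?asD; split=> [[-> -> -> /key[u ->]]|[u [/vi-> /vi-> /vi-> dE]]];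
  try (by exists u); by congr (_, _, _, _); apply/key; exists u.
Qed.

(** A root chosen as a function of z alone, so that equal parameters get equal roots; [shiftM]
    relies on this. The default is 0. *)
Definition AS_root (z : k) : k :=
  if pselect (exists x, z = x + x ^+ 2) is left e then projT1 (cid e) else 0.

Lemma AS_rootP z u : z = u + u ^+ 2 -> AS_root z + AS_root z ^+ 2 = z.
Proof.
move=> zE; rewrite /AS_root; case: pselect => [e|[]]; last by exists u.
by case: (cid e).
Qed.

(* The shift u of a lift of g only depends on the third coordinate fixed by a  *)
(* transposition g, which makes g |-> L_(g,u) multiplicative.                  *)
Definition shift (a b c : k) (g : Gamma) : k :=
  match g with
  | G_inv   => AS_root c
  | G_add1  => AS_root a
  | G_x_div => AS_root b
  | _ => 0
  end.

(** A transposition that fixes the parameters has its remaining one of the form u + u^2. A rotation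
    forces a = b = c, and the shift 0 works. *)
Lemma shift_twist (a b c d u : k) g : (a, b, c, d) = twist g u (a, b, c, d) ->
  (a, b, c, d) = twist g (shift a b c g) (a, b, c, d).
Proof.
have kk (x : k) : x + x = 0 by apply: addrr_pchar2.
have root (x y z : k) : x = x + y + z -> y = z.
  move=> e; apply/eqP; rewrite -subr_eq0 (oppr_pchar2 char2).
  by apply/eqP/(addrI x); rewrite addrA -e addr0.
case: g => /=.
- by rewrite expr0n !addr0.
- by case=> <- _ /root e; rewrite (AS_rootP e) -addrA kk addr0.
- by case=> <- _ /root e; rewrite (AS_rootP e) -addrA kk addr0.
- case=> <- _; rewrite [d + a + b]addrAC -[d + b + a + a]addrA kk addr0 => /root e.
  by rewrite (AS_rootP e) -addrA kk addr0.
- by case=> <- <- _ _; rewrite expr0n !addr0 -addrA kk addr0.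
by case=> <- <- _ _; rewrite expr0n !addr0 -addrA kk addr0.
Qed.

(** If two distinct transpositions, or a transposition and a rotation, fix the parameters, then a =
    b = c and all transpositions have the same shift; two of these cancel, matching the shift 0 of a
    rotation. *)
Lemma shiftM (a b c d u v : k) g h : (a, b, c, d) = twist g u (a, b, c, d) ->
  (a, b, c, d) = twist h v (a, b, c, d) ->
  shift a b c (Gamma_mul g h) = shift a b c g + shift a b c h.
Proof.
have kk (x : k) : x + x = 0 by apply: addrr_pchar2.
by case: g; case: h => /= e1 e2; injection e1; injection e2; intros; subst;
  rewrite ?kk ?addr0 ?add0r.
Qed.

Section OneCurve.
Variables (a b c : kstar k) (d : k).
Local Notation n := (val a, val b, val c, d).
Local Notation calN_n := (a, b, c, ASclass char2 d).
Local Notation C := (curve (val a) (val b) (val c) d).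
Local Notation pt := (pvariety iota C).
Local Notation is_lin g u phi := (@lin_map _ _ iota n n g u (Defs.symf phi)).

Lemma var_aut_lin (phi : sym pt) : phi \in var_aut iota C ->
  exists g u, n = twist g u n /\ is_lin g u phi.
Proof.
move=> /asboolP[rf rf'].
have [h [u [e fE]]] := classification char2 (valP a) (valP b) (valP c) (valP a)
  (@Defs.symK _ phi) (@Defs.symVK _ phi) rf rf'.
by exists h, u.
Qed.

Lemma lin_var_aut g u : n = twist g u n ->
  exists2 phi : sym pt, phi \in var_aut iota C & is_lin g u phi.
Proof.
move=> /lin_map_iso_eq[f [f' [fK f'K fE fE']]]; exists (Defs.Sym fK f'K) => //.
apply/asboolP; split; [exact: lin_map_regular fE|exact: lin_map_regular fE'].
Qed.

Lemma is_lin_eq g u (phi psi : sym pt) : is_lin g u phi -> is_lin g u psi -> phi = psi.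
Proof. by move=> e e'; apply: sym_ext; apply: lin_map_uniq e e'. Qed.

Lemma is_linM g h u v (phi psi : sym pt) : is_lin g u phi -> is_lin h v psi ->
  is_lin (Gamma_mul g h) (u + v) (phi * psi)%g.
Proof. exact: lin_map_comp. Qed.

Lemma is_lin_Gamma g h u v (phi : sym pt) : is_lin g u phi -> is_lin h v phi -> g = h.
Proof.
move=> e e'; apply: (@Gamma_PGL2_inj _ char2 _ iota); apply: sym_ext => p.
have [P <-] := xcoord_surj (val a) (val b) (val c) d p.
by rewrite -(lin_map_xcoord _ e) -(lin_map_xcoord _ e').
Qed.

Lemma is_lin1 : is_lin G_x 0 (1%g : sym pt).
Proof.
have [|phi _ phiE] := @lin_var_aut G_x 0; first by rewrite /= expr0n !addr0.
suff -> : 1%g = phi by [].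
by apply: sym_ext => P; rewrite (lin_map_id char2 phiE).
Qed.

Local Notation hyp := (hyperelliptic_involution char2 iota (val a) (val b) (val c) d).

Lemma is_lin_hyp : is_lin G_x 1 hyp.
Proof.
move=> P; rewrite /= /linrow /hyp_row /Gamma_mx !mxE /= !(rmorph0, rmorph1).
by congr (<[row5 _ _ _ _ _]>%VS); ring.
Qed.

Lemma hyp_mulV : (hyp * hyp = 1)%g.
Proof. by apply: sym_ext => P; apply: (hyp_funK char2). Qed.

Lemma cyclic_hyp phi : phi \in cyclic_subgroup hyp <-> phi = 1%g \/ phi = hyp.
Proof.
have hV : (hyp^-1 = hyp)%g by rewrite -[LHS]mulg1 -hyp_mulV mulKg.
have hX m : (hyp ^+ m = 1)%g \/ (hyp ^+ m = hyp)%g.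
  elim: m => [|m [e|e]]; first by left.
    by right; rewrite expgS e mulg1.
  by left; rewrite expgS e hyp_mulV.
split=> [/asboolP[m [->|->]]|[->|->]].
- exact: hX.
- by case: (hX m) => ->; [left; rewrite invg1|right].
- by apply/asboolP; exists 0%N; left.
- by apply/asboolP; exists 1%N; left; rewrite expg1.
Qed.

Lemma twist1 u : n = twist G_x u n -> u = 0 \/ u = 1.
Proof.
case=> /eqP; rewrite -subr_eq0 opprD addrA subrr sub0r oppr_eq0 expr2.
rewrite -{1}[u]mulr1 -mulrDr mulf_eq0 => /orP[/eqP|]; [by left|right].
by apply/eqP; rewrite -subr_eq0 (oppr_pchar2 char2) addrC.
Qed.

Lemma isotropyP y : y \in isotropy iota calN_n <->
  exists2 g, y = Gamma_PGL2 iota g & Gamma_act calN_n g = calN_n.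
Proof.
by split=> [/asboolP[g e yE]|[g yE e]]; [exists g|apply/asboolP; exists g].
Qed.

Lemma fixed_twist g : Gamma_act calN_n g = calN_n <-> exists u, n = twist g u n.
Proof.
by rewrite -(Gamma_act_twist a b c a b c d d g); split=> /esym.
Qed.

End OneCurve.
End Automorphisms.

(** * The isotropy groups *)

Section Isotropy.
Variables (k : fieldType) (char2 : 2%N \in [pchar k]).
Variables (K : closedFieldType) (iota : {rmorphism k -> K}).
Variables (a b c : kstar k) (d : k).
Local Notation calN_n := (a, b, c, ASclass char2 d).

Lemma Gamma_fixedP g : Gamma_act calN_n g = calN_n <->
  match g with
  | G_x     => True
  | G_inv   => a = b /\ val c \in AS char2
  | G_add1  => b = c /\ val a \in AS char2
  | G_x_div => a = c /\ val b \in AS char2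
  | _       => a = b /\ b = c
  end.
Proof.
have kk (x : k) : x + x = 0 by apply: addrr_pchar2.
have root (x y z : k) : x = x + y + z -> y = z.
  move=> e; apply/eqP; rewrite -subr_eq0 (oppr_pchar2 char2).
  by apply/eqP/(addrI x); rewrite addrA -e addr0.
have vi (x y : kstar k) : val x = val y -> x = y by apply: val_inj.
rewrite fixed_twist; case: g => /=.
- by split=> // _; exists 0; rewrite expr0n !addr0.
- split=> [[u [/vi-> _ /root e]]|[-> /asboolP[u ->]]].
    by split=> //; apply/asboolP; exists u.
  by exists u; rewrite -addrA kk addr0.
- split=> [[u [/vi-> _ /root e]]|[-> /asboolP[u ->]]].
    by split=> //; apply/asboolP; exists u.
  by exists u; rewrite -addrA kk addr0.
- split=> [[u [/vi-> _]]|[-> /asboolP[u bE]]].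
    rewrite [d + val c + _]addrAC -[d + _ + val c + val c]addrA kk addr0 => /root e.
    by split=> //; apply/asboolP; exists u.
  exists u; rewrite [d + val c + _]addrAC -[d + _ + val c + val c]addrA kk addr0.
  by rewrite -bE -addrA kk addr0.
- split=> [[u [/vi-> /vi-> _ _]]|[-> ->]] //.
  by exists 0; rewrite expr0n !addr0 -addrA kk addr0.
split=> [[u [/vi-> /vi-> _ _]]|[-> ->]] //.
by exists 0; rewrite expr0n !addr0 -addrA kk addr0.
Qed.

Lemma Gamma_fixedM g h : Gamma_act calN_n g = calN_n -> Gamma_act calN_n h = calN_n ->
  Gamma_act calN_n (Gamma_mul g h) = calN_n.
Proof. by move=> eg eh; rewrite -Gamma_actM eg. Qed.

(** [Gamma] is a bare enumeration, so a group structure is transported through a bijection s from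
    the fixing elements to gT, multiplicative for [Gamma_mul]. *)
Lemma isotropy_iso (gT : finGroupType) (H : Gamma -> Prop) (s : Gamma -> gT) :
  (forall g, H g <-> Gamma_act calN_n g = calN_n) ->
  (forall g h, H g -> H h -> s (Gamma_mul g h) = s g * s h)%g ->
  (forall g h, H g -> H h -> s g = s h -> g = h) ->
  (forall x, exists2 g, H g & s g = x) ->
  isomorphic_to (isotropy iota calN_n) gT.
Proof.
move=> HE sM s_inj s_surj.
pose r x := projT1 (cid2 (s_surj x)).
have rH x : H (r x) by rewrite /r; case: cid2.
have rK x : s (r x) = x by rewrite /r; case: cid2.
have HM g h : H g -> H h -> H (Gamma_mul g h).
  by move=> /HE hg /HE hh; apply/HE; apply: Gamma_fixedM.
exists (fun x => Gamma_PGL2 iota (r x)); split.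
- move=> x y; rewrite Gamma_PGL2M //; congr (Gamma_PGL2 _ _).
  by apply: s_inj; rewrite ?sM ?rK //; apply: HM.
- by move=> x y /(Gamma_PGL2_inj char2) e; rewrite -(rK x) e rK.
move=> y; rewrite isotropyP; split=> [[g -> /HE Hg]|[x <-]].
  by exists (s g); congr (Gamma_PGL2 _ _); apply: s_inj; rewrite ?rK.
by exists (r x) => //; apply/HE.
Qed.

End Isotropy.

(** * Gamma as the symmetric group *)

Section GammaS3.

(* Composition of permutations reads from left to right in 'S_3, hence this    *)
(* table lists the inverses of the permutations of (a, b, c) by Gamma_act.     *)
Definition Gamma_table (g : Gamma) : seq nat :=
  match g with
  | G_x        => [:: 0; 1; 2]
  | G_inv      => [:: 1; 0; 2]
  | G_add1     => [:: 0; 2; 1]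
  | G_x_div    => [:: 2; 1; 0]
  | G_1_div    => [:: 2; 0; 1]
  | G_add1_div => [:: 1; 2; 0]
  end.

Definition Gamma_fun (g : Gamma) (i : 'I_3) : 'I_3 := @inord 2 (nth 0 (Gamma_table g) i).

Lemma Gamma_funE g i : nat_of_ord (Gamma_fun g i) = nth 0 (Gamma_table g) i.
Proof. by rewrite inordK //; case: g; case: i => [[|[|[|i]]]]. Qed.

Lemma Gamma_fun_inj g : injective (Gamma_fun g).
Proof.
move=> i j /(congr1 (@nat_of_ord 3)); rewrite !Gamma_funE => e; apply: ord_inj.
by move: e; case: g; case: i => [[|[|[|i]]]] //= ?; case: j => [[|[|[|j]]]].
Qed.

Definition Gamma_perm g : 'S_3 := perm (@Gamma_fun_inj g).

Lemma Gamma_permM g h : Gamma_perm (Gamma_mul g h) = (Gamma_perm g * Gamma_perm h)%g.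
Proof.
apply/permP => i; rewrite permM !permE; apply: ord_inj; rewrite !Gamma_funE.
by case: g; case: h; case: i => [[|[|[|i]]]].
Qed.

Lemma Gamma_perm_inj : injective Gamma_perm.
Proof.
move=> g h /permP e; have := e (@inord 2 0); have := e (@inord 2 1).
rewrite !permE => /(congr1 (@nat_of_ord 3)) + /(congr1 (@nat_of_ord 3)).
by rewrite !Gamma_funE !inordK //; case: g {e}; case: h.
Qed.

(** An injection between sets of six elements is onto. *)
Lemma Gamma_perm_surj x : exists g, Gamma_perm g = x.
Proof.
pose Gs := [:: G_x; G_inv; G_add1; G_x_div; G_1_div; G_add1_div].
pose F (i : 'I_6) := Gamma_perm (nth G_x Gs i).
have F_inj : injective F.
  move=> [i i6] [j j6] /Gamma_perm_inj /= e; apply: ord_inj => /=.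
  by move: e; case: i i6 => [|[|[|[|[|[|i]]]]]] // _; case: j j6 => [|[|[|[|[|[|j]]]]]].
have : x \in codom F by apply: inj_card_onto => //; rewrite card_Sn card_ord.
by case/codomP=> i ->; exists (nth G_x Gs i).
Qed.

End GammaS3.

Section CyclicIsotropy.
Variables (k : fieldType) (char2 : 2%N \in [pchar k]).
Variables (K : closedFieldType) (iota : {rmorphism k -> K}).
Variables (a b c : kstar k) (d : k).
Local Notation calN_n := (a, b, c, ASclass char2 d).

Lemma isotropy_Z3 : a = b -> b = c -> val a \notin AS char2 ->
  isomorphic_to (isotropy iota calN_n) 'Z_3.
Proof.
move=> ab bc nAS; pose H g := match g with G_x | G_1_div | G_add1_div => True | _ => False end.
pose s g : 'Z_3 := match g with G_1_div => inZp 1 | G_add1_div => inZp 2 | _ => inZp 0 end.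
apply: (@isotropy_iso _ _ _ _ _ _ _ _ _ H s) => [g|g h|g h|x].
- rewrite Gamma_fixedP; case: g => //=; subst; split=> // -[] // _; exact/negP.
- by case: g => //; case: h => // _ _; apply: ord_inj.
- by case: g => //; case: h.
case: x => [[|[|[|x]]]] // x3; [exists G_x|exists G_1_div|exists G_add1_div] => //;
  exact: ord_inj.
Qed.

Lemma isotropy_Z2 t : Gamma_mul t t = G_x -> t <> G_x ->
  (forall g, Gamma_act calN_n g = calN_n <-> g = G_x \/ g = t) ->
  isomorphic_to (isotropy iota calN_n) 'Z_2.
Proof.
move=> tt t1 HE; pose s g : 'Z_2 := match g with G_x => inZp 0 | _ => inZp 1 end.
have st : s t = inZp 1 by case: (t) t1.
apply: (@isotropy_iso _ _ _ _ _ _ _ _ _ (fun g => g = G_x \/ g = t) s) => [g|g h|g h|x].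
- by rewrite HE.
- have tx : Gamma_mul t G_x = t by case: (t).
  by move=> [->|->] [->|->]; rewrite ?tt ?tx ?st; apply: ord_inj.
- by move=> [->|->] [->|->] //; rewrite st => /(congr1 (@nat_of_ord _)).
case: x => [[|[|x]]] // x2; [exists G_x|exists t]; try (by left); try (by right).
  exact: ord_inj.
by rewrite st; apply: ord_inj.
Qed.

End CyclicIsotropy.

(** * Isomorphism classes, the split sequence and the isotropy types *)

Theorem proposition8
  (k : fieldType) (char2 : 2%N \in [pchar k]) (perf_k : perfect_field k)
  (K : closedFieldType) (iota : {rmorphism k -> K})
  (algK : forall z : K, algebraicOver iota z) :
  (forall (a b c a' b' c' : kstar k) (d d' : k),
     isomorphic iota (curve (val a') (val b') (val c') d')
                     (curve (val a) (val b) (val c) d)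
     <-> exists g : Gamma, (a', b', c', ASclass char2 d')
                           = Gamma_act (a, b, c, ASclass char2 d) g)
  /\
  (forall (a b c : kstar k) (d : k),
     let C := curve (val a) (val b) (val c) d in
     let Gamma_abcd := isotropy iota (a, b, c, ASclass char2 d) in
     let hyp := hyperelliptic_involution char2 iota (val a) (val b) (val c) d in
     (exists p : sym (pvariety iota C) -> sym (pspace K 1),
        (forall phi : sym (pvariety iota C), phi \in var_aut iota C ->
           forall P, xcoord (phi P) = p phi (xcoord P))
        /\ split_exact (cyclic_subgroup hyp) (var_aut iota C) Gamma_abcd p)
     /\
     (if [&& a == b, b == c & val a \in AS char2] then
        isomorphic_to Gamma_abcd 'S_3
      else if [&& a == b, b == c & val a \notin AS char2] then
        isomorphic_to Gamma_abcd 'Z_3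
      else if [|| [&& a == b, a != c & val c \in AS char2],
                  [&& a == c, a != b & val b \in AS char2]
                | [&& b == c, a != b & val a \in AS char2]] then
        isomorphic_to Gamma_abcd 'Z_2
      else Gamma_abcd =i pred1 1%g)).
Proof.
split=> [a b c a' b' c' d d'|a b c d].
  split=> [[f [g [fK gK rf rg]]]|[g /Gamma_act_twist[u e]]].
    have [h [u [e _]]] := classification char2 (valP a') (valP b') (valP c') (valP a)
      fK gK rf rg.
    by exists h; apply/Gamma_act_twist; exists u.
  have [f [f' [fK f'K fE fE']]] := lin_map_iso_eq char2 iota e.
  by exists f, f'; split=> //; [exact: lin_map_regular fE|exact: lin_map_regular fE'].
move=> C Gamma_abcd hyp; pose n := (val a, val b, val c, d).
split.
  pose lin g u (phi : sym (pvariety iota C)) := @lin_map _ _ iota n n g u (Defs.symf phi).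
  (* An automorphism goes to the Moebius map of its linear description; other permutations of the
     points go to 1. *)
  have /choice[p pP] (phi : sym (pvariety iota C)) : exists q, phi \in var_aut iota C ->
      exists g u, [/\ n = twist g u n, lin g u phi & q = Gamma_PGL2 iota g].
    have [/(var_aut_lin char2)[g [u [e phiE]]]|nA] := boolP (phi \in var_aut iota C).
      by exists (Gamma_PGL2 iota g) => _; exists g, u.
    by exists 1%g.
  have p_lin g u phi : phi \in var_aut iota C -> lin g u phi -> p phi = Gamma_PGL2 iota g.
    move=> /pP[h [v [_ e ->]]] e'; congr (Gamma_PGL2 _ _).
    exact: (is_lin_Gamma char2 e e').
  have AM (phi psi : sym (pvariety iota C)) : phi \in var_aut iota C ->
      psi \in var_aut iota C -> (phi * psi)%g \in var_aut iota C.
    move=> /asboolP[rf rf'] /asboolP[rg rg']; apply/asboolP; split.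
      exact: (regular_comp rf rg).
    by rewrite invMg; apply: (regular_comp rg' rf').
  have lin_aut g u phi : n = twist g u n -> lin g u phi -> phi \in var_aut iota C.
    move=> e phiE; have [psi psiA psiE] := lin_var_aut char2 iota e.
    by rewrite (is_lin_eq phiE psiE).
  (* Over g = 1 the shifts 0 and 1 give the identity and the involution. *)
  have tw0 : n = twist G_x 0 n by rewrite /= expr0n !addr0.
  have tw1 : n = twist G_x 1 n.
    by rewrite /= expr1n (addrr_pchar2 char2) addr0.
  have A1 := lin_aut _ _ _ tw0 (@is_lin1 _ char2 _ iota a b c d).
  exists p; split.
    by move=> phi /pP[g [u [_ e ->]]] P; apply: lin_map_xcoord e.
  split.
  - move=> phi psi phiA psiA; have [g [u [eg gE ->]]] := pP _ phiA.
    have [h [v [eh hE ->]]] := pP _ psiA; rewrite Gamma_PGL2M //.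
    by apply: p_lin; [exact: AM|exact: (is_linM char2 gE hE)].
  - move=> phi; rewrite cyclic_hyp; split=> [[->|->]|[phiA p1]].
    + by split=> //; rewrite (p_lin _ _ _ A1 (@is_lin1 _ char2 _ iota a b c d)) Gamma_PGL2_1.
    + have hypE := @is_lin_hyp _ char2 _ iota a b c d.
      have hypA := lin_aut _ _ _ tw1 hypE.
      by split=> //; rewrite (p_lin _ _ _ hypA hypE) Gamma_PGL2_1.
    have [g [u [e gE pE]]] := pP _ phiA.
    have g1 : g = G_x by apply: (@Gamma_PGL2_inj _ char2 _ iota); rewrite -pE p1 Gamma_PGL2_1.
    move: e gE; rewrite g1 => /(twist1 char2)[->|->] gE; [left|right].
      exact: is_lin_eq gE (@is_lin1 _ char2 _ iota a b c d).
    exact: is_lin_eq gE (@is_lin_hyp _ char2 _ iota a b c d).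
  - move=> y; rewrite isotropyP; split=> [[g -> /fixed_twist[u e]]|[phi phiA <-]].
      have [phi phiA phiE] := lin_var_aut char2 iota e.
      by exists phi => //; apply: p_lin phiE.
    have [g [u [e _ ->]]] := pP _ phiA.
    by exists g => //; apply/fixed_twist; exists u.
  (* The section lifts g with the shift prescribed by [shift], so that [shiftM] makes it
     multiplicative. *)
  have /choice[s sP] (y : sym (pspace K 1)) : exists phi, y \in Gamma_abcd ->
      exists g u, [/\ y = Gamma_PGL2 iota g, n = twist g u n
        & lin g (shift (val a) (val b) (val c) g) phi].
    have [/isotropyP[g yE /fixed_twist[u e]]|nB] := boolP (y \in Gamma_abcd); last first.
      by exists 1%g.
    have [phi phiA phiE] := lin_var_aut char2 iota (shift_twist char2 e).
    by exists phi => _; exists g, u.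
  have sA y : y \in Gamma_abcd -> s y \in var_aut iota C.
    move=> /sP[g [u [_ e sE]]]; apply: lin_aut sE; exact: shift_twist e.
  exists s; split=> //.
    move=> y z yB zB; have [g [u [yE eg gE]]] := sP _ yB; have [h [v [zE eh hE]]] := sP _ zB.
    have yzE : (y * z)%g = Gamma_PGL2 iota (Gamma_mul g h) by rewrite yE zE Gamma_PGL2M.
    have yzB : (y * z)%g \in Gamma_abcd.
      apply/isotropyP; exists (Gamma_mul g h) => //; rewrite -Gamma_actM.
      have -> : Gamma_act (a, b, c, ASclass char2 d) g = (a, b, c, ASclass char2 d).
        by apply/fixed_twist; exists u.
      by apply/fixed_twist; exists v.
    have [gh [w [ghE egh yzs]]] := sP _ yzB.
    have e : gh = Gamma_mul g h.
      by apply: (@Gamma_PGL2_inj _ char2 _ iota); rewrite -ghE yzE.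
    rewrite e (shiftM char2 eg eh) in yzs.
    exact: is_lin_eq yzs (is_linM char2 gE hE).
  move=> y yB; have [g [u [yE e sE]]] := sP _ yB.
  by rewrite [RHS]yE; apply: p_lin sE; apply: sA.
have fixP := Gamma_fixedP char2 a b c d.
case: ifP => [/and3P[/eqP ab /eqP bc aAS]|ncase1].
  apply: (@isotropy_iso _ _ _ _ _ _ _ _ _ (fun=> True) Gamma_perm) => [g|g h _ _|g h _ _|x].
  - by rewrite fixP; case: g => //=; subst.
  - exact: Gamma_permM.
  - exact: Gamma_perm_inj.
  by have [g] := Gamma_perm_surj x; exists g.
case: ifP => [/and3P[/eqP ab /eqP bc aAS]|ncase2]; first exact: isotropy_Z3.
(* With a = b = c excluded, rotations fix nothing, and the condition for each transposition gains an
   inequality; the three conditions become mutually exclusive. *)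
have fixed g : Gamma_act (a, b, c, ASclass char2 d) g = (a, b, c, ASclass char2 d) <->
    match g with
    | G_x     => True
    | G_inv   => [&& a == b, a != c & val c \in AS char2]
    | G_add1  => [&& b == c, a != b & val a \in AS char2]
    | G_x_div => [&& a == c, a != b & val b \in AS char2]
    | _       => False
    end.
  have nall : a = b -> b = c -> False.
    move=> ab bc; move: ncase1 ncase2; rewrite ab bc eqxx /=.
    by case: (val c \in AS char2).
  rewrite fixP; case: g => //; split=> //.
  - by case=> ab ->; rewrite ab eqxx andbT; apply/eqP => bc; apply: nall.
  - by case/and3P=> /eqP.
  - by case=> bc ->; rewrite bc eqxx andbT; apply/eqP => ab; apply: nall; rewrite ?ab.
  - by case/and3P=> /eqP.
  - case=> ac ->; rewrite ac eqxx andbT; apply/eqP => cb.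
    exact: (nall (etrans ac cb) (esym cb)).
  - by case/and3P=> /eqP.
  - by case=> /nall.
  by case=> /nall.
have other g g' : Gamma_act (a, b, c, ASclass char2 d) g = (a, b, c, ASclass char2 d) ->
    Gamma_act (a, b, c, ASclass char2 d) g' = (a, b, c, ASclass char2 d) ->
    g' <> G_x -> g = G_x \/ g = g'.
  move=> /fixed fg /fixed; case: g' => // + _; case: g fg => //= + +;
    try (by left); try (by right);
    by do 2![case/and3P=> /eqP ? /eqP ? _]; subst.
case: ifP => [/or3P[] fx|ncase3].
- apply: (@isotropy_Z2 _ _ _ _ _ _ _ _ G_inv) => // g; split=> [fg|[]->]; last exact/fixed.
    by apply: other fg _ _ => //; apply/fixed.
  exact/fixed.
- apply: (@isotropy_Z2 _ _ _ _ _ _ _ _ G_x_div) => // g; split=> [fg|[]->]; last exact/fixed.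
    by apply: other fg _ _ => //; apply/fixed.
  exact/fixed.
- apply: (@isotropy_Z2 _ _ _ _ _ _ _ _ G_add1) => // g; split=> [fg|[]->]; last exact/fixed.
    by apply: other fg _ _ => //; apply/fixed.
  exact/fixed.
have g1 g : Gamma_act (a, b, c, ASclass char2 d) g = (a, b, c, ASclass char2 d) -> g = G_x.
  by move/fixed; case: g => // fg; move: ncase3; rewrite fg ?orbT.
move=> y; apply/idP/eqP => [/isotropyP[g -> /g1->]|->]; first exact: Gamma_PGL2_1.
by apply/isotropyP; exists G_x => //; rewrite Gamma_PGL2_1.
Qed.
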